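(* Let $\mathcal{L}$ be an operator $*$-algebra and let $(H,\pi,U)$ be a standard form representation of $\mathcal{L}$. Moreover, let $P\in B(H)$ be an orthogonal projection such that (1) $PU=UP$; (2) $P\pi(\mathcal{L})\subseteq\pi(\mathcal{L})$ and $\pi(\mathcal{L})P\subseteq\pi(\mathcal{L})$. Then the closed subalgebras $P\pi(\mathcal{L})P$ and $\mathcal{B}:=(1-P)\pi(\mathcal{L})(1-P)$ of $B(H)$ are operator $*$-algebras in the involution $T^\dagger:=UT^*U$, $T\in B(H)$. Furthermore, for any closed subalgebra $\mathcal{A}\subseteq P\pi(\mathcal{L})P$ with $\mathcal{A}^\dagger=\mathcal{A}$, the closed subspace $\mathcal{X}:=P\pi(\mathcal{L})(1-P)\subseteq B(H)$ is an operator $*$-correspondence from $\mathcal{A}$ to $\mathcal{B}$ with bimodule structure coming from the algebra structure on $B(H)$ and with the inner product $$\langle S,T\rangle_{\mathcal{X}}:=S^\dagger\cdot T:=US^*UT,\quad S,T\in\mathcal{X}.$$ Moreover, up to cb-isomorphism, any operator $*$-correspondence arises in this way: for every operator $*$-correspondence $\mathcal{Y}$ (from an operator $*$-algebra $\mathcal{C}$ to an operator $*$-algebra $\mathcal{D}$) there exist $\mathcal{L}$, $(H,\pi,U)$, $P$ and $\mathcal{A}$ as described such that $\mathcal{Y}$ is cb-isomorphic, as an operator $*$-correspondence, to the resulting $\mathcal{X}$.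
   Context: An operator space is a complex vector space $\mathcal{X}$ with norms on $M_n(\mathcal{X})$, $n\in\mathbb{N}$, such that: $\mathcal{X}=M_1(\mathcal{X})$ is complete; $\|\lambda\xi\mu\|\le\|\lambda\|\,\|\xi\|\,\|\mu\|$ for $\lambda,\mu\in M_n(\mathbb{C})$, $\xi\in M_n(\mathcal{X})$; $\|\xi\oplus\eta\|=\max\{\|\xi\|,\|\eta\|\}$. A closed subspace of $B(H)$ is an operator space with matrix norms from $B(H^{\oplus n})$. A linear map is completely bounded if the maps it induces entrywise on all $M_n$ are bounded by one common constant; a cb-isomorphism of operator spaces is an invertible completely bounded map with completely bounded inverse. An operator algebra is an operator space $\mathcal{A}$ that is an algebra over $\mathbb{C}$ with $\|xy\|\le\|x\|\,\|y\|$ for all $n$ and $x,y\in M_n(\mathcal{A})$ (no unit or approximate identity is assumed). An operator $*$-algebra is an operator algebra that is a $*$-algebra with an involution $\dagger$ satisfying $\|x^\dagger\|=\|x\|$ for all $n$ and $x\in M_n(\mathcal{A})$, where $(x^\dagger)_{ij}=(x_{ji})^\dagger$. A cb-isomorphism of operator $*$-algebras is a cb-isomorphism that is an algebra homomorphism and commutes with the involutions. A standard form representation of an operator $*$-algebra $\mathcal{L}$ is a triple $(H,\pi,U)$ where $H$ is a Hilbert space, $U\in B(H)$ is a selfadjoint unitary and $\pi$ is a completely bounded algebra homomorphism from $\mathcal{L}$ onto a closed subalgebra of $B(H)$ with completely bounded inverse (defined on the image), such that $\pi(a)^*=U\pi(a^\dagger)U$ for all $a\in\mathcal{L}$. A right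 operator $\mathcal{B}$-module is an operator space $\mathcal{X}$ that is a right $\mathcal{B}$-module with $\|\xi\cdot b\|\le\|\xi\|\,\|b\|$ for all $n$, $\xi\in M_n(\mathcal{X})$, $b\in M_n(\mathcal{B})$; left operator modules similarly. An operator $*$-module over an operator $*$-algebra $\mathcal{B}$ is a right operator $\mathcal{B}$-module $\mathcal{X}$ with a pairing $\langle\cdot,\cdot\rangle_{\mathcal{X}}:\mathcal{X}\times\mathcal{X}\to\mathcal{B}$, linear in the second variable, with $\langle\xi,\eta b\rangle=\langle\xi,\eta\rangle b$, $\langle\xi,\eta\rangle=\langle\eta,\xi\rangle^\dagger$, and $\|\langle\xi,\eta\rangle\|\le\|\xi\|\,\|\eta\|$ for all $n$ and $\xi,\eta\in M_n(\mathcal{X})$, where $\langle\xi,\eta\rangle_{ij}=\sum_k\langle\xi_{ki},\eta_{kj}\rangle$. An operator $*$-correspondence from $\mathcal{A}$ to $\mathcal{B}$ is an operator $*$-module $\mathcal{X}$ over $\mathcal{B}$ with a left operator $\mathcal{A}$-module structure such that $a(\xi b)=(a\xi)b$ and $\langle a\xi,\eta\rangle=\langle\xi,a^\dagger\eta\rangle$. Operator $*$-correspondences $\mathcal{X}$ (from $\mathcal{A}$ to $\mathcal{B}$) and $\mathcal{Y}$ (from $\mathcal{C}$ to $\mathcal{D}$) are cb-isomorphic when there are a cb-isomorphism of operator spaces $\phi:\mathcal{X}\to\mathcal{Y}$ and cb-isomorphisms of operator $*$-algebras $\alpha:\mathcal{A}\to\mathcal{C}$, $\beta:\mathcal{B}\to\mathcal{D}$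 with $\phi(a\xi)=\alpha(a)\phi(\xi)$, $\phi(\xi b)=\phi(\xi)\beta(b)$ and $\langle\phi(\xi),\phi(\eta)\rangle_{\mathcal{Y}}=\beta(\langle\xi,\eta\rangle_{\mathcal{X}})$. *)

(* Defs.v *)
(* The complex numbers are R[i] for R : realType. *)
From HB Require Import structures.
From mathcomp Require Import all_boot all_order all_algebra.
From mathcomp Require Import sesquilinear complex.
From mathcomp Require Import all_classical reals topology normedtype sequences.

Set Implicit Arguments.
Unset Strict Implicit.
Unset Printing Implicit Defensive.

Import Order.TTheory GRing.Theory Num.Theory.
Import numFieldNormedType.Exports.

Local Open Scope classical_set_scope.
Local Open Scope ring_scope.

(* Operator spaces, algebras and modules are raw data on a set (the carrier)
   inside an ambient vector space, together with predicates (is_...) that state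
   the axioms relative to that set. An abstract space is the case where the
   carrier is setT; a subspace of B(H) is a set inside the vector space H -> H.
   The values of the operations outside the carriers are irrelevant.

   The matrix norms are indexed by all n, including n = 0; on the zero space
   M_0 the norm axioms force the norm to be 0, so this adds no content. *)

Section MatrixOperations.

Definition mx_in (V : Type) (E : set V) m n (x : 'M[V]_(m, n)) : Prop :=
  forall i j, E (x i j).

(* The matrix product induced by a binary operation. *)
Definition mulmx_by (U V : Type) (W : nmodType) (op : U -> V -> W) m n p
    (x : 'M[U]_(m, n)) (y : 'M[V]_(n, p)) : 'M[W]_(m, p) :=
  \matrix_(i, j) \sum_k op (x i k) (y k j).

End MatrixOperations.

Section Subsets.
Variable C : pzRingType.

Definition subspace_set (V : lmodType C) (E : set V) : Prop :=
  E 0 /\ (forall (a : C) x y, E x -> E y -> E (a *: x + y)).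

Definition linear_on (V W : lmodType C) (E : set V) (f : V -> W) : Prop :=
  forall (a : C) x y, E x -> E y -> f (a *: x + y) = a *: f x + f y.

Definition bilinear_on (V W Z : lmodType C) (E : set V) (F : set W) (G : set Z)
    (op : V -> W -> Z) : Prop :=
  [/\ forall x y, E x -> F y -> G (op x y),
      forall y, F y -> linear_on E (op^~ y)
    & forall x, E x -> linear_on F (op x)].

End Subsets.

Section Norms.
Variable R : realType.

(* The norm of a normed R[i]-space, which the library takes in R[i], as an
   element of R. *)
Definition rnorm (V : normedZmodType R[i]) (x : V) : R := complex.Re `|x|.

Definition l2norm (V : normedZmodType R[i]) n (x : 'cV[V]_n) : R :=
  Num.sqrt (\sum_i rnorm (x i 0) ^+ 2).

Definition unit_ball (V : normedZmodType R[i]) n : set 'cV[V]_n :=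
  [set x | l2norm x <= 1].

(* The C*-norm of M_n(C) = B(C^n). *)
Definition scalar_mxnorm n (l : 'M[R[i]]_n) : R :=
  sup [set l2norm (l *m x) | x in @unit_ball R[i] n].

End Norms.

Section OperatorSpaces.
Variable R : realType.

Record mnspace := MNSpace {
  mn_sort :> lmodType R[i];
  carrier : set mn_sort;
  mxnorm : forall n, 'M[mn_sort]_n -> R }.

Arguments carrier : clear implicits.

Definition vnorm (X : mnspace) (x : X) : R := mxnorm (const_mx x : 'M_1).

Record is_operator_space (X : mnspace) : Prop := {
  os_subspace : subspace_set (carrier X);
  os_norm_eq0 : forall n (x : 'M[X]_n),
    mx_in (carrier X) x -> mxnorm x = 0 -> x = 0;
  os_normZ : forall n (a : R[i]) (x : 'M[X]_n), mx_in (carrier X) x ->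
    mxnorm (map_mx ( *:%R a) x) = rnorm a * mxnorm x;
  os_normD : forall n (x y : 'M[X]_n), mx_in (carrier X) x -> mx_in (carrier X) y ->
    mxnorm (x + y) <= mxnorm x + mxnorm y;
  os_complete : forall u : nat -> X, (forall n, carrier X (u n)) ->
    (forall e : R, 0 < e -> exists N, forall p q, (N <= p)%N -> (N <= q)%N ->
       vnorm (u p - u q) < e) ->
    exists l, carrier X l /\ (fun n => vnorm (u n - l)) @ \oo --> (0 : R);
  os_scale : forall n (l m : 'M[R[i]]_n) (x : 'M[X]_n), mx_in (carrier X) x ->
    mxnorm (mulmx_by (fun v (a : R[i]) => a *: v) (mulmx_by *:%R l x) m)
      <= scalar_mxnorm l * mxnorm x * scalar_mxnorm m;
  os_dsum : forall n m (x : 'M[X]_n) (y : 'M[X]_m),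
    mx_in (carrier X) x -> mx_in (carrier X) y ->
    mxnorm (block_mx x 0 0 y) = Num.max (mxnorm x) (mxnorm y) }.

Record completely_bounded (X Y : mnspace) (f : X -> Y) : Prop := {
  cb_maps : forall x, carrier X x -> carrier Y (f x);
  cb_linear : linear_on (carrier X) f;
  cb_bound : exists K : R, forall n (x : 'M[X]_n), mx_in (carrier X) x ->
    mxnorm (map_mx f x) <= K * mxnorm x }.

Definition cb_isomorphism (X Y : mnspace) (f : X -> Y) : Prop :=
  completely_bounded f /\
  exists g : Y -> X, [/\ completely_bounded g,
    forall x, carrier X x -> g (f x) = x & forall y, carrier Y y -> f (g y) = y].

End OperatorSpaces.

Arguments carrier {R} m _.

Section OperatorAlgebras.
Variable R : realType.

Record mnalgebra := MNAlgebra {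
  alg_space :> mnspace R;
  amul : alg_space -> alg_space -> alg_space }.

Record is_operator_algebra (A : mnalgebra) : Prop := {
  oa_space : is_operator_space A;
  oa_bilinear : bilinear_on (carrier A) (carrier A) (carrier A) (@amul A);
  oa_assoc : forall x y z : A, carrier A x -> carrier A y -> carrier A z ->
    amul x (amul y z) = amul (amul x y) z;
  oa_norm : forall n (x y : 'M[A]_n), mx_in (carrier A) x -> mx_in (carrier A) y ->
    mxnorm (mulmx_by (@amul A) x y) <= mxnorm x * mxnorm y }.

Record mnstaralgebra := MNStarAlgebra {
  star_alg :> mnalgebra;
  invol : star_alg -> star_alg }.

Record is_operator_star_algebra (A : mnstaralgebra) : Prop := {
  osa_algebra : is_operator_algebra A;
  osa_closed : forall x : A, carrier A x -> carrier A (invol x);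
  osa_conjlinear : forall (a : R[i]) (x y : A), carrier A x -> carrier A y ->
    invol (a *: x + y) = Num.conj a *: invol x + invol y;
  osa_mul : forall x y : A, carrier A x -> carrier A y ->
    invol (amul x y) = amul (invol y) (invol x);
  osa_invol : forall x : A, carrier A x -> invol (invol x) = x;
  osa_norm : forall n (x : 'M[A]_n), mx_in (carrier A) x ->
    mxnorm (map_mx (@invol A) x^T) = mxnorm x }.

Record star_cb_isomorphism (A B : mnstaralgebra) (f : A -> B) : Prop := {
  sci_cb : cb_isomorphism f;
  sci_mul : forall x y : A, carrier A x -> carrier A y ->
    f (amul x y) = amul (f x) (f y);
  sci_invol : forall x : A, carrier A x -> f (invol x) = invol (f x) }.

Record is_right_operator_module (X : mnspace R) (B : mnalgebra)
    (ract : X -> B -> X) : Prop := {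
  rom_space : is_operator_space X;
  rom_bilinear : bilinear_on (carrier X) (carrier B) (carrier X) ract;
  rom_assoc : forall (x : X) (b c : B), carrier X x -> carrier B b -> carrier B c ->
    ract x (amul b c) = ract (ract x b) c;
  rom_norm : forall n (x : 'M[X]_n) (b : 'M[B]_n),
    mx_in (carrier X) x -> mx_in (carrier B) b ->
    mxnorm (mulmx_by ract x b) <= mxnorm x * mxnorm b }.

Record is_left_operator_module (A : mnalgebra) (X : mnspace R)
    (lact : A -> X -> X) : Prop := {
  lom_space : is_operator_space X;
  lom_bilinear : bilinear_on (carrier A) (carrier X) (carrier X) lact;
  lom_assoc : forall (a b : A) (x : X), carrier A a -> carrier A b -> carrier X x ->
    lact (amul a b) x = lact a (lact b x);
  lom_norm : forall n (a : 'M[A]_n) (x : 'M[X]_n),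
    mx_in (carrier A) a -> mx_in (carrier X) x ->
    mxnorm (mulmx_by lact a x) <= mxnorm a * mxnorm x }.

Record is_operator_star_module (X : mnspace R) (B : mnstaralgebra)
    (ract : X -> B -> X) (pairing : X -> X -> B) : Prop := {
  osm_algebra : is_operator_star_algebra B;
  osm_module : is_right_operator_module ract;
  osm_closed : forall x y, carrier X x -> carrier X y -> carrier B (pairing x y);
  osm_linear : forall x, carrier X x -> linear_on (carrier X) (pairing x);
  osm_pairM : forall (x y : X) (b : B), carrier X x -> carrier X y -> carrier B b ->
    pairing x (ract y b) = amul (pairing x y) b;
  osm_pairC : forall x y, carrier X x -> carrier X y -> pairing x y = invol (pairing y x);
  osm_norm : forall n (x y : 'M[X]_n), mx_in (carrier X) x -> mx_in (carrier X) y ->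
    mxnorm (mulmx_by pairing x^T y) <= mxnorm x * mxnorm y }.

Record mncorrespondence (A B : mnstaralgebra) := MNCorrespondence {
  corr_space :> mnspace R;
  lact : A -> corr_space -> corr_space;
  ract : corr_space -> B -> corr_space;
  pairing : corr_space -> corr_space -> B }.

Record is_operator_star_correspondence (A B : mnstaralgebra)
    (X : mncorrespondence A B) : Prop := {
  osc_algebra : is_operator_star_algebra A;
  osc_star_module : is_operator_star_module (@ract A B X) (@pairing A B X);
  osc_left_module : is_left_operator_module (@lact A B X);
  osc_bimodule : forall (a : A) (x : X) (b : B),
    carrier A a -> carrier X x -> carrier B b ->
    lact a (ract x b) = ract (lact a x) b;
  osc_adjoint : forall (a : A) (x y : X), carrier A a -> carrier X x -> carrier X y ->
    pairing (lact a x) y = pairing x (lact (invol a) y) }.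

Definition cb_isomorphic_correspondences (A B C D : mnstaralgebra)
    (X : mncorrespondence A B) (Y : mncorrespondence C D) : Prop :=
  exists (phi : X -> Y) (alpha : A -> C) (beta : B -> D),
    [/\ cb_isomorphism phi, star_cb_isomorphism alpha,
        star_cb_isomorphism beta
      & [/\ forall (a : A) (x : X), carrier A a -> carrier X x ->
              phi (lact a x) = lact (alpha a) (phi x),
            forall (x : X) (b : B), carrier X x -> carrier B b ->
              phi (ract x b) = ract (phi x) (beta b)
          & forall x y : X, carrier X x -> carrier X y ->
              pairing (phi x) (phi y) = beta (pairing x y)]].

End OperatorAlgebras.

Section HilbertSpaces.
Variable R : realType.

(* A complex Banach space whose norm comes from an inner product, linear in
   the first variable. *)
Record hilbert := Hilbert {
  hsort :> completeNormedModType R[i];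
  hdot : {dot hsort for Num.conj};
  hdot_norm : forall x : hsort, hdot x x = `|x| ^+ 2 }.

End HilbertSpaces.

Arguments hdot {R h}.

Section Operators.
Variables (R : realType) (H : hilbert R).
Implicit Types (S T U P : H -> H) (E : set (H -> H)).

(* B(H), as a set inside the vector space H -> H. *)
Definition bounded_operators : set (H -> H) :=
  [set T | linear T /\ exists K : R, forall x, rnorm (T x) <= K * rnorm x].

Definition is_adjoint T S : Prop := forall x y, hdot (T x) y = hdot x (S y).

(* The adjoint of T in B(H); it is determined by the choice below for T in
   B(H), by the Riesz representation theorem. *)
Definition adjoint T : H -> H :=
  xget 0 [set S | bounded_operators S /\ is_adjoint T S].

(* The norm of M_n(B(H)) = B(H^n). *)
Definition operator_mxnorm n (T : 'M[H -> H]_n) : R :=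
  sup [set l2norm (mulmx_by (fun t (x : H) => t x) T x) | x in @unit_ball R H n].

Definition bh_space E : mnspace R := MNSpace E operator_mxnorm.

Definition operator_norm T : R := @vnorm R (bh_space bounded_operators) T.

Definition norm_closed E : Prop :=
  forall (u : nat -> H -> H) T, (forall n, E (u n)) -> bounded_operators T ->
    (fun n => operator_norm (u n - T)) @ \oo --> (0 : R) -> E T.

Definition closed_subspace E : Prop :=
  [/\ E `<=` bounded_operators, subspace_set E & norm_closed E].

Definition closed_subalgebra E : Prop :=
  closed_subspace E /\ (forall S T, E S -> E T -> E (S \o T)).

Definition selfadjoint T : Prop := adjoint T = T.

Definition unitary T : Prop :=
  [/\ bounded_operators T, adjoint T \o T = id & T \o adjoint T = id].

Definition orthogonal_projection P : Prop :=
  [/\ bounded_operators P, P \o P = P & selfadjoint P].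

(* The operator 1 - P. *)
Definition complement P : H -> H := fun x => x - P x.

(* The set P E Q. *)
Definition corner P E (Q : H -> H) : set (H -> H) := [set P \o T \o Q | T in E].

Definition dagger U T : H -> H := U \o adjoint T \o U.

Definition bh_staralgebra U E : mnstaralgebra R :=
  MNStarAlgebra (star_alg := MNAlgebra (alg_space := bh_space E)
                               (fun S T => S \o T))
                (dagger U).

Definition bh_correspondence U (A B X : set (H -> H)) :
    mncorrespondence (bh_staralgebra U A) (bh_staralgebra U B) :=
  MNCorrespondence (A := bh_staralgebra U A) (B := bh_staralgebra U B)
    (corr_space := bh_space X)
    (fun (a x : H -> H) => a \o x) (fun (x b : H -> H) => x \o b)
    (fun S T => dagger U S \o T).

End Operators.

Section StandardForm.
Variables (R : realType) (L : mnstaralgebra R) (H : hilbert R).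

Record is_standard_form (pi : L -> H -> H) (U : H -> H) : Prop := {
  sf_selfadjoint : selfadjoint U;
  sf_unitary : unitary U;
  sf_image : closed_subalgebra (pi @` carrier L);
  sf_mul : forall a b : L, carrier L a -> carrier L b ->
    pi (amul a b) = pi a \o pi b;
  sf_cb : @cb_isomorphism R L (bh_space (pi @` carrier L)) pi;
  sf_invol : forall a : L, carrier L a -> adjoint (pi a) = U \o pi (invol a) \o U }.

(* A projection P that commutes with U and such that P pi(L) and pi(L) P are
   contained in pi(L). *)
Record compatible_projection (pi : L -> H -> H) (U P : H -> H) : Prop := {
  cp_projection : orthogonal_projection P;
  cp_commute : P \o U = U \o P;
  cp_left : forall a : L, carrier L a -> (pi @` carrier L) (P \o pi a);
  cp_right : forall a : L, carrier L a -> (pi @` carrier L) (pi a \o P) }.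

End StandardForm.

(* Main.v *)
(* A closed subspace of B(H) satisfies the matrix-norm axioms because M_n(B(H))
   acts on H^n, and T -> U T^* U is a completely isometric involution fixing P
   and 1 - P and preserving pi(L); the four corners inherit everything from this.

   Conversely, an operator *-correspondence Y from C to D is made concrete in
   three steps.
   (1) The formal matrices s = [[c, y], [z^*, d]] act on the module
   X = (Y + C + complex numbers) + (D + complex numbers), which has a cyclic
   vector e. One looks for a positive form on sequences in X for which matrices
   s of norm at most 1/4 are contractive and whose values on a given matrix a
   applied to e bound the norm of a from above. By the Hahn-Banach theorem such
   a form exists unless the sum of squares attached to a is dominated by t times
   that of e for a small t; a Douglas factorization turns a domination into the
   estimate |a| <= 4 sqrt t, since s halves the norm on X.
   (2) The sum of these forms over all a gives a semi-inner product space E, on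
   whose bounded antilinear functionals, a Hilbert space K by the Jordan-von
   Neumann theorem, the elements of C, Y and D act with norms equivalent to the
   original ones. On K + K, with U the swap, an element s acts as s on one copy
   and as the adjoint of s^dagger on the other, which makes T -> U T^* U
   implement the involution.
   (3) With A, X, B the images of C, Y, D, the algebra L consists of all T for
   which P T P and its adjoint map X into X, P T (1 - P) and its adjoint's
   corner lie in X, and (1 - P) T (1 - P) lies in B; its corners are X and B,
   and P L P contains A. *)
From HB Require Import structures.
Require Import Defs.
From mathcomp Require Import all_boot all_order all_algebra.
From mathcomp Require Import complex ring lra.
From mathcomp Require Import all_classical reals topology normedtype.

Set Implicit Arguments.
Unset Strict Implicit.
Unset Printing Implicit Defensive.

Import Order.TTheory GRing.Theory Num.Theory.
Import numFieldNormedType.Exports.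

Local Open Scope classical_set_scope.
Local Open Scope ring_scope.

(** * Complex numbers and pre-Hilbert spaces *)

(** [C] and [D] may lack units and approximate identities, so the norm of an element cannot be
    recovered from its action on the given spaces; the adjoined scalars supply the vector [e] from
    which it can. The norm used on X is a plain sum of norms, chosen because small matrices halve it
    and not because it is an operator space norm; this costs the factors 1/4 and 4 and is why the
    result is a cb-isomorphism. Positive forms are found by duality. A vector x is turned into the
    function f -> |f x|^2 of the linear functionals f, and a form becomes a linear functional on a
    real space of such functions, which is where Hahn-Banach applies. The matrices with entries in
    A, X, the daggers of X and B are in general not closed under products: for S, T in X the
    operator S T^dagger maps X into X but need not lie in A. Hence the upper left corner of L is
    enlarged to all multipliers of X, and A sits in P L P as a subalgebra only. *)

Section ComplexNumbers.
Variable R : realType.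
Implicit Types (z w : R[i]) (t : R).

Lemma ReD z w : complex.Re (z + w) = complex.Re z + complex.Re w.
Proof. by case: z; case: w. Qed.

Lemma ImD z w : complex.Im (z + w) = complex.Im z + complex.Im w.
Proof. by case: z; case: w. Qed.

Lemma ReN z : complex.Re (- z) = - complex.Re z. Proof. by case: z. Qed.

Lemma ImN z : complex.Im (- z) = - complex.Im z. Proof. by case: z. Qed.

Lemma ReJ z : complex.Re (Num.conj z) = complex.Re z. Proof. by case: z. Qed.

Lemma ImJ z : complex.Im (Num.conj z) = - complex.Im z. Proof. by case: z. Qed.

Lemma conj_realc t : Num.conj t%:C%C = t%:C%C. Proof. exact: conjc_real. Qed.

Lemma ReMr t z : complex.Re (t%:C%C * z) = t * complex.Re z.
Proof. by case: z => a b /=; rewrite mul0r subr0. Qed.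

Lemma Re_sum I (s : seq I) (P : pred I) (F : I -> R[i]) :
  complex.Re (\sum_(i <- s | P i) F i) = \sum_(i <- s | P i) complex.Re (F i).
Proof. by apply: (big_morph _ ReD). Qed.

Lemma eqc_ReIm z w : complex.Re z = complex.Re w -> complex.Im z = complex.Im w -> z = w.
Proof. by case: z; case: w => /= ? ? ? ? -> ->. Qed.

Lemma rnormE (V : normedZmodType R[i]) (x : V) : (rnorm x)%:C%C = `|x|.
Proof. by rewrite /rnorm RRe_real // normr_real. Qed.

Lemma rnorm_ge0 (V : normedZmodType R[i]) (x : V) : 0 <= rnorm x.
Proof. by rewrite -ler0c rnormE. Qed.

Lemma rnormD (V : normedZmodType R[i]) (x y : V) : rnorm (x + y) <= rnorm x + rnorm y.
Proof. by rewrite -lecR rmorphD /= !rnormE ler_normD. Qed.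

Lemma rnormN (V : normedZmodType R[i]) (x : V) : rnorm (- x) = rnorm x.
Proof. by rewrite /rnorm normrN. Qed.

Lemma rnormB (V : normedZmodType R[i]) (x y : V) : rnorm (x - y) = rnorm (y - x).
Proof. by rewrite -rnormN opprB. Qed.

Lemma rnorm0 (V : normedZmodType R[i]) : rnorm (0 : V) = 0.
Proof. by rewrite /rnorm normr0. Qed.

Lemma rnorm0_eq0 (V : normedZmodType R[i]) (x : V) : rnorm x = 0 -> x = 0.
Proof. by move=> x0; apply/eqP; rewrite -normr_eq0 -rnormE x0. Qed.

Lemma rnormZ (V : normedModType R[i]) a (x : V) : rnorm (a *: x) = rnorm a * rnorm x.
Proof. by apply: (@complexI R); rewrite rmorphM /= !rnormE normrZ. Qed.

Lemma rnormM z w : rnorm (z * w) = rnorm z * rnorm w.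
Proof. by apply: (@complexI R); rewrite rmorphM /= !rnormE normrM. Qed.

Lemma rnormJ z : rnorm (Num.conj z) = rnorm z.
Proof. by case: z => a b; rewrite /rnorm /= sqrrN. Qed.

Lemma rnorm_real t : rnorm t%:C%C = `|t|.
Proof. by rewrite /rnorm /= expr0n addr0 sqrtr_sqr. Qed.

Lemma rnorm_nat n : rnorm (n%:R : R[i]) = n%:R.
Proof. by rewrite -[n%:R](rmorph_nat (real_complex R)) rnorm_real normr_nat. Qed.

Lemma rnorm1 : rnorm (1 : R[i]) = 1. Proof. exact: (rnorm_nat 1). Qed.

Lemma rnorm_sqr z : rnorm z ^+ 2 = complex.Re z ^+ 2 + complex.Im z ^+ 2.
Proof. by case: z => a b; rewrite /rnorm /= sqr_sqrtr // addr_ge0 // sqr_ge0. Qed.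

Lemma mul_conj z : z * Num.conj z = (rnorm z ^+ 2)%:C%C.
Proof. by rewrite -normCK -rnormE rmorphXn. Qed.

Lemma Re_le_rnorm z : complex.Re z <= rnorm z.
Proof.
have [z0|z0] := leP (complex.Re z) 0; first by rewrite (le_trans z0) ?rnorm_ge0.
by rewrite -ler_sqr ?nnegrE ?rnorm_ge0 ?(ltW z0) // rnorm_sqr lerDl sqr_ge0.
Qed.

(** Rotating a value to the positive axis turns a bound on real parts into a bound on moduli; the
    complex Cauchy-Schwarz estimates below combine this with [ler_of_quadratic]. *)
Lemma rnorm_phase z : exists2 w, rnorm w = 1 & w * z = (rnorm z)%:C%C.
Proof.
have [->|z0] := eqVneq z 0.
  by exists 1; rewrite ?mulr0 ?rnorm0 // rnorm1.
have nz0 : rnorm z != 0 by apply: contraNneq z0 => /rnorm0_eq0 ->.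
exists (Num.conj z * ((rnorm z)^-1)%:C%C).
  by rewrite rnormM rnormJ rnorm_real gtr0_norm ?invr_gt0 ?lt0r ?nz0 ?rnorm_ge0 // divff.
by rewrite mulrAC [Num.conj z * z]mulrC mul_conj -rmorphM /= expr2 mulfK.
Qed.

Lemma real_cauchy_cvg (z : nat -> R) :
  (forall e : R, 0 < e -> exists n, forall p q, (n <= p)%N -> (n <= q)%N -> `|z p - z q| < e) ->
  exists l, forall e : R, 0 < e -> exists n, forall p, (n <= p)%N -> `|z p - l| < e.
Proof.
move=> zc; have /cvg_ex[l /cvgrPdist_lt zl] : cvgn z.
  apply/cauchy_cvgP/cauchy_exP => e /zc[n hn]; exists (z n); exists n => // p /= np.
  by rewrite -ball_normE /=; apply: hn.
exists l => e /zl[n _ hn]; exists n => p np; rewrite distrC; exact: hn.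
Qed.

Lemma complex_cauchy_cvg (z : nat -> R[i]) :
  (forall e : R, 0 < e -> exists n, forall p q, (n <= p)%N -> (n <= q)%N -> rnorm (z p - z q) < e) ->
  exists l, forall e : R, 0 < e -> exists n, forall p, (n <= p)%N -> rnorm (z p - l) < e.
Proof.
have Re_le w : `|complex.Re w| <= rnorm w.
  by rewrite -ler_sqr ?nnegrE ?rnorm_ge0 // rnorm_sqr real_normK ?num_real // lerDl sqr_ge0.
have Im_le w : `|complex.Im w| <= rnorm w.
  by rewrite -ler_sqr ?nnegrE ?rnorm_ge0 // rnorm_sqr real_normK ?num_real // lerDr sqr_ge0.
move=> zc.
have [a ha] : exists a, forall e : R, 0 < e -> exists n, forall p, (n <= p)%N -> `|complex.Re (z p) - a| < e.
  apply: real_cauchy_cvg => e /zc[n hn]; exists n => p q np nq.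
  by rewrite -ReN -ReD (le_lt_trans (Re_le _)) ?hn.
have [b hb] : exists b, forall e : R, 0 < e -> exists n, forall p, (n <= p)%N -> `|complex.Im (z p) - b| < e.
  apply: real_cauchy_cvg => e /zc[n hn]; exists n => p q np nq.
  by rewrite -ImN -ImD (le_lt_trans (Im_le _)) ?hn.
exists (Complex a b) => e e0; have e2 : 0 < e / 2 by rewrite divr_gt0.
have [n hn] := ha _ e2; have [m hm] := hb _ e2; exists (maxn n m) => p; rewrite geq_max => /andP[np mp].
rewrite [z p - _](_ : _ = (complex.Re (z p) - a)%:C%C + 'i%C * (complex.Im (z p) - b)%:C%C); last first.
  by apply: eqc_ReIm; case: (z p) => u v /=; ring.
have i1 : rnorm ('i%C : R[i]) = 1 by rewrite /rnorm /= expr0n expr1n add0r sqrtr1.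
rewrite (le_lt_trans (rnormD _ _)) // rnormM !rnorm_real i1 mul1r.
by rewrite [ltRHS]splitr ltrD ?hn ?hm.
Qed.

End ComplexNumbers.

Section PreHilbert.
Variable R : realType.

(** The name only refers to the missing topology: the space is complete, which is stated through
    sequences and squared norms so that no uniform structure is presupposed. *)
Record prehilbert := PreHilbert {
  ph_space : lmodType R[i];
  ph_dot : ph_space -> ph_space -> R[i];
  ph_linear : forall a x y z, ph_dot (a *: x + y) z = a * ph_dot x z + ph_dot y z;
  ph_conj : forall x y, ph_dot x y = Num.conj (ph_dot y x);
  ph_ge0 : forall x, 0 <= ph_dot x x;
  ph_eq0 : forall x, ph_dot x x = 0 -> x = 0;
  ph_complete : forall u : nat -> ph_space,
    (forall e : R, 0 < e -> exists N, forall p q, (N <= p)%N -> (N <= q)%N ->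
       complex.Re (ph_dot (u p - u q) (u p - u q)) < e) ->
    exists l, forall e : R, 0 < e -> exists N, forall p, (N <= p)%N ->
       complex.Re (ph_dot (u p - l) (u p - l)) < e }.

(** A copy of the carrier that depends on [V], to which form, norm and topology can be attached as
    canonical instances. *)
Definition ph_sort (V : prehilbert) : Type := ph_space V.

Variable V : prehilbert.
HB.instance Definition _ := GRing.Lmodule.on (ph_sort V).

Definition ph_form : ph_sort V -> ph_sort V -> R[i] := @ph_dot V.

Lemma ph_bilinear : bilinear_for ( *%R : GRing.Scale.law _ _) (Num.conj \; *%R : GRing.Scale.law _ _) ph_form.
Proof.
split=> u a x y; rewrite /ph_form; first exact: ph_linear.
by rewrite ph_conj ph_linear rmorphD rmorphM /= -!ph_conj.
Qed.

HB.instance Definition _ := bilinear_isBilinear.Build _ _ _ _ _ _ ph_form ph_bilinear.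

Lemma ph_hermitian x y : ph_form x y = (-1) ^+ false * Num.conj (ph_form y x).
Proof. by rewrite expr0 mul1r; exact: ph_conj. Qed.

HB.instance Definition _ := isHermitianSesquilinear.Build _ _ _ _ ph_form ph_hermitian.

Lemma ph_posdef x : x != 0 -> 0 < ph_form x x.
Proof.
move=> x0; rewrite lt_def ph_ge0 andbT; apply: contraNneq x0 => fx0.
by apply/eqP/(@ph_eq0 V).
Qed.

HB.instance Definition _ := isDotProduct.Build _ _ ph_form ph_posdef.

End PreHilbert.

Section Squares.
Variable R : realType.
Implicit Types a b c t : R.

(** The discriminant criterion on the half line t >= 0, evaluated at the minimizing point t = b / c.
    It is behind every Cauchy-Schwarz inequality below. *)
Lemma ler_of_quadratic a b c : 0 <= c ->
  (forall t, 0 <= t -> 2 * t * b <= a + t ^+ 2 * c) -> 0 <= b -> b ^+ 2 <= a * c.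
Proof.
move=> c0 H b0; have [cz|cn] := eqVneq c 0.
  have {}H t : 0 <= t -> 2 * t * b <= a by move=> /H; rewrite cz mulr0 addr0.
  have a0 : 0 <= a by have := H 0 (lexx _); rewrite mulr0 mul0r.
  have [->|bn] := eqVneq b 0; first by rewrite expr0n cz mulr0.
  have bp : 0 < b by rewrite lt0r bn.
  (* With c = 0 this [t] gives 2 (a + 1) <= a, which contradicts 0 <= a. *)
  have := H ((a + 1) / b) (divr_ge0 (addr_ge0 a0 ler01) b0).
  rewrite -mulrA divfK //; lra.
have cp : 0 < c by rewrite lt0r cn.
have := H (b / c) (divr_ge0 b0 c0).
rewrite -(ler_pM2r cp) [leRHS]mulrDl.
have -> : 2 * (b / c) * b * c = 2 * b ^+ 2 by field.
have -> : (b / c) ^+ 2 * c * c = b ^+ 2 by field.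
lra.
Qed.

Lemma ler_of_addgt0 a b : (forall e, 0 < e -> a <= b + e) -> a <= b.
Proof. by move=> H; apply/ler_addgt0Pr => e /H. Qed.

Lemma sqrD_le a b : (a + b) ^+ 2 <= 2 * a ^+ 2 + 2 * b ^+ 2.
Proof.
suff -> : 2 * a ^+ 2 + 2 * b ^+ 2 = (a + b) ^+ 2 + (a - b) ^+ 2 by rewrite lerDl sqr_ge0.
by ring.
Qed.

Lemma sqr_double_le a b c : c ^+ 2 <= a * b -> (2 * c) ^+ 2 <= (a + b) ^+ 2.
Proof.
move=> h; have -> : (a + b) ^+ 2 = 4 * (a * b) + (a - b) ^+ 2 by ring.
rewrite exprMn (_ : 2 ^+ 2 = 4); last by ring.
by rewrite -[leLHS]addr0 lerD ?sqr_ge0 // ler_pM2l.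
Qed.

End Squares.

Section HilbertOfPreHilbert.
Variables (R : realType) (V : prehilbert R).
Notation dot := (@ph_form R V).
Notation nrm2 x := (complex.Re (dot x x)).

Lemma ph_re x : dot x x = (nrm2 x)%:C%C.
Proof. by rewrite RRe_real // realE ph_ge0. Qed.

Lemma ph_re_ge0 x : 0 <= nrm2 x.
Proof. by have := @ph_ge0 R V x; rewrite -/(dot x x) ph_re ler0c. Qed.

Lemma ph_re_eq0 x : nrm2 x = 0 -> x = 0.
Proof. by move=> h; apply: (@ph_eq0 R V); rewrite -/(dot x x) ph_re h. Qed.

Lemma ph_formC x y : dot x y = Num.conj (dot y x). Proof. exact: ph_conj. Qed.

Lemma ph_formZl a x y : dot (a *: x) y = a * dot x y.
Proof. exact: linearZl_LR. Qed.

Lemma ph_formZr a x y : dot x (a *: y) = Num.conj a * dot x y.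
Proof. exact: linearZr_LR. Qed.

Lemma nrm2D x y : nrm2 (x + y) = nrm2 x + nrm2 y + 2 * complex.Re (dot x y).
Proof.
by rewrite linearDl /= !linearDr /= !ReD (ph_formC y x) ReJ; ring.
Qed.

Lemma nrm2Z a x : nrm2 (a *: x) = rnorm a ^+ 2 * nrm2 x.
Proof. by rewrite ph_formZl ph_formZr mulrA mul_conj ReMr. Qed.

Lemma ph_CS x y : rnorm (dot x y) ^+ 2 <= nrm2 x * nrm2 y.
Proof.
have [w w1 hw] := rnorm_phase (dot x y).
apply: ler_of_quadratic => [|t t0|]; rewrite ?ph_re_ge0 ?rnorm_ge0 //.
have := ph_re_ge0 (w *: x + (- t)%:C%C *: y).
rewrite nrm2D !nrm2Z w1 expr1n mul1r rnorm_real real_normK ?num_real // sqrrN.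
rewrite ph_formZl ph_formZr conj_realc mulrCA hw -rmorphM /=; lra.
Qed.

Definition ph_norm (x : ph_sort V) : R[i] := (Num.sqrt (nrm2 x))%:C%C.

Lemma ph_normD x y : ph_norm (x + y) <= ph_norm x + ph_norm y.
Proof.
rewrite /ph_norm -rmorphD /= lecR.
rewrite -ler_sqr ?nnegrE ?addr_ge0 ?sqrtr_ge0 // sqrrD !sqr_sqrtr ?ph_re_ge0 //.
rewrite nrm2D [leRHS]addrAC lerD2l -[leRHS]mulr_natl ler_pM2l //.
rewrite -sqrtrM ?ph_re_ge0 //.
apply: (le_trans (Re_le_rnorm _)); rewrite -[leLHS]ger0_norm ?rnorm_ge0 // -sqrtr_sqr.
by rewrite ler_sqrt ?ph_CS // mulr_ge0 ?ph_re_ge0.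
Qed.

Lemma ph_normZ a x : ph_norm (a *: x) = `|a| * ph_norm x.
Proof.
by rewrite /ph_norm nrm2Z sqrtrM ?sqr_ge0 // sqrtr_sqr rmorphM /= ger0_norm ?rnorm_ge0 // rnormE.
Qed.

Lemma ph_norm_eq0 x : ph_norm x = 0 -> x = 0.
Proof.
move=> /(@complexI R) /eqP; rewrite sqrtr_eq0 => h; apply: ph_re_eq0.
by apply/eqP; rewrite eq_le h ph_re_ge0.
Qed.

HB.instance Definition _ :=
  Lmodule_isNormed.Build R[i] (ph_sort V) ph_normD ph_normZ ph_norm_eq0.

Lemma ph_normE (x : ph_sort V) : `|x| = ph_norm x. Proof. by []. Qed.

Lemma ph_rnorm_sqr (x : ph_sort V) : rnorm x ^+ 2 = nrm2 x.
Proof. by rewrite /rnorm ph_normE /ph_norm /= sqr_sqrtr ?ph_re_ge0. Qed.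

(** Sequential completeness suffices: a Cauchy filter contains a ball of radius 1 / (n + 1) for each
    n, the centres [u n] of these balls form a Cauchy sequence, and its limit is a limit of the
    filter. *)
Lemma ph_cauchy_cvg (F : set_system (ph_sort V)) :
  ProperFilter F -> cauchy F -> cvg F.
Proof.
move=> FF /cauchyP Fc.
have cx n : exists x, F (ball x ((n.+1%:R^-1 : R)%:C%C)).
  by apply: Fc; rewrite ltcR invr_gt0.
have [u uF] := choice cx.
have n_gt (e : R) : 0 < e -> exists N : nat, forall n, (N <= n)%N -> n.+1%:R^-1 < e.
  move=> e0; exists (Num.bound e^-1) => n Nn.
  rewrite invf_plt ?posrE //; apply: (lt_le_trans (archi_boundP _)).
    by rewrite ltW ?invr_gt0.
  by rewrite ler_nat ltnW.
have [l ul] : exists l, forall e : R, 0 < e -> exists N, forall p, (N <= p)%N ->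
    nrm2 (u p - l) < e.
  apply: (@ph_complete R V u) => e e0.
  have e1 : 0 < Num.sqrt e / 2 by rewrite divr_gt0 ?sqrtr_gt0.
  have [N hN] := n_gt _ e1; exists N => p q Np Nq.
  have [x [px qx]] := filter_ex (filterI (uF p) (uF q)).
  rewrite -[nrm2 _]/(nrm2 (u p - u q)) -ph_rnorm_sqr -[e]sqr_sqrtr ?ltW //.
  rewrite ltr_sqr ?nnegrE ?rnorm_ge0 ?sqrtr_ge0 //.
  have pt r : ball (u r) (r.+1%:R^-1)%:C%C x -> (N <= r)%N -> rnorm (u r - x) < Num.sqrt e / 2.
    by move=> + /hN; rewrite -ball_normE /= -rnormE ltcR; exact: lt_trans.
  have -> : u p - u q = (u p - x) - (u q - x) by rewrite opprB addrA subrK.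
  apply: (le_lt_trans (rnormD _ _)); rewrite rnormN.
  by rewrite [ltRHS]splitr ltrD // pt.
apply/cvg_ex; exists l; apply/fcvg_ballP => e0 e0p.
have [e -> {e0 e0p} e0] : exists2 e : R, e0 = e%:C%C & 0 < e.
  by exists (complex.Re e0); rewrite ?RRe_real ?gtr0_real //; move: e0p; rewrite ltcE => /andP[].
have e1 : 0 < e / 2 by rewrite divr_gt0.
have [N hN] := n_gt _ e1.
have [M hM] := ul ((e / 2) ^+ 2) (exprn_gt0 _ e1).
pose n := maxn N M; apply: filterS (uF n) => x.
rewrite -ball_normE /= -rnormE ltcR => xn.
rewrite -rnormE ltcR -[l](subrK (u n)) -addrA.
apply: (le_lt_trans (rnormD _ _)); rewrite [ltRHS]splitr ltrD //.
  rewrite rnormB -ltr_sqr ?nnegrE ?rnorm_ge0 ?ltW //.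
  by rewrite ph_rnorm_sqr; apply: hM; rewrite leq_maxr.
by apply: (lt_trans xn); apply: hN; rewrite leq_maxl.
Qed.

HB.instance Definition _ := Uniform_isComplete.Build (ph_sort V) ph_cauchy_cvg.

Lemma ph_dot_norm (x : ph_sort V) : dot x x = `|x| ^+ 2.
Proof. by rewrite -rnormE -rmorphXn /= ph_rnorm_sqr ph_re. Qed.

Definition hilbert_of : hilbert R := @Hilbert R (ph_sort V) (@ph_form R V) ph_dot_norm.

Lemma hilbert_of_dot (x y : hilbert_of) : hdot x y = ph_dot (x : ph_space V) y.
Proof. by []. Qed.

End HilbertOfPreHilbert.

(** * Hilbert spaces of antilinear functionals *)

Section AdditiveBounded.
Variables (R : realType) (d : R -> R) (M : R).
Hypothesis dD : forall s t, d (s + t) = d s + d t.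
Hypothesis dM : forall t, 0 <= t -> t <= 1 -> `|d t| <= M.

(** With [d 1 = 0] an additive [d] vanishes on the integers and so has period 1; the bound on [0, 1]
    then holds everywhere, and multiples of a nonzero value would exceed it. *)
Lemma additive_bounded_eq0 t : d 1 = 0 -> d t = 0.
Proof.
move=> d1.
have d0 : d 0 = 0 by have := dD 0 0; rewrite addr0; lra.
have dN s : d (- s) = - d s by have := dD s (- s); rewrite subrr d0; lra.
have dMn s n : d (s *+ n) = d s *+ n.
  by elim: n => [|n IH]; rewrite ?mulr0n // !mulrS dD IH.
have dz (z : int) : d z%:~R = 0.
  by case: z => n; rewrite ?NegzE ?rmorphN /= ?dN dMn d1 mul0rn ?oppr0.
have db s : `|d s| <= M.
  have /andP[fs sf] : (Num.floor s)%:~R <= s < (Num.floor s + 1)%:~R by rewrite floor_itv ?num_real.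
  have -> : d s = d (s - (Num.floor s)%:~R) by rewrite dD dN dz subr0.
  by apply: dM; rewrite ?subr_ge0 // lerBlDl -intrD1 ltW.
apply/eqP; rewrite -normr_le0 leNgt; apply/negP => dt.
have := db (t *+ (Num.bound (M / `|d t|))); apply/negP; rewrite -ltNge dMn normrMn.
rewrite -mulr_natl -ltr_pdivrMr //; apply: le_lt_trans (archi_boundP _); first by [].
by rewrite divr_ge0 // (le_trans _ (db 0)).
Qed.

End AdditiveBounded.

Section JordanVonNeumann.
Variables (R : realType) (V : lmodType R[i]) (N : V -> R).
Hypothesis N_ge0 : forall x, 0 <= N x.
Hypothesis NZ : forall a x, N (a *: x) = rnorm a ^+ 2 * N x.
Hypothesis N_parallelogram : forall x y, N (x + y) + N (x - y) = 2 * N x + 2 * N y.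

(** Polarization: [N] is the squared norm and [jvn_re] the real part of the inner product. In
    [jvn_dot] the imaginary part of <x, y> is Re <x, i y>, as linearity in the first variable
    requires. *)
Definition jvn_re x y : R := (N (x + y) - N (x - y)) / 4.
Definition jvn_dot x y : R[i] := Complex (jvn_re x y) (jvn_re x ('i%C *: y)).
Local Notation r := jvn_re.

Lemma jvn_NN x : N (- x) = N x.
Proof. by rewrite -scaleN1r NZ rnormN rnorm1 expr1n mul1r. Qed.

Lemma jvn_N0 : N 0 = 0.
Proof. by rewrite -(scale0r 0) NZ rnorm0 expr0n mul0r. Qed.

Lemma jvn_NBC x y : N (x - y) = N (y - x).
Proof. by rewrite -jvn_NN opprB. Qed.

Lemma jvn_reC x y : r x y = r y x.
Proof. by rewrite /r [x + y]addrC jvn_NBC. Qed.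

Lemma jvn_re0 y : r 0 y = 0.
Proof. by rewrite /r add0r sub0r jvn_NN subrr mul0r. Qed.

Lemma jvn_reNr x y : r x (- y) = - r x y.
Proof. by rewrite /r opprK; lra. Qed.

Lemma jvn_reDB x x' y : r (x + x') y + r (x - x') y = 2 * r x y.
Proof.
have h1 := N_parallelogram (x + y) x'; have h2 := N_parallelogram (x - y) x'.
rewrite /r [x + x' + y]addrAC [x - x' + y]addrAC [x + x' - y]addrAC [x - x' - y]addrAC.
lra.
Qed.

Lemma jvn_reDl x x' y : r (x + x') y = r x y + r x' y.
Proof.
have half z : r z y = 2 * r ((1 / 2)%:C%C *: z) y.
  rewrite -(jvn_reDB _ ((1 / 2)%:C%C *: z)) subrr jvn_re0 addr0 -scalerDl -rmorphD /=.
  by rewrite [1 / 2 + 1 / 2](_ : _ = 1) ?scale1r //; lra.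
rewrite half scalerDr.
have := jvn_reDB ((1 / 2)%:C%C *: x + (1 / 2)%:C%C *: x') ((1 / 2)%:C%C *: x - (1 / 2)%:C%C *: x') y.
set u := _ *: x; set v := _ *: x'.
have -> : u + v + (u - v) = u *+ 2 by rewrite mulr2n addrACA subrr addr0.
have -> : u + v - (u - v) = v *+ 2 by rewrite mulr2n opprB [u + v]addrC addrACA subrr addr0.
have dbl (z : V) : ((1 / 2)%:C%C *: z) *+ 2 = z.
  by rewrite mulr2n -scalerDl -rmorphD /= [_ + _](_ : _ = 1) ?scale1r //; lra.
by rewrite /u /v !dbl.
Qed.

Lemma jvn_re_bound x y : `|r x y| <= (N x + N y) / 2.
Proof.
have := N_parallelogram x y; have := N_ge0 (x + y); have := N_ge0 (x - y).
by rewrite ler_norml /r => *; apply/andP; split; lra.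
Qed.

(** The defect from homogeneity is additive in [t], vanishes at 1, and is bounded on [0, 1] because
    [jvn_re_bound] controls the real part by [N] alone; hence it is zero by
    [additive_bounded_eq0]. *)
Lemma jvn_reZl (t : R) x y : r (t%:C%C *: x) y = t * r x y.
Proof.
apply/eqP; rewrite -subr_eq0; apply/eqP.
pose d s := r (s%:C%C *: x) y - s * r x y.
apply: (@additive_bounded_eq0 _ d (N x + N y + `|r x y|)) => [s s'|s s0 s1|].
- by rewrite /d rmorphD scalerDl jvn_reDl; ring.
- rewrite (le_trans (ler_normB _ _)) // lerD //.
    apply: (le_trans (jvn_re_bound _ _)); rewrite NZ rnorm_real ger0_norm //.
    have : s ^+ 2 * N x <= 1 * N x by rewrite ler_wpM2r // expr_le1.
    by have := N_ge0 x; have := N_ge0 y; lra.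
  by rewrite normrM ger0_norm // ler_piMl.
- by rewrite /d scale1r mul1r subrr.
Qed.

Lemma jvn_re_i x y : r ('i%C *: x) ('i%C *: y) = r x y.
Proof.
by rewrite /r -scalerDr -scalerBr !NZ /rnorm /= expr0n expr1n add0r sqrtr1 expr1n !mul1r.
Qed.

Lemma jvn_ii (x : V) : 'i%C *: ('i%C *: x) = - x.
Proof. by rewrite scalerA -expr2 sqr_i scaleN1r. Qed.

Lemma jvn_re_il x y : r ('i%C *: x) y = - r x ('i%C *: y).
Proof. by rewrite -[in RHS]jvn_re_i jvn_ii jvn_reNr opprK. Qed.

Lemma jvn_dotDl x y z : jvn_dot (x + y) z = jvn_dot x z + jvn_dot y z.
Proof. by rewrite /jvn_dot !jvn_reDl. Qed.

Lemma jvn_dotrZl (t : R) x z : jvn_dot (t%:C%C *: x) z = t%:C%C * jvn_dot x z.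
Proof. by apply: eqc_ReIm; rewrite /= ?jvn_reZl; ring. Qed.

Lemma jvn_dotiZl x z : jvn_dot ('i%C *: x) z = 'i%C * jvn_dot x z.
Proof.
by apply: eqc_ReIm; rewrite /= !jvn_re_il ?jvn_ii ?jvn_reNr; ring.
Qed.

Lemma jvn_dot_linear a x y z : jvn_dot (a *: x + y) z = a * jvn_dot x z + jvn_dot y z.
Proof.
rewrite jvn_dotDl; congr (_ + _); rewrite [a]complexE scalerDl jvn_dotDl mulrDl.
by rewrite -scalerA jvn_dotrZl jvn_dotiZl jvn_dotrZl mulrA.
Qed.

Lemma jvn_dotC x y : jvn_dot x y = Num.conj (jvn_dot y x).
Proof.
by rewrite /jvn_dot; apply: eqc_ReIm => /=; rewrite jvn_reC // jvn_re_il.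
Qed.

Lemma jvn_dot_sqr x : jvn_dot x x = (N x)%:C%C.
Proof.
rewrite /jvn_dot; apply: eqc_ReIm => /=; last by have := jvn_re_il x x; rewrite jvn_reC; lra.
by rewrite /r subrr jvn_N0 -mulr2n -scaler_nat NZ rnorm_nat; lra.
Qed.

Hypothesis N_eq0 : forall x, N x = 0 -> x = 0.
Hypothesis N_complete : forall u : nat -> V,
  (forall e : R, 0 < e -> exists n, forall p q, (n <= p)%N -> (n <= q)%N -> N (u p - u q) < e) ->
  exists l, forall e : R, 0 < e -> exists n, forall p, (n <= p)%N -> N (u p - l) < e.

Lemma jvn_ge0 x : 0 <= jvn_dot x x. Proof. by rewrite jvn_dot_sqr ler0c. Qed.

Lemma jvn_eq0 x : jvn_dot x x = 0 -> x = 0.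
Proof. by rewrite jvn_dot_sqr => /(@complexI R) /N_eq0. Qed.

Lemma jvn_complete (u : nat -> V) :
  (forall e : R, 0 < e -> exists n, forall p q, (n <= p)%N -> (n <= q)%N ->
     complex.Re (jvn_dot (u p - u q) (u p - u q)) < e) ->
  exists l, forall e : R, 0 < e -> exists n, forall p, (n <= p)%N ->
     complex.Re (jvn_dot (u p - l) (u p - l)) < e.
Proof.
move=> uc; have [|l hl] := N_complete (u := u).
  by move=> e /uc[n hn]; exists n => p q np nq; have := hn _ _ np nq; rewrite jvn_dot_sqr.
by exists l => e /hl[n hn]; exists n => p /hn; rewrite jvn_dot_sqr.
Qed.

Definition jvn_prehilbert : prehilbert R :=
  PreHilbert jvn_dot_linear jvn_dotC jvn_ge0 jvn_eq0 jvn_complete.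

End JordanVonNeumann.

Section SemiInner.
Variable R : realType.

Record semiinner := SemiInner {
  si_space :> lmodType R[i];
  si_form : si_space -> si_space -> R[i];
  si_linear : forall a x y z, si_form (a *: x + y) z = a * si_form x z + si_form y z;
  si_conj : forall x y, si_form x y = Num.conj (si_form y x);
  si_ge0 : forall x, 0 <= si_form x x }.

Variable E : semiinner.
Implicit Types (x y : E) (g h : E -> R[i]^o) (a : R[i]).
Local Notation K := (@si_form E).
Local Notation q x := (complex.Re (K x x)).

Lemma si_formDl x y z : K (x + y) z = K x z + K y z.
Proof. by rewrite -[x]scale1r si_linear mul1r scale1r. Qed.

Lemma si_formDr x y z : K z (x + y) = K z x + K z y.
Proof. by rewrite si_conj si_formDl rmorphD /= -!si_conj. Qed.

Lemma si_form0l z : K 0 z = 0.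
Proof. by apply: (@addrI _ (K 0 z)); rewrite -si_formDl !addr0. Qed.

Lemma si_formZl a x z : K (a *: x) z = a * K x z.
Proof. by rewrite -[a *: x]addr0 si_linear si_form0l addr0. Qed.

Lemma si_formZr a x z : K z (a *: x) = Num.conj a * K z x.
Proof. by rewrite si_conj si_formZl rmorphM /= -si_conj. Qed.

Lemma si_formNl x z : K (- x) z = - K x z.
Proof. by rewrite -scaleN1r si_formZl mulN1r. Qed.

Lemma si_re x : K x x = (q x)%:C%C.
Proof. by rewrite RRe_real // realE si_ge0. Qed.

Lemma si_re_ge0 x : 0 <= q x. Proof. by rewrite -ler0c -si_re si_ge0. Qed.

Lemma si_reD x y : q (x + y) = q x + q y + 2 * complex.Re (K x y).
Proof. by rewrite si_formDl !si_formDr !ReD (si_conj y x) ReJ; ring. Qed.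

Lemma si_reZ a x : q (a *: x) = rnorm a ^+ 2 * q x.
Proof. by rewrite si_formZl si_formZr mulrA mul_conj ReMr. Qed.

Lemma si_reN x : q (- x) = q x.
Proof. by rewrite -scaleN1r si_reZ rnormN rnorm1 expr1n mul1r. Qed.

Lemma si_reB x y : q (x - y) = q x + q y - 2 * complex.Re (K x y).
Proof.
rewrite si_reD si_reN [K x (- y)]si_conj si_formNl ReJ ReN.
by rewrite [K x y]si_conj ReJ mulrN.
Qed.

Lemma si_re0 : q 0 = 0. Proof. by rewrite si_form0l. Qed.

(** Antilinear functionals are used so that [si_eval], which sends [x] to [si_form x], is linear.
    The bound by the form makes them vanish on its null vectors, so neither a quotient nor a
    completion has to be formed. *)
Definition antilinear_bounded g : Prop :=
  (forall a x y, g (a *: x + y) = Num.conj a * g x + g y) /\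
  exists c : R, forall x, rnorm (g x) ^+ 2 <= c * q x.

Definition si_dual_pred : {pred (E -> R[i]^o)} := fun g => `[< antilinear_bounded g >].

Lemma si_dual_closed : submod_closed si_dual_pred.
Proof.
split=> [|a g h /asboolP[ga [c gc]] /asboolP[ha [d hd]]]; apply/asboolP; split.
- by move=> a x y; rewrite -![(0 : E -> R[i]^o) _]/(0 : R[i]) mulr0 addr0.
- by exists 0 => x; rewrite -[(0 : E -> R[i]^o) _]/(0 : R[i]) rnorm0 expr0n mul0r.
- move=> b x y; rewrite -![(a *: g + h) _]/(a * g _ + h _) ga ha !mulrDr addrACA.
  by congr (_ + _ + _); rewrite mulrCA.
exists (2 * rnorm a ^+ 2 * c + 2 * d) => x.
rewrite -[(a *: g + h) _]/(a * g x + h x); have := rnormD (a * g x) (h x); rewrite rnormM => le.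
have sq : rnorm (a * g x + h x) ^+ 2 <= (rnorm a * rnorm (g x) + rnorm (h x)) ^+ 2.
  by rewrite ler_sqr ?nnegrE ?addr_ge0 ?mulr_ge0 ?rnorm_ge0.
apply: (le_trans sq); apply: (le_trans (sqrD_le _ _)).
have : rnorm a ^+ 2 * rnorm (g x) ^+ 2 <= rnorm a ^+ 2 * (c * q x) by rewrite ler_wpM2l ?sqr_ge0.
have := hd x; rewrite exprMn; move: (rnorm a ^+ 2 * rnorm (g x) ^+ 2) (rnorm (h x) ^+ 2) => A B.
have -> : (2 * rnorm a ^+ 2 * c + 2 * d) * q x = 2 * (rnorm a ^+ 2 * (c * q x)) + 2 * (d * q x) by ring.
by move: (d * q x) (rnorm a ^+ 2 * (c * q x)) => C D; lra.
Qed.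

HB.instance Definition _ := GRing.isSubmodClosed.Build R[i] (E -> R[i]^o) si_dual_pred si_dual_closed.

Record si_dual := SiDual { si_dual_val :> E -> R[i]^o; _ : si_dual_val \in si_dual_pred }.
HB.instance Definition _ := [isSub for si_dual_val].
HB.instance Definition _ := [Choice of si_dual by <:].
HB.instance Definition _ := [SubChoice_isSubLmodule of si_dual by <:].

End SemiInner.

Section DualHilbert.
Variables (R : realType) (E : semiinner R).
Implicit Types (x y : E) (g h : si_dual E) (a : R[i]).
Local Notation K := (@si_form R E).
Local Notation q x := (complex.Re (K x x)).

Lemma si_dualP g : antilinear_bounded g.
Proof. by case: g => g /= /asboolP. Qed.

Lemma si_dual_eq g h : (forall x, g x = h x) -> g = h.
Proof. by move=> gh; apply/val_inj/funext. Qed.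

Lemma si_dualDE g h x : (g + h) x = g x + h x. Proof. by []. Qed.
Lemma si_dualNE g x : (- g) x = - g x. Proof. by []. Qed.
Lemma si_dualBE g h x : (g - h) x = g x - h x. Proof. by []. Qed.
Lemma si_dualZE a g x : (a *: g) x = a * g x. Proof. by []. Qed.
Lemma si_dual0E x : (0 : si_dual E) x = 0. Proof. by []. Qed.

Lemma si_dualD g x y : g (x + y) = g x + g y.
Proof.
have [lg _] := si_dualP g.
by rewrite -[x in LHS]scale1r lg rmorph1 mul1r.
Qed.

Lemma si_dual0 g : g 0 = 0.
Proof. by apply: (@addrI _ (g 0)); rewrite -si_dualD !addr0. Qed.

Lemma si_dualZ g a x : g (a *: x) = Num.conj a * g x.
Proof. by have [lg _] := si_dualP g; rewrite -[a *: x]addr0 lg si_dual0 addr0. Qed.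

(** For g = <v, .> this is |v|^2 - |v - x|^2, so its supremum [si_dual_N] is the squared norm of
    [g], written in a way that makes sense for a degenerate form. *)
Definition si_dual_gap g x : R := 2 * complex.Re (g x) - q x.
Definition si_dual_N g : R := sup (range (si_dual_gap g)).

Lemma si_dual_has_sup g : has_sup (range (si_dual_gap g)).
Proof.
split; first by exists (si_dual_gap g 0), 0.
have [_ [c hc]] := si_dualP g; exists `|c| => _ [x _ <-].
have {}hc : rnorm (g x) ^+ 2 <= `|c| * q x.
  by rewrite (le_trans (hc x)) // ler_wpM2r ?si_re_ge0 // ler_norm.
rewrite /si_dual_gap lerBlDr.
have := Re_le_rnorm (g x); set v := rnorm _ in hc * => rv.
apply: (@le_trans _ _ (2 * v)); first by lra.
rewrite -ler_sqr ?nnegrE ?addr_ge0 ?mulr_ge0 ?rnorm_ge0 ?si_re_ge0 //.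
exact: sqr_double_le.
Qed.

Lemma si_dual_gap_le g x : 2 * complex.Re (g x) - q x <= si_dual_N g.
Proof. by apply: (@sup_upper_bound _ _ (si_dual_has_sup g)); exists x. Qed.

Lemma si_dual_N_le g (M : R) : (forall x, 2 * complex.Re (g x) - q x <= M) -> si_dual_N g <= M.
Proof.
move=> H; apply: ge_sup; first by have [] := si_dual_has_sup g.
by move=> _ [x _ <-]; exact: H.
Qed.

Lemma si_dual_N_approx g (e : R) : 0 < e -> exists x, si_dual_N g - e < 2 * complex.Re (g x) - q x.
Proof.
by move=> e0; have [_ [x _ <-] h] := sup_adherent e0 (si_dual_has_sup g); exists x.
Qed.

Lemma si_dual_N_ge0 g : 0 <= si_dual_N g.
Proof. by have := si_dual_gap_le g 0; rewrite si_dual0 si_re0 mulr0 subr0. Qed.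

Lemma si_dual_bound g x : rnorm (g x) ^+ 2 <= si_dual_N g * q x.
Proof.
have [w w1 hw] := rnorm_phase (g x).
apply: ler_of_quadratic => [|t t0|]; rewrite ?si_re_ge0 ?rnorm_ge0 //.
have := si_dual_gap_le g ((t%:C%C * Num.conj w) *: x).
rewrite si_reZ si_dualZ rmorphM /= conj_realc conjCK -mulrA hw -rmorphM /=.
rewrite rnormM rnorm_real rnormJ w1 mulr1 real_normK ?num_real //; lra.
Qed.

Lemma si_dual_NZ_le a g : si_dual_N (a *: g) <= rnorm a ^+ 2 * si_dual_N g.
Proof.
have [->|a0] := eqVneq a 0.
  rewrite scale0r rnorm0 expr0n mul0r; apply: si_dual_N_le => x.
  by rewrite si_dual0E mulr0 sub0r oppr_le0 si_re_ge0.
apply: si_dual_N_le => x; rewrite si_dualZE.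
have na : 0 < rnorm a by rewrite lt0r rnorm_ge0 andbT; apply: contraNneq a0 => /rnorm0_eq0 ->.
have [y xE] : exists y, x = a *: y by exists (a^-1 *: x); rewrite scalerA divff ?scale1r.
have := si_dual_gap_le g y; rewrite -(ler_pM2l (exprn_gt0 2 na)).
by rewrite xE si_dualZ mulrA mul_conj ReMr si_reZ; lra.
Qed.

Lemma si_dual_NZ a g : si_dual_N (a *: g) = rnorm a ^+ 2 * si_dual_N g.
Proof.
apply/eqP; rewrite eq_le si_dual_NZ_le /=.
have [->|a0] := eqVneq a 0; first by rewrite rnorm0 expr0n mul0r si_dual_N_ge0.
have na : 0 < rnorm a by rewrite lt0r rnorm_ge0 andbT; apply: contraNneq a0 => /rnorm0_eq0 ->.
have := si_dual_NZ_le a^-1 (a *: g); rewrite scalerA mulVf // scale1r.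
rewrite -(ler_pM2l (exprn_gt0 2 na)) mulrA -exprMn -rnormM divff //.
by rewrite rnorm1 expr1n mul1r.
Qed.

(** Near-maximizers [x] for [g] and [y] for [h] are tested as [x + y] against [g + h] and as [x - y]
    against [g - h]; the terms in [q] add up by the parallelogram law of the form. *)
Lemma si_dual_parallelogram_le g h :
  2 * si_dual_N g + 2 * si_dual_N h <= si_dual_N (g + h) + si_dual_N (g - h).
Proof.
apply: ler_of_addgt0 => e e0; have e4 : 0 < e / 4 by rewrite divr_gt0.
have [x hx] := si_dual_N_approx g e4; have [y hy] := si_dual_N_approx h e4.
have h1 := si_dual_gap_le (g + h) (x + y); have h2 := si_dual_gap_le (g - h) (x - y).
have gN f z : (f : si_dual E) (- z) = - f z.
  by rewrite -scaleN1r si_dualZ rmorphN1 mulN1r.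
move: h1 h2 hx hy; rewrite si_dualBE si_dualDE !si_dualD !gN !(ReD, ReN) si_reD si_reB.
move: (complex.Re (g x)) (complex.Re (g y)) (complex.Re (h x)) (complex.Re (h y)).
move: (complex.Re (K x y)) (q x) (q y) (si_dual_N g) (si_dual_N h) (si_dual_N (g + h)) (si_dual_N (g - h)).
by move=> *; lra.
Qed.

(** The reverse inequality is the same one for the pair [g + h], [g - h]. *)
Lemma si_dual_parallelogram g h :
  si_dual_N (g + h) + si_dual_N (g - h) = 2 * si_dual_N g + 2 * si_dual_N h.
Proof.
apply/eqP; rewrite eq_le si_dual_parallelogram_le andbT.
have := si_dual_parallelogram_le (g + h) (g - h).
have -> : g + h + (g - h) = 2%:R *: g by rewrite addrACA subrr addr0 scaler_nat.
have -> : g + h - (g - h) = 2%:R *: h by rewrite opprB [g + h]addrC addrACA subrr addr0 scaler_nat.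
by rewrite !si_dual_NZ rnorm_nat; lra.
Qed.

Lemma si_dual_N_eq0 g : si_dual_N g = 0 -> g = 0.
Proof.
move=> g0; apply: si_dual_eq => x; rewrite si_dual0E; apply: rnorm0_eq0.
have := si_dual_bound g x; rewrite g0 mul0r => h.
by apply/eqP; rewrite -sqrf_eq0 eq_le h sqr_ge0.
Qed.

(** The limit is taken pointwise. A bound on all gaps of [u p - u r] is a family of bounds on single
    values and survives r -> oo by [near_le], so the gaps of [u p - l] are small before [l] is known
    to be bounded. *)
Lemma si_dual_complete (u : nat -> si_dual E) :
  (forall e : R, 0 < e -> exists n, forall p r, (n <= p)%N -> (n <= r)%N -> si_dual_N (u p - u r) < e) ->
  exists l, forall e : R, 0 < e -> exists n, forall p, (n <= p)%N -> si_dual_N (u p - l) < e.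
Proof.
move=> uc.
have /choice[l hl] x : exists l, forall e : R, 0 < e -> exists n, forall p, (n <= p)%N -> rnorm (u p x - l) < e.
  apply: complex_cauchy_cvg => e e0.
  have k0 : 0 < q x + 1 by have := si_re_ge0 x; lra.
  have [n hn] := uc (e ^+ 2 / (q x + 1)) (divr_gt0 (exprn_gt0 2 e0) k0).
  exists n => p r np nr; rewrite -ltr_sqr ?nnegrE ?rnorm_ge0 ?(ltW e0) //.
  rewrite -si_dualBE (le_lt_trans (si_dual_bound _ _)) //.
  apply: (@le_lt_trans _ _ (si_dual_N (u p - u r) * (q x + 1))).
    by rewrite ler_wpM2l ?si_dual_N_ge0 //; lra.
  by rewrite -ltr_pdivlMr // hn.
have near_le x n (m : R) (t : R[i]) : (forall p, (n <= p)%N -> 2 * complex.Re (t - u p x) <= m) ->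
    2 * complex.Re (t - l x) <= m.
  move=> H; apply: ler_of_addgt0 => e e0; have e2 : 0 < e / 2 by rewrite divr_gt0.
  have [k hk] := hl x _ e2; pose p := maxn n k.
  have h1 := H p (leq_maxl _ _); have h2 := hk p (leq_maxr _ _).
  have h3 := Re_le_rnorm (u p x - l x).
  by move: h1 h3; rewrite !ReD !ReN; lra.
have gap e : 0 < e -> exists n, forall p, (n <= p)%N -> forall x, 2 * complex.Re (u p x - l x) - q x <= e.
  move=> e0; have [n hn] := uc e e0; exists n => p np x.
  rewrite lerBlDr; apply: (near_le x n) => r nr.
  have := si_dual_gap_le (u p - u r) x; rewrite si_dualBE.
  by have := hn _ _ np nr; lra.
have lP : antilinear_bounded (l : E -> R[i]^o).
  have lC x : forall e : R, 0 < e -> exists n, forall p, (n <= p)%N -> rnorm (u p x - l x) < e by exact: hl.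
  have l_lin a x y : l (a *: x + y) = Num.conj a * l x + l y.
    apply/eqP; rewrite -subr_eq0; apply/eqP/rnorm0_eq0/eqP; rewrite eq_le rnorm_ge0 andbT.
    apply: ler_of_addgt0 => e e0; rewrite add0r.
    have a0 : 0 < rnorm a + 1 by have := rnorm_ge0 a; lra.
    have e3 : 0 < e / 3 by rewrite divr_gt0.
    have [n1 h1] := hl (a *: x + y) _ e3; have [n2 h2] := hl y _ e3.
    have [n3 h3] := hl x _ (divr_gt0 e3 a0).
    pose p := maxn n1 (maxn n2 n3).
    have {}h1 : rnorm (u p (a *: x + y) - l (a *: x + y)) < e / 3 by apply: h1; rewrite /p !leq_max leqnn.
    have {}h2 : rnorm (u p y - l y) < e / 3 by apply: h2; rewrite /p !leq_max leqnn !orbT.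
    have {}h3 : rnorm (u p x - l x) < e / 3 / (rnorm a + 1) by apply: h3; rewrite /p !leq_max leqnn !orbT.
    have -> : l (a *: x + y) - (Num.conj a * l x + l y) =
        - (u p (a *: x + y) - l (a *: x + y)) + (Num.conj a * (u p x - l x) + (u p y - l y)).
      by have [-> _] := si_dualP (u p); rewrite mulrBr; ring.
    have e4 : rnorm (Num.conj a * (u p x - l x)) <= e / 3.
      rewrite rnormM rnormJ; move: h3; rewrite ltr_pdivlMr // mulrC => /ltW.
      by apply: le_trans; rewrite ler_wpM2r ?rnorm_ge0 //; lra.
    have := rnormD (- (u p (a *: x + y) - l (a *: x + y))) (Num.conj a * (u p x - l x) + (u p y - l y)).
    have := rnormD (Num.conj a * (u p x - l x)) (u p y - l y).
    by rewrite rnormN; lra.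
  (* Gaps of at most 1 bound [u n - l] by the phase and discriminant argument, and [l] inherits its
     bound from [u n]. *)
  split=> //; have [n hn] := gap 1 ltr01.
  have lZ a x : l (a *: x) = Num.conj a * l x.
    have l0 : l 0 = 0 by apply: (@addrI _ (l 0)); rewrite -{1}[l 0]mul1r -[1](rmorph1 (Num.conj : {rmorphism R[i] -> R[i]})) -l_lin scaler0 !addr0.
    by rewrite -[a *: x]addr0 l_lin l0 addr0.
  exists (2 * si_dual_N (u n) + 2) => x.
  have hd : rnorm (u n x - l x) ^+ 2 <= 1 * q x.
    pose v : R[i] := u n x - l x; rewrite -/v.
    have vZ c : (u n (c *: x) - l (c *: x) : R[i]) = Num.conj c * v.
      by rewrite si_dualZ lZ /v mulrBr.
    have [w w1 hw] := rnorm_phase v.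
    apply: ler_of_quadratic => [|t t0|]; rewrite ?si_re_ge0 ?rnorm_ge0 //.
    have := hn _ (leqnn n) ((t%:C%C * Num.conj w) *: x).
    rewrite vZ si_reZ rmorphM /= conj_realc conjCK -mulrA hw -rmorphM /=.
    by rewrite rnormM rnorm_real rnormJ w1 mulr1 real_normK ?num_real //; lra.
  have hb := si_dual_bound (u n) x.
  have hs : rnorm (l x) <= rnorm (u n x) + rnorm (u n x - l x).
    by rewrite -[l x](subKr (u n x)) (le_trans (rnormD _ _)) ?rnormN ?subKr.
  have : rnorm (l x) ^+ 2 <= (rnorm (u n x) + rnorm (u n x - l x)) ^+ 2.
    by rewrite ler_sqr ?nnegrE ?addr_ge0 ?rnorm_ge0.
  move=> /le_trans/(_ (sqrD_le _ _)); move: hd hb.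
  have -> : (2 * si_dual_N (u n) + 2) * q x = 2 * (si_dual_N (u n) * q x) + 2 * q x by ring.
  rewrite mul1r; move: (si_dual_N (u n) * q x) => D.
  by move: (rnorm (u n x) ^+ 2) (rnorm (u n x - l x) ^+ 2) (rnorm (l x) ^+ 2) (q x) => A B C F; lra.
exists (SiDual (introT (asboolP _) lP)) => e e0.
have e2 : 0 < e / 2 by rewrite divr_gt0.
have [n hn] := gap _ e2; exists n => p np.
apply: (@le_lt_trans _ _ (e / 2)); last by lra.
by apply: si_dual_N_le => x; rewrite si_dualBE; exact: hn.
Qed.

Definition dual_hilbert : hilbert R :=
  hilbert_of (jvn_prehilbert si_dual_N_ge0 si_dual_NZ si_dual_parallelogram
    si_dual_N_eq0 si_dual_complete).

Lemma dual_rnorm (g : dual_hilbert) : rnorm g ^+ 2 = si_dual_N g.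
Proof. rewrite [LHS]ph_rnorm_sqr -[RHS]/(complex.Re (si_dual_N g)%:C%C); congr complex.Re.
exact: (jvn_dot_sqr si_dual_NZ). Qed.

Lemma si_eval_subproof x : (K x : E -> R[i]^o) \in @si_dual_pred R E.
Proof.
apply/asboolP; split=> [a y z|]; first by rewrite si_formDr si_formZr.
exists (q x) => y; have [w w1 hw] := rnorm_phase (K x y).
apply: ler_of_quadratic => [|t t0|]; rewrite ?si_re_ge0 ?rnorm_ge0 //.
have := si_re_ge0 (x - (t%:C%C * Num.conj w) *: y).
rewrite si_reB si_reZ si_formZr rmorphM /= conj_realc conjCK -mulrA hw -rmorphM /=.
by rewrite rnormM rnorm_real rnormJ w1 mulr1 real_normK ?num_real //; lra.
Qed.

Definition si_eval x : dual_hilbert := SiDual (si_eval_subproof x).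

Lemma si_eval_N x : si_dual_N (si_eval x) = q x.
Proof.
apply/eqP; rewrite eq_le; apply/andP; split.
  by apply: si_dual_N_le => y; have := si_re_ge0 (x - y); rewrite si_reB /=; lra.
by have := si_dual_gap_le (si_eval x) x; rewrite /=; lra.
Qed.

(** The expansion of |g - <x, .>|^2 in which [g x] stands for an inner product; each inequality is a
    translation of the variable in the supremum. Polarized it becomes [dual_reproducing], and it
    lets [riesz] approximate functionals by evaluations. *)
Lemma si_dual_NB_eval g x :
  si_dual_N (g - si_eval x) = si_dual_N g - 2 * complex.Re (g x) + q x.
Proof.
apply/eqP; rewrite eq_le; apply/andP; split.
  apply: si_dual_N_le => y; have := si_dual_gap_le g (y + x).
  by rewrite si_dualBE /= si_dualD !(ReD, ReN) si_reD [K x y]si_conj ReJ; lra.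
suff : si_dual_N g <= si_dual_N (g - si_eval x) + 2 * complex.Re (g x) - q x by lra.
apply: si_dual_N_le => y; have := si_dual_gap_le (g - si_eval x) (y - x).
rewrite si_dualBE /= si_dualD -[g (- x)]/(g (- x)) -scaleN1r si_dualZ rmorphN1 mulN1r scaleN1r.
rewrite si_formDr -scaleN1r si_formZr rmorphN1 mulN1r scaleN1r si_reB !(ReD, ReN, ReJ) [K x y]si_conj ReJ; lra.
Qed.

Lemma dual_reproducing (g : dual_hilbert) x : hdot g (si_eval x) = (g : si_dual E) x.
Proof.
have NB (f : si_dual E) z : si_dual_N (f + si_eval z) = si_dual_N f + 2 * complex.Re (f z) + q z.
  have -> : f + si_eval z = f - si_eval (- z).
    by congr (_ + _); apply: si_dual_eq => y; rewrite si_dualNE /= si_formNl opprK.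
  by rewrite si_dual_NB_eval si_reN -scaleN1r si_dualZ rmorphN1 mulN1r ReN; lra.
have re z : jvn_re (@si_dual_N) g (si_eval z) = complex.Re ((g : si_dual E) z).
  by rewrite /jvn_re NB si_dual_NB_eval; lra.
rewrite hilbert_of_dot; apply: eqc_ReIm; first exact: re.
have -> : complex.Im (@ph_dot R (jvn_prehilbert si_dual_N_ge0 si_dual_NZ si_dual_parallelogram
    si_dual_N_eq0 si_dual_complete) g (si_eval x)) = jvn_re (@si_dual_N) g (si_eval ('i%C *: x)).
  congr jvn_re; apply: si_dual_eq => y; rewrite si_dualZE /=; exact/esym/si_formZl.
rewrite re si_dualZ; case: ((g : si_dual E) x) => a b /=; ring.
Qed.

End DualHilbert.

(** * Adjoints and products *)

Section HilbertTheory.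
Variables (R : realType) (H : hilbert R).
Implicit Types (x y z : H) (a : R[i]).

Lemma hdotDl x y z : hdot (x + y) z = hdot x z + hdot y z.
Proof. exact: linearDl. Qed.

Lemma hdotZl a x z : hdot (a *: x) z = a * hdot x z.
Proof. exact: linearZl_LR. Qed.

Lemma hdotC x y : hdot x y = Num.conj (hdot y x).
Proof.
by have := @hermitian_subproof _ _ _ _ (@hdot R H) x y; rewrite expr0 mul1r.
Qed.

Lemma hdotDr x y z : hdot x (y + z) = hdot x y + hdot x z.
Proof. by rewrite hdotC hdotDl rmorphD /= -!hdotC. Qed.

Lemma hdotZr a x z : hdot x (a *: z) = Num.conj a * hdot x z.
Proof. by rewrite hdotC hdotZl rmorphM /= -hdotC. Qed.

Lemma hdotNl x z : hdot (- x) z = - hdot x z.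
Proof. by rewrite -scaleN1r hdotZl mulN1r. Qed.

Lemma hdotNr x z : hdot x (- z) = - hdot x z.
Proof. by rewrite hdotC hdotNl rmorphN /= -hdotC. Qed.

Lemma hdot_rnorm x : hdot x x = (rnorm x ^+ 2)%:C%C.
Proof. by rewrite (@hdot_norm R H) -rnormE rmorphXn. Qed.

(** Makes the construction of the dual available for [H] itself; it is transparent so that [si_form]
    stays convertible to [hdot]. *)
Definition hilbert_semiinner : semiinner R.
Proof.
refine (@SemiInner R H (@hdot R H) _ hdotC _).
  by move=> a x y z; rewrite hdotDl hdotZl.
by move=> x; rewrite hdot_rnorm ler0c sqr_ge0.
Defined.

Lemma rnorm_sqr_hdot x : rnorm x ^+ 2 = complex.Re (hdot x x).
Proof. by rewrite hdot_rnorm. Qed.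

Lemma hdot_CS x y : rnorm (hdot x y) <= rnorm x * rnorm y.
Proof.
rewrite -ler_sqr ?nnegrE ?mulr_ge0 ?rnorm_ge0 // exprMn !rnorm_sqr_hdot.
have := @si_dual_bound _ hilbert_semiinner (si_eval (x : hilbert_semiinner)) y.
by rewrite si_eval_N.
Qed.

Lemma hdot_eqr y z : (forall x, hdot x y = hdot x z) -> y = z.
Proof.
move=> h; apply/eqP; rewrite -subr_eq0; apply/eqP/rnorm0_eq0/eqP.
by rewrite -sqrf_eq0 rnorm_sqr_hdot hdotDr hdotNr h subrr.
Qed.

Lemma hilbert_complete (u : nat -> H) :
  (forall e : R, 0 < e -> exists n, forall p q, (n <= p)%N -> (n <= q)%N -> rnorm (u p - u q) < e) ->
  exists l, forall e : R, 0 < e -> exists n, forall p, (n <= p)%N -> rnorm (u p - l) < e.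
Proof.
move=> uc; have /cvg_ex[l /cvgrPdist_lt ul] : cvgn u.
  apply/cauchy_cvgP/cauchy_exP => e0 e0p.
  have [e -> {e0 e0p} e0] : exists2 e : R, e0 = e%:C%C & 0 < e.
    by exists (complex.Re e0); rewrite ?RRe_real ?gtr0_real //; move: e0p; rewrite ltcE => /andP[].
  have [n hn] := uc e e0; exists (u n); exists n => // p /= np.
  by rewrite -ball_normE /= -rnormE ltcR; exact: hn.
exists l => e e0; have [|n _ hn] := ul e%:C%C; first by rewrite ltcR.
by exists n => p np; rewrite rnormB -ltcR rnormE; exact: hn.
Qed.

(** By [si_dual_NB_eval], near-maximizers of 2 Re (f x) - |x|^2 are points whose evaluations
    approximate the conjugate of [f] in the dual norm. On [H] the evaluation map is isometric, so
    these points form a Cauchy sequence, and its limit represents [f]. *)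
Lemma riesz (f : H -> R[i]) (c : R) :
  (forall a x y, f (a *: x + y) = a * f x + f y) -> (forall x, rnorm (f x) <= c * rnorm x) ->
  exists y, forall x, f x = hdot x y.
Proof.
move=> fl fc; pose E := hilbert_semiinner.
have gP : (fun x => Num.conj (f x) : R[i]^o) \in @si_dual_pred R E.
  apply/asboolP; split=> [a x y|]; first by rewrite fl rmorphD rmorphM.
  exists (c ^+ 2) => x; rewrite rnormJ -[si_form _ _]/(hdot x x) -rnorm_sqr_hdot -exprMn.
  by rewrite ler_sqr ?nnegrE ?rnorm_ge0 ?fc // (le_trans _ (fc x)) ?rnorm_ge0.
pose g : si_dual E := SiDual gP.
have NB (s t r : si_dual E) : si_dual_N (s - t) <= 2 * si_dual_N (s - r) + 2 * si_dual_N (t - r).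
  rewrite -si_dual_parallelogram [X in _ <= _ + X](_ : _ = si_dual_N (s - t)).
    by rewrite lerDr si_dual_N_ge0.
  by congr si_dual_N; rewrite opprB addrA subrK.
have app n : exists x : E, si_dual_N (si_eval x - g) < n.+1%:R^-1.
  have [|x hx] := @si_dual_N_approx _ _ g n.+1%:R^-1; first by rewrite invr_gt0.
  exists x; rewrite -opprB (jvn_NN (@si_dual_NZ _ _)) si_dual_NB_eval; move: hx.
  move: (si_dual_N g) (complex.Re (g x)) (complex.Re (si_form x x)) => A B C.
  by move: (n.+1%:R^-1) => d; lra.
have [u hu] := choice app.
have evB (x y : E) : si_dual_N (si_eval x - si_eval y) = rnorm (x - y : H) ^+ 2.
  rewrite rnorm_sqr_hdot -[hdot _ _]/(@si_form R E (x - y) (x - y)) -si_eval_N; congr si_dual_N.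
  by apply: si_dual_eq => z; rewrite si_dualBE /= [in RHS]hdotDl hdotNl.
have n_gt (e : R) : 0 < e -> exists N : nat, forall n, (N <= n)%N -> n.+1%:R^-1 < e.
  move=> e0; exists (Num.bound e^-1) => n Nn.
  rewrite invf_plt ?posrE //; apply: (lt_le_trans (archi_boundP _)).
    by rewrite ltW ?invr_gt0.
  by rewrite ler_nat ltnW.
have [y hy] : exists l, forall e : R, 0 < e -> exists n, forall p, (n <= p)%N -> rnorm (u p - l : H) < e.
  apply: hilbert_complete => e e0.
  have e4 : 0 < e ^+ 2 / 4 by rewrite divr_gt0 ?exprn_gt0.
  have [N hN] := n_gt _ e4; exists N => p q Np Nq.
  rewrite -ltr_sqr ?nnegrE ?rnorm_ge0 ?(ltW e0) // -evB (le_lt_trans (NB _ _ g)) //.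
  move: (lt_trans (hu p) (hN _ Np)) (lt_trans (hu q) (hN _ Nq)).
  by move: (si_dual_N _) (si_dual_N _) (e ^+ 2) => A B C; lra.
exists y; have gy : g - si_eval (y : E) = 0.
  apply: si_dual_N_eq0; apply/eqP; rewrite eq_le si_dual_N_ge0 andbT.
  apply: ler_of_addgt0 => e e0; rewrite add0r.
  have e4 : 0 < e / 4 by rewrite divr_gt0.
  have [N hN] := n_gt _ e4.
  have s0 : 0 < Num.sqrt (e / 4) by rewrite sqrtr_gt0.
  have [M hM] := hy _ s0; pose p := maxn N M.
  rewrite (le_trans (NB _ _ (si_eval (u p)))) //.
  have h1 := lt_trans (hu p) (hN p (leq_maxl _ _)).
  have := hM p (leq_maxr _ _); rewrite -ltr_sqr ?nnegrE ?rnorm_ge0 ?sqrtr_ge0 // sqr_sqrtr ?(ltW e4) //.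
  rewrite -evB -[si_eval y - _]opprB (jvn_NN (@si_dual_NZ _ _)) -[g - _]opprB (jvn_NN (@si_dual_NZ _ _)).
  by move: h1; move: (si_dual_N _) (si_dual_N _) => A B; lra.
move=> x; have : (g - si_eval (y : E)) (x : E) = 0 by rewrite gy.
rewrite si_dualBE /= => /eqP; rewrite subr_eq0 => /eqP h.
by rewrite -[f x]conjCK (h : Num.conj (f x) = hdot y x) -hdotC.
Qed.

End HilbertTheory.

Section BoundedOperators.
Variables (R : realType) (H : hilbert R).
Implicit Types (x y : H) (S T : H -> H).
Local Notation bop := (@bounded_operators R H).

Lemma bopD T x y : bop T -> T (x + y) = T x + T y.
Proof. by move=> [Tl _]; rewrite -[x in LHS]scale1r Tl scale1r. Qed.

Lemma bop_at0 T : bop T -> T 0 = 0.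
Proof. by move=> Tb; apply: (@addrI _ (T 0)); rewrite -bopD // !addr0. Qed.

Lemma bopZ T a x : bop T -> T (a *: x) = a *: T x.
Proof. by move=> Tb; have [Tl _] := Tb; rewrite -[a *: x]addr0 Tl bop_at0 // addr0. Qed.

Lemma bopN T x : bop T -> T (- x) = - T x.
Proof. by move=> Tb; rewrite -scaleN1r bopZ // scaleN1r. Qed.

Lemma bopB T x y : bop T -> T (x - y) = T x - T y.
Proof. by move=> Tb; rewrite bopD // bopN. Qed.

Lemma bop_sum T I (s : seq I) (P : pred I) (F : I -> H) : bop T ->
  T (\sum_(i <- s | P i) F i) = \sum_(i <- s | P i) T (F i).
Proof. by move=> Tb; apply: (big_morph T) => [x y|]; [exact: bopD | exact: bop_at0]. Qed.

Lemma bop_pos T : bop T -> exists2 K : R, 0 < K & forall x, rnorm (T x) <= K * rnorm x.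
Proof.
move=> [_ [K hK]]; exists (`|K| + 1); first by rewrite ltr_wpDl.
move=> x; rewrite (le_trans (hK x)) // ler_wpM2r ?rnorm_ge0 //.
by have := ler_norm K; lra.
Qed.

Lemma bop_zero : bop 0.
Proof.
split=> [a x y|]; first by rewrite -![(0 : H -> H) _]/(0 : H) scaler0 addr0.
by exists 0 => x; rewrite -[(0 : H -> H) _]/(0 : H) rnorm0 mul0r.
Qed.

Lemma bop_id : bop id.
Proof. by split=> //; exists 1 => x; rewrite mul1r. Qed.

Lemma bop_comp S T : bop S -> bop T -> bop (S \o T).
Proof.
move=> Sb Tb; split=> [a x y|]; first by rewrite /= bopD // bopZ // bopD // bopZ.
have [K K0 hK] := bop_pos Sb; have [L L0 hL] := bop_pos Tb.
exists (K * L) => x /=; rewrite (le_trans (hK _)) // -mulrA ler_wpM2l ?(ltW K0) //.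
Qed.

Lemma bop_lincomb a S T : bop S -> bop T -> bop (a *: S + T).
Proof.
move=> Sb Tb; split=> [b x y|].
  rewrite !fctE bopD // bopZ // [T _]bopD // [T (_ *: _)]bopZ // !scalerDr !scalerA addrACA.
  by rewrite mulrC.
have [K K0 hK] := bop_pos Sb; have [L L0 hL] := bop_pos Tb.
exists (rnorm a * K + L) => x; rewrite !fctE (le_trans (rnormD _ _)) // mulrDl lerD //.
by rewrite rnormZ -mulrA ler_wpM2l ?rnorm_ge0.
Qed.

Lemma bop_add S T : bop S -> bop T -> bop (S + T).
Proof. by move=> Sb Tb; rewrite -[S]scale1r; exact: bop_lincomb. Qed.

Lemma bop_scale a S : bop S -> bop (a *: S).
Proof. by move=> Sb; rewrite -[_ *: _]addr0; exact: bop_lincomb bop_zero. Qed.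

Lemma bop_opp S : bop S -> bop (- S).
Proof. by rewrite -scaleN1r; exact: bop_scale. Qed.

Lemma bop_complement P : bop P -> bop (complement P).
Proof. by move=> Pb; apply: bop_add bop_id (bop_opp Pb). Qed.

Lemma adjoint_exists T : bop T -> exists S, bop S /\ is_adjoint T S.
Proof.
move=> Tb; have [K K0 hK] := bop_pos Tb.
have /choice[S hS] y : exists z, forall x, hdot (T x) y = hdot x z.
  apply: (@riesz _ _ _ (K * rnorm y)) => [a x z|x]; first by rewrite bopD // bopZ // hdotDl hdotZl.
  rewrite (le_trans (hdot_CS _ _)) // mulrAC ler_wpM2r ?rnorm_ge0 //.
exists S; split=> [|x y]; last exact: hS.
split=> [a y z|].
  by apply: hdot_eqr => x; rewrite -hS hdotDr hdotZr !hS -hdotZr -hdotDr.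
exists K => y; have [->|Sy0] := eqVneq (rnorm (S y)) 0; first by rewrite mulr_ge0 ?rnorm_ge0 ?ltW.
have Syp : 0 < rnorm (S y) by rewrite lt0r Sy0 rnorm_ge0.
rewrite -(ler_pM2l Syp) -expr2 rnorm_sqr_hdot -hS (le_trans (Re_le_rnorm _)) //.
by rewrite (le_trans (hdot_CS _ _)) // mulrA ler_wpM2r ?rnorm_ge0 // mulrC.
Qed.

Lemma adjointP T : bop T -> bop (adjoint T) /\ is_adjoint T (adjoint T).
Proof. by move=> Tb; exact: (xgetPex 0 (adjoint_exists Tb)). Qed.

Lemma bop_adjoint T : bop T -> bop (adjoint T). Proof. by move=> /adjointP[]. Qed.

Lemma hdot_adjoint T x y : bop T -> hdot (T x) y = hdot x (adjoint T y).
Proof. by move=> /adjointP[_]; exact. Qed.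

Lemma hdot_adjointr T x y : bop T -> hdot x (T y) = hdot (adjoint T x) y.
Proof. by move=> Tb; rewrite hdotC hdot_adjoint // -hdotC. Qed.

Lemma adjoint_unique T S : bop T -> is_adjoint T S -> adjoint T = S.
Proof.
by move=> Tb TS; apply/funext => y; apply: hdot_eqr => x; rewrite -hdot_adjoint.
Qed.

Lemma adjointK T : bop T -> adjoint (adjoint T) = T.
Proof.
move=> Tb; apply: adjoint_unique; first exact: bop_adjoint.
by move=> x y; rewrite -hdot_adjointr.
Qed.

Lemma adjoint_comp S T : bop S -> bop T -> adjoint (S \o T) = adjoint T \o adjoint S.
Proof.
move=> Sb Tb; apply: adjoint_unique; first exact: bop_comp.
by move=> x y /=; rewrite hdot_adjoint // hdot_adjoint.
Qed.

Lemma adjoint_lincomb a S T : bop S -> bop T ->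
  adjoint (a *: S + T) = Num.conj a *: adjoint S + adjoint T.
Proof.
move=> Sb Tb; apply: adjoint_unique; first exact: bop_lincomb.
by move=> x y; rewrite !fctE hdotDl hdotZl hdotDr hdotZr conjCK !hdot_adjoint.
Qed.

Lemma adjoint_id : adjoint (@id H) = id.
Proof. by apply: adjoint_unique => //; exact: bop_id. Qed.

Lemma selfadjoint_complement P : bop P -> selfadjoint P -> selfadjoint (complement P).
Proof.
move=> Pb Ps; apply: adjoint_unique; first exact: bop_complement.
by move=> x y; rewrite /complement hdotDl hdotNl hdot_adjoint // Ps hdotDr hdotNr.
Qed.

Lemma complement_idem P : bop P -> P \o P = P -> complement P \o complement P = complement P.
Proof.
move=> Pb PP; apply/funext => x; rewrite /complement /= bopB // -[P (P x)]/((P \o P) x) PP.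
by rewrite subrr subr0.
Qed.

End BoundedOperators.

Section ProductHilbert.
Variables (R : realType) (H1 H2 : hilbert R).
Local Notation V := (H1 * H2)%type.

Definition prod_dot (x y : V) : R[i] := hdot x.1 y.1 + hdot x.2 y.2.

Lemma prod_dot_linear a (x y z : V) : prod_dot (a *: x + y) z = a * prod_dot x z + prod_dot y z.
Proof. by rewrite /prod_dot /= !hdotDl !hdotZl mulrDr addrACA. Qed.

Lemma prod_dotC (x y : V) : prod_dot x y = Num.conj (prod_dot y x).
Proof. by rewrite /prod_dot rmorphD /= -!hdotC. Qed.

Lemma prod_dot_sqr (x : V) : prod_dot x x = (rnorm x.1 ^+ 2 + rnorm x.2 ^+ 2)%:C%C.
Proof. by rewrite /prod_dot !hdot_rnorm -rmorphD. Qed.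

Lemma prod_dot_ge0 (x : V) : 0 <= prod_dot x x.
Proof. by rewrite prod_dot_sqr ler0c addr_ge0 ?sqr_ge0. Qed.

Lemma prod_dot_eq0 (x : V) : prod_dot x x = 0 -> x = 0.
Proof.
rewrite prod_dot_sqr => /(@complexI R) /eqP; rewrite paddr_eq0 ?sqr_ge0 // !sqrf_eq0.
by case: x => a b /= /andP[/eqP /rnorm0_eq0 -> /eqP /rnorm0_eq0 ->].
Qed.

Lemma prod_dot_complete (u : nat -> V) :
  (forall e : R, 0 < e -> exists N, forall p q, (N <= p)%N -> (N <= q)%N ->
     complex.Re (prod_dot (u p - u q) (u p - u q)) < e) ->
  exists l, forall e : R, 0 < e -> exists N, forall p, (N <= p)%N ->
     complex.Re (prod_dot (u p - l) (u p - l)) < e.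
Proof.
move=> uc.
have [a ha] : exists l, forall e : R, 0 < e -> exists n, forall p, (n <= p)%N -> rnorm ((u p).1 - l) < e.
  apply: hilbert_complete => e e0; have [N hN] := uc (e ^+ 2) (exprn_gt0 2 e0).
  exists N => p q Np Nq; rewrite -ltr_sqr ?nnegrE ?rnorm_ge0 ?(ltW e0) //.
  by have := hN p q Np Nq; rewrite prod_dot_sqr /=; apply: le_lt_trans; rewrite lerDl sqr_ge0.
have [b hb] : exists l, forall e : R, 0 < e -> exists n, forall p, (n <= p)%N -> rnorm ((u p).2 - l) < e.
  apply: hilbert_complete => e e0; have [N hN] := uc (e ^+ 2) (exprn_gt0 2 e0).
  exists N => p q Np Nq; rewrite -ltr_sqr ?nnegrE ?rnorm_ge0 ?(ltW e0) //.
  by have := hN p q Np Nq; rewrite prod_dot_sqr /=; apply: le_lt_trans; rewrite lerDr sqr_ge0.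
exists (a, b) => e e0.
have s0 : 0 < Num.sqrt (e / 2) by rewrite sqrtr_gt0 divr_gt0.
have [n hn] := ha _ s0; have [m hm] := hb _ s0; exists (maxn n m) => p; rewrite geq_max => /andP[np mp].
have := hm _ mp; have := hn _ np; rewrite -ltr_sqr ?nnegrE ?rnorm_ge0 ?sqrtr_ge0 // => h1.
rewrite -ltr_sqr ?nnegrE ?rnorm_ge0 ?sqrtr_ge0 // => h2.
rewrite prod_dot_sqr /= [ltRHS]splitr; have e2 : 0 <= e / 2 by rewrite divr_ge0 // ltW.
by move: h1 h2; rewrite !sqr_sqrtr // => h1 h2; exact: ltrD.
Qed.

Definition prod_prehilbert : prehilbert R :=
  PreHilbert prod_dot_linear prod_dotC prod_dot_ge0 prod_dot_eq0 prod_dot_complete.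
Definition prod_hilbert : hilbert R := hilbert_of prod_prehilbert.

Definition hpair (x : H1) (y : H2) : prod_hilbert := (x, y).
Definition hfst (x : prod_hilbert) : H1 := (x : V).1.
Definition hsnd (x : prod_hilbert) : H2 := (x : V).2.

Lemma prod_hdot (x y : prod_hilbert) : hdot x y = hdot (hfst x) (hfst y) + hdot (hsnd x) (hsnd y).
Proof. by []. Qed.

Lemma prod_rnorm (x : prod_hilbert) : rnorm x ^+ 2 = rnorm (hfst x) ^+ 2 + rnorm (hsnd x) ^+ 2.
Proof. by rewrite rnorm_sqr_hdot prod_hdot !hdot_rnorm. Qed.

Lemma hfst_lin a (x y : prod_hilbert) : hfst (a *: x + y) = a *: hfst x + hfst y.
Proof. by []. Qed.

Lemma hsnd_lin a (x y : prod_hilbert) : hsnd (a *: x + y) = a *: hsnd x + hsnd y.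
Proof. by []. Qed.

Lemma hpair_lin a x y x' y' : hpair (a *: x + x') (a *: y + y') = a *: hpair x y + hpair x' y'.
Proof. by []. Qed.

End ProductHilbert.

(** * Matrix norms on B(H) *)

Section UnitBallSup.
Variables (R : realType) (X : Type) (nu f : X -> R) (sc : R -> X -> X) (x0 : X) (K : R).
Hypotheses (nu_ge0 : forall x, 0 <= nu x) (f_ge0 : forall x, 0 <= f x).
Hypothesis nuZ : forall t x, 0 <= t -> nu (sc t x) = t * nu x.
Hypothesis fZ : forall t x, 0 <= t -> f (sc t x) = t * f x.
Hypothesis fK : forall x, f x <= K * nu x.
Hypothesis nu0 : nu x0 <= 1.
Let s := sup [set f x | x in [set x | nu x <= 1]].

(** One argument serves scalar matrices and matrices of operators: [nu] is the norm of a vector, [f]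
    the norm of its image, [sc] the scaling by nonnegative reals and [x0] a witness that the ball is
    not empty. *)
Lemma has_sup_unit_ball : has_sup [set f x | x in [set x | nu x <= 1]].
Proof.
split; first by exists (f x0), x0.
exists `|K| => _ [x /= x1 <-]; rewrite (le_trans (fK x)) //.
rewrite (@le_trans _ _ (`|K| * nu x)) // ?ler_wpM2r ?ler_norm //.
by rewrite ler_piMr.
Qed.

Lemma sup_unit_ball_ge0 : 0 <= s.
Proof.
by apply: (le_trans (f_ge0 x0)); apply: (sup_upper_bound has_sup_unit_ball); exists x0.
Qed.

Lemma le_sup_unit_ball x : f x <= s * nu x.
Proof.
have [n0|n0] := eqVneq (nu x) 0; first by have := fK x; rewrite n0 !mulr0.
have np : 0 < nu x by rewrite lt0r n0 nu_ge0.
rewrite -ler_pdivrMr // mulrC -fZ ?invr_ge0 ?nu_ge0 //.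
apply: (sup_upper_bound has_sup_unit_ball); exists (sc (nu x)^-1 x) => //=.
by rewrite nuZ ?invr_ge0 ?nu_ge0 // mulVf.
Qed.

Lemma sup_unit_ball_le c : 0 <= c -> (forall x, f x <= c * nu x) -> s <= c.
Proof.
move=> c0 fc; apply: ge_sup; first by have [] := has_sup_unit_ball.
by move=> _ [x /= x1 <-]; rewrite (le_trans (fc x)) // ler_piMr.
Qed.

End UnitBallSup.

Section L2Norm.
Variables (R : realType).

Lemma sum_mul_CS (I : finType) (a b : I -> R) :
  (forall i, 0 <= a i) -> (forall i, 0 <= b i) ->
  (\sum_i a i * b i) ^+ 2 <= (\sum_i a i ^+ 2) * (\sum_i b i ^+ 2).
Proof.
move=> a0 b0; apply: ler_of_quadratic => [|t t0|]; try by apply: sumr_ge0 => i _; rewrite ?sqr_ge0 ?mulr_ge0.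
rewrite !mulr_sumr -big_split /=; apply: ler_sum => i _.
have := sqr_ge0 (a i - t * b i); rewrite sqrrB exprMn -mulr_natl mulrA; lra.
Qed.

Variable V : normedZmodType R[i].
Implicit Types (n : nat).

Definition l2sq n (x : 'cV[V]_n) : R := \sum_i rnorm (x i 0) ^+ 2.

Lemma l2sq_ge0 n (x : 'cV[V]_n) : 0 <= l2sq x.
Proof. by apply: sumr_ge0 => i _; exact: sqr_ge0. Qed.

Lemma l2norm_ge0 n (x : 'cV[V]_n) : 0 <= l2norm x. Proof. exact: sqrtr_ge0. Qed.

Lemma l2norm_sqr n (x : 'cV[V]_n) : l2norm x ^+ 2 = l2sq x.
Proof. by rewrite sqr_sqrtr ?l2sq_ge0. Qed.

Lemma l2norm_le n (x : 'cV[V]_n) (W : normedZmodType R[i]) m (y : 'cV[W]_m) (c : R) :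
  0 <= c -> (l2norm x <= c * l2norm y) = (l2sq x <= c ^+ 2 * \sum_i rnorm (y i 0) ^+ 2).
Proof.
move=> c0; rewrite -ler_sqr ?nnegrE ?mulr_ge0 ?l2norm_ge0 ?sqrtr_ge0 //.
by rewrite exprMn l2norm_sqr sqr_sqrtr ?sumr_ge0 // => i _; rewrite sqr_ge0.
Qed.

Lemma rnorm_le_l2norm n (x : 'cV[V]_n) i : rnorm (x i 0) <= l2norm x.
Proof.
rewrite -ler_sqr ?nnegrE ?rnorm_ge0 ?l2norm_ge0 // l2norm_sqr /l2sq (bigD1 i) //=.
by rewrite lerDl sumr_ge0 // => j _; rewrite sqr_ge0.
Qed.

Lemma sum_rnorm_sqr_le (I : finType) (a : I -> R) : (forall i, 0 <= a i) ->
  \sum_i a i ^+ 2 <= (\sum_i a i) ^+ 2.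
Proof.
move=> a0; rewrite expr2 mulr_suml; apply: ler_sum => i _.
by rewrite expr2 ler_wpM2l // (bigD1 i) //= lerDl sumr_ge0.
Qed.

Lemma l2norm_le_sum n (x : 'cV[V]_n) : l2norm x <= \sum_i rnorm (x i 0).
Proof.
rewrite -ler_sqr ?nnegrE ?l2norm_ge0 ?sumr_ge0 // => [|i _]; last exact: rnorm_ge0.
by rewrite l2norm_sqr sum_rnorm_sqr_le // => i; exact: rnorm_ge0.
Qed.

Lemma rnorm_sum (I : Type) (s : seq I) (P : pred I) (F : I -> V) :
  rnorm (\sum_(i <- s | P i) F i) <= \sum_(i <- s | P i) rnorm (F i).
Proof.
elim/big_rec2: _ => [|i a b _ h]; first by rewrite rnorm0.
by rewrite (le_trans (rnormD _ _)) // lerD2l.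
Qed.

Lemma l2normD n (x y : 'cV[V]_n) : l2norm (x + y) <= l2norm x + l2norm y.
Proof.
rewrite -ler_sqr ?nnegrE ?addr_ge0 ?l2norm_ge0 // sqrrD !l2norm_sqr.
have cs := sum_mul_CS (fun i => rnorm_ge0 (x i 0)) (fun i => rnorm_ge0 (y i 0)).
have s0 : 0 <= \sum_i rnorm (x i 0) * rnorm (y i 0).
  by apply: sumr_ge0 => i _; rewrite mulr_ge0 ?rnorm_ge0.
have {}cs : \sum_i rnorm (x i 0) * rnorm (y i 0) <= l2norm x * l2norm y.
  by rewrite -ler_sqr ?nnegrE ?mulr_ge0 ?l2norm_ge0 // exprMn !l2norm_sqr.
apply: (@le_trans _ _ (\sum_i (rnorm (x i 0) + rnorm (y i 0)) ^+ 2)).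
  by apply: ler_sum => i _; rewrite ler_sqr ?nnegrE ?addr_ge0 ?rnorm_ge0 // mxE rnormD.
have -> : \sum_i (rnorm (x i 0) + rnorm (y i 0)) ^+ 2 =
    l2sq x + (\sum_i rnorm (x i 0) * rnorm (y i 0)) *+ 2 + l2sq y.
  by rewrite /l2sq -sumrMnl -!big_split; apply: eq_bigr => i _; rewrite sqrrD.
by rewrite lerD2r lerD2l lerMn2r cs orbT.
Qed.

Lemma l2sq_eq0 n (x : 'cV[V]_n) : l2sq x = 0 -> x = 0.
Proof.
move=> /eqP; rewrite psumr_eq0 => [/allP h|i _]; last exact: sqr_ge0.
apply/matrixP => i j; rewrite ord1 mxE; apply: rnorm0_eq0; apply/eqP.
by have := h i (mem_index_enum _); rewrite sqrf_eq0.
Qed.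

Lemma l2sq_col_mx m n (x : 'cV[V]_m) (y : 'cV[V]_n) : l2sq (col_mx x y) = l2sq x + l2sq y.
Proof.
rewrite /l2sq big_split_ord /=; congr (_ + _); apply: eq_bigr => i _.
  by rewrite col_mxEu.
by rewrite col_mxEd.
Qed.

Lemma l2norm0 n : l2norm (0 : 'cV[V]_n) = 0.
Proof.
apply/eqP; rewrite sqrtr_eq0 big1 // => i _; by rewrite mxE rnorm0 expr0n.
Qed.

End L2Norm.

Section ScalarMatrixNorm.
Variable R : realType.
Implicit Types (n : nat).

Lemma l2normZ (V : normedModType R[i]) n (a : R[i]) (x : 'cV[V]_n) :
  l2norm (map_mx ( *:%R a) x) = rnorm a * l2norm x.
Proof.
rewrite -[rnorm a]ger0_norm ?rnorm_ge0 // -sqrtr_sqr -sqrtrM ?sqr_ge0 // /l2norm; congr Num.sqrt.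
by rewrite mulr_sumr; apply: eq_bigr => i _; rewrite mxE rnormZ exprMn.
Qed.

Lemma scalar_mx_bounded n (l : 'M[R[i]]_n) : exists K : R,
  forall x : 'cV[R[i]]_n, l2norm (l *m x) <= K * l2norm x.
Proof.
exists (\sum_i \sum_k rnorm (l i k)) => x; rewrite (le_trans (l2norm_le_sum _)) // mulr_suml.
apply: ler_sum => i _; rewrite mxE (le_trans (rnorm_sum _ _ _)) // mulr_suml.
by apply: ler_sum => k _; rewrite rnormM ler_wpM2l ?rnorm_ge0 // rnorm_le_l2norm.
Qed.

Lemma l2normZc n (t : R) (x : 'cV[R[i]]_n) : 0 <= t -> l2norm (t%:C%C *: x) = t * l2norm x.
Proof.
move=> t0; have -> : t%:C%C *: x = map_mx ( *:%R (t%:C%C : R[i]^o)) (x : 'cV[R[i]^o]_n).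
  by apply/matrixP => i j; rewrite !mxE.
by rewrite (@l2normZ R[i]^o) rnorm_real ger0_norm.
Qed.

Lemma scalar_mxnorm_ball n (l : 'M[R[i]]_n) (x : 'cV[R[i]]_n) :
  l2norm (l *m x) <= scalar_mxnorm l * l2norm x.
Proof.
have [K hK] := scalar_mx_bounded l.
apply: (@le_sup_unit_ball R _ (@l2norm R _ n) (fun x => l2norm (l *m x)) (fun t x => t%:C%C *: x) 0 K) => //.
- by move=> y; exact: l2norm_ge0.
- by move=> t y t0; rewrite l2normZc.
- by move=> t y t0; rewrite -scalemxAr l2normZc.
- by rewrite l2norm0.
Qed.

Lemma scalar_mxnorm_ge0 n (l : 'M[R[i]]_n) : 0 <= scalar_mxnorm l.
Proof.
have [K hK] := scalar_mx_bounded l.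
apply: (@sup_unit_ball_ge0 R _ (@l2norm R _ n) (fun x => l2norm (l *m x)) 0 K) => //.
- by move=> y; exact: l2norm_ge0.
- by move=> y; exact: l2norm_ge0.
- by rewrite l2norm0.
Qed.

Lemma scalar_mxnorm_le n (l : 'M[R[i]]_n) (c : R) : 0 <= c ->
  (forall x : 'cV[R[i]]_n, l2norm (l *m x) <= c * l2norm x) -> scalar_mxnorm l <= c.
Proof.
move=> c0 H; have [K hK] := scalar_mx_bounded l.
apply: (@sup_unit_ball_le R _ (@l2norm R _ n) (fun x => l2norm (l *m x)) 0 K) => //.
- by move=> y; exact: l2norm_ge0.
- by rewrite l2norm0.
Qed.

End ScalarMatrixNorm.

Section OperatorMatrixNorm.
Variables (R : realType) (H : hilbert R).
Local Notation bop := (@bounded_operators R H).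
Implicit Types (n : nat).

Definition mxapp m n (T : 'M[H -> H]_(m, n)) (x : 'cV[H]_n) : 'cV[H]_m :=
  mulmx_by (fun t (x : H) => t x) T x.

Lemma mxappE m n (T : 'M[H -> H]_(m, n)) x i j : mxapp T x i j = \sum_k T i k (x k 0).
Proof. by rewrite ord1 mxE. Qed.

Lemma mxapp_bounded n (T : 'M[H -> H]_n) : mx_in bop T ->
  exists K : R, forall x, l2norm (mxapp T x) <= K * l2norm x.
Proof.
move=> Tb.
have /choice[K hK] : forall ik : 'I_n * 'I_n, exists K, 0 < K /\ forall x, rnorm (T ik.1 ik.2 x) <= K * rnorm x.
  by move=> [i k]; have [K K0 hK] := bop_pos (Tb i k); exists K.
exists (\sum_i \sum_k K (i, k)) => x; rewrite (le_trans (l2norm_le_sum _)) // mulr_suml.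
apply: ler_sum => i _; rewrite mxappE (le_trans (rnorm_sum _ _ _)) // mulr_suml.
apply: ler_sum => k _; have [K0 {}hK] := hK (i, k); rewrite (le_trans (hK _)) //.
by rewrite ler_wpM2l ?(ltW K0) // rnorm_le_l2norm.
Qed.

Lemma mxappZ n (T : 'M[H -> H]_n) (a : R[i]) x : mx_in bop T ->
  mxapp T (map_mx ( *:%R a) x) = map_mx ( *:%R a) (mxapp T x).
Proof.
move=> Tb; apply/matrixP => i j; rewrite [RHS]mxE !mxappE scaler_sumr.
by apply: eq_bigr => k _; rewrite mxE bopZ.
Qed.

Section Bounds.
Variables (n : nat) (T : 'M[H -> H]_n).
Hypothesis Tb : mx_in bop T.

Lemma opnorm_ball x : l2norm (mxapp T x) <= operator_mxnorm T * l2norm x.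
Proof.
have [K hK] := mxapp_bounded Tb.
apply: (@le_sup_unit_ball R _ (@l2norm R H n) (fun x => l2norm (mxapp T x))
  (fun t x => map_mx ( *:%R (t%:C%C)) x) 0 K) => //.
- by move=> y; exact: l2norm_ge0.
- by move=> t y t0; rewrite l2normZ rnorm_real ger0_norm.
- by move=> t y t0; rewrite mxappZ // l2normZ rnorm_real ger0_norm.
- by rewrite l2norm0.
Qed.

Lemma opnorm_ge0 : 0 <= operator_mxnorm T.
Proof.
have [K hK] := mxapp_bounded Tb.
apply: (@sup_unit_ball_ge0 R _ (@l2norm R H n) (fun x => l2norm (mxapp T x)) 0 K) => //.
- by move=> y; exact: l2norm_ge0.
- by move=> y; exact: l2norm_ge0.
- by rewrite l2norm0.
Qed.

Lemma opnorm_le (c : R) : 0 <= c -> (forall x, l2norm (mxapp T x) <= c * l2norm x) -> operator_mxnorm T <= c.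
Proof.
move=> c0 h; have [K hK] := mxapp_bounded Tb.
apply: (@sup_unit_ball_le R _ (@l2norm R H n) (fun x => l2norm (mxapp T x)) 0 K) => //.
- by move=> y; exact: l2norm_ge0.
- by rewrite l2norm0.
Qed.

Lemma opnorm_le_sq (c : R) : 0 <= c -> (forall x, l2sq (mxapp T x) <= c ^+ 2 * l2sq x) -> operator_mxnorm T <= c.
Proof. by move=> c0 h; apply: opnorm_le => // x; rewrite l2norm_le //; exact: h. Qed.

Lemma opnorm_ball_sq x : l2sq (mxapp T x) <= operator_mxnorm T ^+ 2 * l2sq x.
Proof. by have := opnorm_ball x; rewrite l2norm_le // opnorm_ge0. Qed.

Lemma opnorm_eq0 : operator_mxnorm T = 0 -> T = 0.
Proof.
move=> T0; apply/matrixP => i j; rewrite mxE; apply/funext => v.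
have := opnorm_ball (\col_k (if k == j then v else 0)); rewrite T0 mul0r => h.
apply: rnorm0_eq0; apply/eqP; rewrite eq_le rnorm_ge0 andbT.
have := le_trans (rnorm_le_l2norm _ i) h.
rewrite mxappE (bigD1 j) //= big1 ?addr0 ?mxE ?eqxx // => k kj.
by rewrite mxE (negbTE kj) bop_at0.
Qed.

End Bounds.

Lemma mx_in_comp m n p (S : 'M[H -> H]_(m, n)) (T : 'M[H -> H]_(n, p)) :
  mx_in bop S -> mx_in bop T -> mx_in bop (mulmx_by (fun s t : H -> H => s \o t) S T).
Proof.
move=> Sb Tb i j; rewrite mxE; elim/big_ind: _ => [|f g|k _]; first exact: bop_zero.
  exact: bop_add.
exact: bop_comp.
Qed.

Lemma fct_sumE' I (s : seq I) (P : pred I) (F : I -> H -> H) x :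
  (\sum_(i <- s | P i) F i) x = \sum_(i <- s | P i) F i x.
Proof. by elim/big_rec2: _ => // i a b _ <-. Qed.

Lemma mxapp_comp m n p (S : 'M[H -> H]_(m, n)) (T : 'M[H -> H]_(n, p)) x :
  mx_in bop S -> mxapp (mulmx_by (fun s t : H -> H => s \o t) S T) x = mxapp S (mxapp T x).
Proof.
move=> Sb; apply/matrixP => i j; rewrite !mxappE.
under eq_bigr => k _ do rewrite mxE fct_sumE'.
rewrite exchange_big /=; apply: eq_bigr => k _.
by rewrite mxappE bop_sum.
Qed.

Lemma mxappD m n (S T : 'M[H -> H]_(m, n)) x : mxapp (S + T) x = mxapp S x + mxapp T x.
Proof.
apply/matrixP => i j; rewrite [RHS]mxE !mxappE -big_split /=.
by apply: eq_bigr => k _; rewrite mxE.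
Qed.

Lemma mxapp_scale m n a (T : 'M[H -> H]_(m, n)) x :
  mxapp (map_mx ( *:%R a) T) x = map_mx ( *:%R a) (mxapp T x).
Proof.
apply/matrixP => i j; rewrite [RHS]mxE !mxappE scaler_sumr.
by apply: eq_bigr => k _; rewrite mxE.
Qed.

Lemma mx_in_scale n a (T : 'M[H -> H]_n) : mx_in bop T -> mx_in bop (map_mx ( *:%R a) T).
Proof. by move=> Tb i j; rewrite mxE; exact: bop_scale. Qed.

Lemma opnormZ n a (T : 'M[H -> H]_n) : mx_in bop T ->
  operator_mxnorm (map_mx ( *:%R a) T) = rnorm a * operator_mxnorm T.
Proof.
move=> Tb; have le b S : mx_in bop S -> operator_mxnorm (map_mx ( *:%R b) S) <= rnorm b * operator_mxnorm (S : 'M_n).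
  move=> Sb; apply: opnorm_le => [||x]; first exact: mx_in_scale.
    by rewrite mulr_ge0 ?rnorm_ge0 ?opnorm_ge0.
  by rewrite mxapp_scale l2normZ -mulrA ler_wpM2l ?rnorm_ge0 // opnorm_ball.
apply/eqP; rewrite eq_le le //=; have [->|a0] := eqVneq a 0.
  by rewrite rnorm0 mul0r opnorm_ge0 //; exact: mx_in_scale.
have na : 0 < rnorm a by rewrite lt0r rnorm_ge0 andbT; apply: contraNneq a0 => /rnorm0_eq0 ->.
have := le a^-1 _ (mx_in_scale a Tb).
have -> : map_mx ( *:%R a^-1) (map_mx ( *:%R a) T) = T.
  by apply/matrixP => i j; rewrite !mxE scalerA mulVf // scale1r.
rewrite -(ler_pM2l na) mulrA -rnormM divff //.
by rewrite rnorm1 mul1r.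
Qed.

Lemma opnormD n (S T : 'M[H -> H]_n) : mx_in bop S -> mx_in bop T ->
  operator_mxnorm (S + T) <= operator_mxnorm S + operator_mxnorm T.
Proof.
move=> Sb Tb; apply: opnorm_le => [i j||x].
- by rewrite mxE; exact: bop_add.
- by rewrite addr_ge0 ?opnorm_ge0.
by rewrite mxappD (le_trans (l2normD _ _)) // mulrDl lerD ?opnorm_ball.
Qed.

Lemma opnorm_comp n (S T : 'M[H -> H]_n) : mx_in bop S -> mx_in bop T ->
  operator_mxnorm (mulmx_by (fun s t : H -> H => s \o t) S T) <= operator_mxnorm S * operator_mxnorm T.
Proof.
move=> Sb Tb; apply: opnorm_le => [||x].
- exact: mx_in_comp.
- by rewrite mulr_ge0 ?opnorm_ge0.
rewrite mxapp_comp // (le_trans (opnorm_ball Sb _)) // -mulrA ler_wpM2l ?opnorm_ge0 //.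
exact: opnorm_ball.
Qed.

Lemma mx_in_block (E : set (H -> H)) m n (S : 'M[H -> H]_m) (T : 'M[H -> H]_n) :
  E 0 -> mx_in E S -> mx_in E T -> mx_in E (block_mx S 0 0 T).
Proof.
move=> E0 SE TE i j; case: (split_ordP i) => i' ->; case: (split_ordP j) => j' ->;
by rewrite ?block_mxEul ?block_mxEur ?block_mxEdl ?block_mxEdr ?mxE.
Qed.

Lemma mxapp_block m n (S : 'M[H -> H]_m) (T : 'M[H -> H]_n) x y :
  mxapp (block_mx S 0 0 T) (col_mx x y) = col_mx (mxapp S x) (mxapp T y).
Proof.
apply/matrixP => i j; rewrite mxappE big_split_ord /=.
case: (split_ordP i) => i' ->; rewrite ?col_mxEu ?col_mxEd mxappE.
  rewrite [X in _ + X]big1 ?addr0 => [|k _]; last by rewrite block_mxEur mxE.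
  by apply: eq_bigr => k _; rewrite block_mxEul col_mxEu.
rewrite [X in X + _]big1 ?add0r => [|k _]; last by rewrite block_mxEdl mxE.
by apply: eq_bigr => k _; rewrite block_mxEdr col_mxEd.
Qed.

Lemma opnorm_dsum m n (S : 'M[H -> H]_m) (T : 'M[H -> H]_n) : mx_in bop S -> mx_in bop T ->
  operator_mxnorm (block_mx S 0 0 T) = Num.max (operator_mxnorm S) (operator_mxnorm T).
Proof.
move=> Sb Tb; have STb : mx_in bop (block_mx S 0 0 T) by apply: mx_in_block => //; exact: bop_zero.
have m0 : 0 <= Num.max (operator_mxnorm S) (operator_mxnorm T) by rewrite le_max opnorm_ge0.
apply/eqP; rewrite eq_le; apply/andP; split.
  apply: opnorm_le_sq => // x; rewrite -[x]vsubmxK mxapp_block !l2sq_col_mx mulrDr.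
  by rewrite lerD // (le_trans (opnorm_ball_sq _ _)) // ler_wpM2r ?l2sq_ge0 // ler_sqr ?nnegrE ?opnorm_ge0 // le_max lexx ?orbT.
rewrite ge_max; apply/andP; split; apply: opnorm_le_sq => //; try exact: opnorm_ge0.
  move=> x; have := opnorm_ball_sq STb (col_mx x 0).
  by rewrite mxapp_block !l2sq_col_mx [l2sq 0]big1 ?addr0 => [|i _]; [apply: le_trans; rewrite lerDl l2sq_ge0 | rewrite mxE rnorm0 expr0n].
move=> x; have := opnorm_ball_sq STb (col_mx 0 x).
by rewrite mxapp_block !l2sq_col_mx [l2sq 0]big1 ?add0r => [|i _]; [apply: le_trans; rewrite lerDr l2sq_ge0 | rewrite mxE rnorm0 expr0n].
Qed.

End OperatorMatrixNorm.

Section VectorScalarAction.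
Variables (R : realType) (H : hilbert R).

Lemma l2sq_hdot n (x : 'cV[H]_n) : l2sq x = complex.Re (\sum_i hdot (x i 0) (x i 0)).
Proof. by rewrite Re_sum; apply: eq_bigr => i _; rewrite rnorm_sqr_hdot. Qed.

(** The vectors may be dependent: one whose residual [y] vanishes adds nothing to the family, so [m]
    is only known to exist. *)
Lemma gram_schmidt (s : seq H) : exists (m : nat) (e : 'I_m -> H),
  (forall a b, hdot (e a) (e b) = (a == b)%:R) /\
  (forall x, x \in s -> exists c : 'I_m -> R[i], x = \sum_a c a *: e a).
Proof.
elim: s => [|x s [m [e [on sp]]]].
  by exists 0%N, (fun=> 0); split=> [[]|].
pose y := x - \sum_a hdot x (e a) *: e a.
have xy : x = \sum_a hdot x (e a) *: e a + y by rewrite addrC subrK.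
have yo b : hdot y (e b) = 0.
  rewrite hdotDl hdotNl (big_morph (fun z => hdot z (e b)) (fun u v => hdotDl u v _) (linear0l _ _)).
  rewrite (bigD1 b) //= big1 => [|a ab]; last by rewrite hdotZl on (negbTE ab) mulr0.
  by rewrite hdotZl on eqxx mulr1 addr0 subrr.
have [y0|y0] := eqVneq y 0.
  exists m, e; split=> // z; rewrite inE => /predU1P[->|/sp//].
  by exists (fun a => hdot x (e a)); rewrite [LHS]xy y0 addr0.
have ny : rnorm y != 0 by apply: contra_neq y0 => /rnorm0_eq0.
pose f := ((rnorm y)^-1)%:C%C *: y.
pose e' (a : 'I_m.+1) := if unlift ord0 a is Some b then e b else f.
have e'0 : e' ord0 = f by rewrite /e' unlift_none.
have e'S b : e' (lift ord0 b) = e b by rewrite /e' liftK.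
exists m.+1, e'; split=> [a b|z].
  have ff : hdot f f = 1.
    rewrite hdotZl hdotZr conj_realc hdot_rnorm -!rmorphM /= (_ : _^-1 * _ = 1) //.
    by rewrite expr2 mulKf // mulVf.
  have fe c : hdot f (e c) = 0 by rewrite hdotZl yo mulr0.
  case: (unliftP ord0 a) => [a'|] ->; case: (unliftP ord0 b) => [b'|] ->; rewrite ?e'S ?e'0.
  - by rewrite on (inj_eq lift_inj).
  - by rewrite hdotC fe rmorph0 eq_sym (negbTE (neq_lift _ _)).
  - by rewrite fe (negbTE (neq_lift _ _)).
  - by rewrite ff eqxx.
have sum_e' (c : 'I_m.+1 -> R[i]) : \sum_a c a *: e' a = c ord0 *: f + \sum_b c (lift ord0 b) *: e b.
  by rewrite big_ord_recl e'0; congr (_ + _); apply: eq_bigr => b _; rewrite e'S.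
rewrite inE => /predU1P[->|/sp[c ->]].
  exists (fun a => if unlift ord0 a is Some b then hdot x (e b) else (rnorm y)%:C%C).
  rewrite sum_e' unlift_none scalerA -rmorphM /= divff // scale1r [LHS]xy addrC; congr (_ + _).
  by apply: eq_bigr => b _; rewrite liftK.
exists (fun a => if unlift ord0 a is Some b then c b else 0).
by rewrite sum_e' unlift_none scale0r add0r; apply: eq_bigr => b _; rewrite liftK.
Qed.

Lemma rnorm_sqr_orthonormal m (e : 'I_m -> H) (c : 'I_m -> R[i]) :
  (forall a b, hdot (e a) (e b) = (a == b)%:R) ->
  rnorm (\sum_a c a *: e a) ^+ 2 = \sum_a rnorm (c a) ^+ 2.
Proof.
move=> on; rewrite rnorm_sqr_hdot.
have dl z : hdot (\sum_a c a *: e a) z = \sum_a c a * hdot (e a) z.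
  rewrite (big_morph (fun u => hdot u z) (fun u v => hdotDl u v _) (linear0l _ _)).
  by apply: eq_bigr => a _; rewrite hdotZl.
rewrite dl Re_sum; apply: eq_bigr => a _.
have -> : hdot (e a) (\sum_b c b *: e b) = Num.conj (c a).
  rewrite hdotC dl (bigD1 a) //= on eqxx mulr1 big1 ?addr0 // => b ba.
  by rewrite on (negbTE ba) mulr0.
by rewrite mul_conj.
Qed.

(* Expanding the entries of [x] in an orthonormal basis of their span reduces
   the bound to the scalar columns of coefficients. *)
Lemma scalar_action_bound n (l : 'M[R[i]]_n) (x : 'cV[H]_n) :
  l2sq (mulmx_by *:%R l x) <= scalar_mxnorm l ^+ 2 * l2sq x.
Proof.
have [m [e [on sp]]] := gram_schmidt [seq x i 0 | i : 'I_n].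
have /choice[c hc] i : exists c : 'I_m -> R[i], x i 0 = \sum_a c a *: e a.
  by apply: sp; apply/mapP; exists i; rewrite ?mem_enum.
have -> : l2sq x = \sum_a l2sq (\col_i c i a).
  rewrite /l2sq exchange_big /=; apply: eq_bigr => i _; rewrite hc rnorm_sqr_orthonormal //.
  by apply: eq_bigr => a _; rewrite mxE.
have -> : l2sq (mulmx_by *:%R l x) = \sum_a l2sq (l *m \col_i c i a).
  rewrite /l2sq exchange_big /=; apply: eq_bigr => i _; rewrite mxE.
  have -> : \sum_k l i k *: x k 0 = \sum_a (l *m \col_i c i a) i 0 *: e a.
    under eq_bigr => k _ do rewrite hc scaler_sumr.
    rewrite exchange_big /=; apply: eq_bigr => a _; rewrite mxE scaler_suml.
    by apply: eq_bigr => k _; rewrite mxE scalerA.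
  by rewrite rnorm_sqr_orthonormal.
rewrite mulr_sumr; apply: ler_sum => a _.
have := scalar_mxnorm_ball l (\col_i c i a).
by rewrite l2norm_le ?scalar_mxnorm_ge0.
Qed.

Lemma bop_bigsum (I : finType) (F : I -> H -> H) :
  (forall i, bounded_operators (F i)) -> bounded_operators (\sum_i F i).
Proof.
by move=> Fb; elim/big_ind: _ => //; [exact: bop_zero | move=> f g; exact: bop_add].
Qed.

Lemma opnorm_scale n (l m : 'M[R[i]]_n) (T : 'M[H -> H]_n) : mx_in (@bounded_operators R H) T ->
  operator_mxnorm (mulmx_by (fun v (a : R[i]) => a *: v) (mulmx_by *:%R l T) m)
    <= scalar_mxnorm l * operator_mxnorm T * scalar_mxnorm m.
Proof.
move=> Tb; set S := mulmx_by _ _ m.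
have Sb : mx_in (@bounded_operators R H) S.
  move=> i j; rewrite mxE; apply: bop_bigsum => k; apply: bop_scale; rewrite mxE.
  by apply: bop_bigsum => r; apply: bop_scale.
apply: opnorm_le_sq => // [|x]; first by rewrite !mulr_ge0 ?scalar_mxnorm_ge0 ?opnorm_ge0.
have -> : mxapp S x = mulmx_by *:%R l (mxapp T (mulmx_by *:%R m x)).
  apply/matrixP => i j; rewrite ord1 mxappE [RHS]mxE.
  under [RHS]eq_bigr => r _.
    rewrite mxappE scaler_sumr; under eq_bigr => k _.
      by rewrite mxE bop_sum // scaler_sumr; under eq_bigr => p _ do rewrite bopZ //; over.
    over.
  under [LHS]eq_bigr => p _.
    rewrite mxE fct_sumE'; under eq_bigr => k _.
      rewrite mxE -[(_ *: _) _]/(m k p *: _) fct_sumE' scaler_sumr.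
      under eq_bigr => r _ do rewrite -[(_ *: _) _]/(l i r *: _) scalerA mulrC -scalerA.
      over.
    over.
  under eq_bigr => p _ do rewrite exchange_big /=.
  rewrite exchange_big /=; apply: eq_bigr => r _.
  by rewrite exchange_big.
have sq4 (a b c d : R) : (a * b * c) ^+ 2 * d = a ^+ 2 * (b ^+ 2 * (c ^+ 2 * d)) by ring.
rewrite sq4.
rewrite (le_trans (scalar_action_bound _ _)) // ler_wpM2l ?sqr_ge0 //.
rewrite (le_trans (opnorm_ball_sq Tb _)) // ler_wpM2l ?sqr_ge0 //.
exact: scalar_action_bound.
Qed.

End VectorScalarAction.

(** * Norm-closed sets of operators *)

Section AdjointMatrix.
Variables (R : realType) (H : hilbert R).
Local Notation bop := (@bounded_operators R H).

Lemma hdot_suml (I : finType) (F : I -> H) z : hdot (\sum_i F i) z = \sum_i hdot (F i) z.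
Proof. exact: (big_morph (fun u => hdot u z) (fun u v => hdotDl u v _) (linear0l _ _)). Qed.

Lemma hdot_sumr (I : finType) (F : I -> H) z : hdot z (\sum_i F i) = \sum_i hdot z (F i).
Proof. by rewrite hdotC hdot_suml rmorph_sum; apply: eq_bigr => i _ /=; rewrite -hdotC. Qed.

Lemma mxapp_adjoint m n (T : 'M[H -> H]_(m, n)) x (y : 'cV[H]_m) : mx_in bop T ->
  \sum_i hdot (mxapp T x i 0) (y i 0) = \sum_j hdot (x j 0) (mxapp (map_mx (@adjoint R H) T^T) y j 0).
Proof.
move=> Tb; under eq_bigr => i _ do rewrite mxappE hdot_suml.
rewrite exchange_big /=; apply: eq_bigr => j _.
rewrite mxappE hdot_sumr; apply: eq_bigr => i _.
by rewrite !mxE hdot_adjoint.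
Qed.

Lemma Re_sum_hdot_le n (x y : 'cV[H]_n) : complex.Re (\sum_i hdot (x i 0) (y i 0)) <= l2norm x * l2norm y.
Proof.
rewrite (le_trans (Re_le_rnorm _)) // (le_trans (rnorm_sum _ _ _)) //.
apply: (@le_trans _ _ (\sum_i rnorm (x i 0) * rnorm (y i 0))).
  by apply: ler_sum => i _; exact: hdot_CS.
rewrite -ler_sqr ?nnegrE ?mulr_ge0 ?l2norm_ge0 ?sumr_ge0 // => [|i _]; last by rewrite mulr_ge0 ?rnorm_ge0.
by rewrite exprMn !l2norm_sqr sum_mul_CS // => i; exact: rnorm_ge0.
Qed.

Lemma adjoint_mx_bound n (T : 'M[H -> H]_n) (c : R) : mx_in bop T -> 0 <= c ->
  (forall x, l2norm (mxapp T x) <= c * l2norm x) ->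
  forall y, l2norm (mxapp (map_mx (@adjoint R H) T^T) y) <= c * l2norm y.
Proof.
move=> Tb c0 Tc y; set z := mxapp _ y.
have [z0|zn] := eqVneq (l2norm z) 0; first by rewrite z0 mulr_ge0 ?l2norm_ge0.
have zp : 0 < l2norm z by rewrite lt0r zn l2norm_ge0.
rewrite -(ler_pM2l zp) -expr2 l2norm_sqr l2sq_hdot -mxapp_adjoint //.
rewrite (le_trans (Re_sum_hdot_le _ _)) // mulrA ler_wpM2r ?l2norm_ge0 //.
by rewrite mulrC.
Qed.

End AdjointMatrix.

Section NormClosedSets.
Variables (R : realType) (H : hilbert R).
Local Notation bop := (@bounded_operators R H).
Implicit Types (S T : H -> H) (E F : set (H -> H)).

Lemma mx_in_const E T : E T -> mx_in E (const_mx T : 'M_1).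
Proof. by move=> ET i j; rewrite mxE. Qed.

Lemma l2norm_const (x : H) : l2norm (const_mx x : 'cV_1) = rnorm x.
Proof. by rewrite /l2norm big_ord1 mxE sqrtr_sqr ger0_norm ?rnorm_ge0. Qed.

Lemma mxapp_const T x : mxapp (const_mx T : 'M_1) (const_mx x) = const_mx (T x).
Proof. by apply/matrixP => i j; rewrite mxappE big_ord1 !mxE. Qed.

Lemma col1_const (x : 'cV[H]_1) : x = const_mx (x 0 0).
Proof. by apply/matrixP => i j; rewrite !ord1 mxE. Qed.

Lemma operator_norm_ball T x : bop T -> rnorm (T x) <= operator_norm T * rnorm x.
Proof.
by move=> Tb; have := opnorm_ball (mx_in_const Tb) (const_mx x); rewrite mxapp_const !l2norm_const.
Qed.

Lemma operator_norm_ge0 T : bop T -> 0 <= operator_norm T.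
Proof. by move=> Tb; exact: (opnorm_ge0 (mx_in_const Tb)). Qed.

Lemma operator_norm_le T (c : R) : bop T -> 0 <= c -> (forall x, rnorm (T x) <= c * rnorm x) ->
  operator_norm T <= c.
Proof.
move=> Tb c0 h; apply: (opnorm_le (mx_in_const Tb)) => // x.
by rewrite [x]col1_const mxapp_const !l2norm_const.
Qed.

Lemma bop_sub S T : bop S -> bop T -> bop (S - T).
Proof. by move=> Sb Tb; apply: bop_add => //; exact: bop_opp. Qed.

Lemma fctBE S T x : (S - T) x = S x - T x. Proof. by []. Qed.

Lemma cvg0P (v : nat -> R) : (forall n, 0 <= v n) ->
  (v @ \oo --> (0 : R)) <-> (forall e : R, 0 < e -> exists N, forall n, (N <= n)%N -> v n < e).
Proof.
move=> v0; split=> [/cvgrPdist_lt vc e /vc[N _ hN]|h].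
  by exists N => n Nn; have := hN n Nn; rewrite /= sub0r normrN ger0_norm.
apply/cvgrPdist_lt => e /h[N hN]; exists N => // n /hN.
by rewrite /= sub0r normrN ger0_norm.
Qed.

Lemma bop_complete (u : nat -> H -> H) : (forall n, bop (u n)) ->
  (forall e : R, 0 < e -> exists N, forall p q, (N <= p)%N -> (N <= q)%N -> operator_norm (u p - u q) < e) ->
  exists T, bop T /\ (fun n => operator_norm (u n - T)) @ \oo --> (0 : R).
Proof.
move=> ub uc.
have dist n m x : rnorm (u n x - u m x) <= operator_norm (u n - u m) * rnorm x.
  by rewrite -fctBE operator_norm_ball //; exact: bop_sub.
have /choice[T hT] x : exists l, forall e : R, 0 < e -> exists N, forall p, (N <= p)%N -> rnorm (u p x - l) < e.
  apply: hilbert_complete => e e0; have x1 : 0 < rnorm x + 1 by have := rnorm_ge0 x; lra.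
  have [N hN] := uc (e / (rnorm x + 1)) (divr_gt0 e0 x1); exists N => p q Np Nq.
  rewrite (le_lt_trans (dist _ _ _)) //; have := hN p q Np Nq; rewrite ltr_pdivlMr //.
  apply: le_lt_trans; rewrite ler_wpM2l ?operator_norm_ge0 //; last by lra.
  exact: bop_sub.
have lim e : 0 < e -> exists N, forall p, (N <= p)%N -> forall x, rnorm (u p x - T x) <= e * rnorm x.
  move=> e0; have [N hN] := uc e e0; exists N => p Np x; apply: ler_of_addgt0 => d d0.
  have [M hM] := hT x d d0; pose q := maxn N M.
  have -> : u p x - T x = (u p x - u q x) + (u q x - T x) by rewrite addrA subrK.
  rewrite (le_trans (rnormD _ _)) // lerD //; last by rewrite ltW // hM // leq_maxr.
  rewrite (le_trans (dist _ _ _)) // ler_wpM2r ?rnorm_ge0 // ltW // hN // leq_maxl //.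
have Tb : bop T.
  have [N hN] := lim 1 ltr01.
  split=> [a x y|].
    apply/eqP; rewrite -subr_eq0; apply/eqP/rnorm0_eq0/eqP; rewrite eq_le rnorm_ge0 andbT.
    apply: ler_of_addgt0 => e e0; rewrite add0r.
    pose k := rnorm (a *: x + y) + rnorm a * rnorm x + rnorm y.
    have k0 : 0 < k + 1 by rewrite ltr_wpDl // !addr_ge0 ?mulr_ge0 ?rnorm_ge0.
    have [M hM] := lim (e / (k + 1)) (divr_gt0 e0 k0).
    have {}hM := hM M (leqnn M).
    have -> : T (a *: x + y) - (a *: T x + T y) =
       - (u M (a *: x + y) - T (a *: x + y)) + (a *: (u M x - T x) + (u M y - T y)).
      by have [-> _] := ub M; rewrite scalerBr addrACA -opprD opprB addrA subrK.
    apply: (@le_trans _ _ (e / (k + 1) * k)); last first.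
      by rewrite -mulrA ler_piMr ?(ltW e0) // mulrC ler_pdivrMr //; lra.
    rewrite /k !mulrDr (le_trans (rnormD _ _)) // rnormN -addrA lerD // (le_trans (rnormD _ _)) //.
    by rewrite lerD // rnormZ mulrCA ler_wpM2l ?rnorm_ge0.
  exists (operator_norm (u N) + 1) => x.
  have -> : T x = u N x - (u N x - T x) by rewrite subKr.
  rewrite (le_trans (rnormD _ _)) // rnormN mulrDl lerD ?operator_norm_ball //.
  exact: hN.
exists T; split=> //; apply/cvg0P => [n|e e0]; first by apply: operator_norm_ge0; exact: bop_sub.
have e2 : 0 < e / 2 by rewrite divr_gt0.
have [N hN] := lim _ e2; exists N => n Nn; apply: (@le_lt_trans _ _ (e / 2)); last by lra.
by apply: operator_norm_le; [exact: bop_sub | exact: ltW | move=> x; exact: hN].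
Qed.

(** Closedness is pulled back along additive Lipschitz maps; sandwiches, daggers and corners are all
    treated in this way. *)
Lemma norm_closed_preim F (f : (H -> H) -> H -> H) (c : R) :
  norm_closed F -> 0 <= c -> (forall T, bop T -> bop (f T)) ->
  (forall S T, bop S -> bop T -> f (S - T) = f S - f T) ->
  (forall T, bop T -> operator_norm (f T) <= c * operator_norm T) ->
  norm_closed [set T | bop T /\ F (f T)].
Proof.
move=> Fc c0 fb fB fc u T uF Tb uT; split=> //; apply: (Fc (f \o u)) => [n||].
- by have [] := uF n.
- exact: fb.
have ub n : bop (u n) by have [] := uF n.
apply/cvg0P => [n|e e0]; first by apply: operator_norm_ge0; apply: bop_sub; exact: fb.
have c1 : 0 < c + 1 by lra.
have ug n : 0 <= operator_norm (u n - T) by apply: operator_norm_ge0; exact: bop_sub.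
have [N hN] := (cvg0P ug).1 uT _ (divr_gt0 e0 c1); exists N => n Nn /=.
rewrite -fB // (le_lt_trans (fc _ _)) //; first exact: bop_sub.
have := hN n Nn; rewrite ltr_pdivlMr // mulrC; apply: le_lt_trans.
by rewrite ler_wpM2r //; lra.
Qed.

Lemma norm_closedI E F : norm_closed E -> norm_closed F -> norm_closed (E `&` F).
Proof.
move=> Ec Fc u T uEF Tb uT; split; [apply: (Ec u) | apply: (Fc u)] => // n; by have [] := uEF n.
Qed.

Lemma norm_closed0 : norm_closed [set (0 : H -> H)].
Proof.
move=> u T u0 Tb uT /=; apply/funext => x; apply: rnorm0_eq0; apply/eqP.
rewrite eq_le rnorm_ge0 andbT; apply: ler_of_addgt0 => e e0; rewrite add0r.
have ub n : bop (u n) by rewrite (u0 n); exact: bop_zero.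
have ug n : 0 <= operator_norm (u n - T) by apply: operator_norm_ge0; exact: bop_sub.
have x1 : 0 < rnorm x + 1 by have := rnorm_ge0 x; lra.
have [N hN] := (cvg0P ug).1 uT _ (divr_gt0 e0 x1).
have := hN N (leqnn N); rewrite (u0 N) sub0r ltr_pdivlMr // => h.
have := operator_norm_ball x (bop_opp Tb); rewrite -[(- T) x]/(- T x) rnormN => h'.
apply: (le_trans h'); apply: le_trans (ltW h); rewrite ler_wpM2l ?operator_norm_ge0 //; last by lra.
exact: bop_opp.
Qed.

Lemma operator_norm_comp S T : bop S -> bop T -> operator_norm (S \o T) <= operator_norm S * operator_norm T.
Proof.
move=> Sb Tb; apply: operator_norm_le => [||x /=]; first exact: bop_comp.
  by rewrite mulr_ge0 ?operator_norm_ge0.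
by rewrite (le_trans (operator_norm_ball _ Sb)) // -mulrA ler_wpM2l ?operator_norm_ge0 ?operator_norm_ball.
Qed.

Lemma norm_closed_sandwich F P Q : norm_closed F -> bop P -> bop Q ->
  norm_closed [set T | bop T /\ F (P \o T \o Q)].
Proof.
move=> Fc Pb Qb.
apply: (@norm_closed_preim F (fun T => P \o T \o Q) (operator_norm P * operator_norm Q)) => //.
- by rewrite mulr_ge0 ?operator_norm_ge0.
- by move=> T Tb; apply: bop_comp => //; exact: bop_comp.
- by move=> S T Sb Tb; apply/funext => x; rewrite /= fctBE /= fctBE bopB.
move=> T Tb; rewrite (le_trans (operator_norm_comp _ _)) //; first exact: bop_comp.
rewrite mulrAC ler_wpM2r ?operator_norm_ge0 //; exact: operator_norm_comp.
Qed.

End NormClosedSets.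

(** * Operator algebras in B(H) *)

Section BoundedOperatorAlgebras.
Variables (R : realType) (H : hilbert R).
Local Notation bop := (@bounded_operators R H).
Implicit Types (S T : H -> H) (E F : set (H -> H)).

Lemma mx_in_sub E F m n (T : 'M[H -> H]_(m, n)) : E `<=` F -> mx_in E T -> mx_in F T.
Proof. by move=> EF TE i j; apply: EF. Qed.

Lemma bh_operator_space E : closed_subspace E -> is_operator_space (bh_space E).
Proof.
move=> [Eb [E0 El] Ec].
have b n (x : 'M[H -> H]_n) : mx_in E x -> mx_in bop x by exact: mx_in_sub.
split=> /=.
- by split.
- by move=> n x /b; exact: opnorm_eq0.
- by move=> n a x /b; exact: opnormZ.
- by move=> n x y /b xb /b; exact: opnormD.
- move=> u uE uc; have [n||T [Tb uT]] := @bop_complete R H u; first exact/Eb.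
    exact: uc.
  by exists T; split=> //; exact: (Ec u).
- by move=> n l m x /b; exact: opnorm_scale.
- by move=> n m x y /b xb /b; exact: opnorm_dsum.
Qed.

Variable U : H -> H.
Hypotheses (Ub : bop U) (Us : adjoint U = U) (UU : U \o U = id).
Local Notation dag := (dagger U).

Lemma bop_dagger T : bop T -> bop (dag T).
Proof. by move=> Tb; apply: bop_comp => //; apply: bop_comp => //; exact: bop_adjoint. Qed.

Lemma UUx x : U (U x) = x. Proof. by rewrite -[LHS]/((U \o U) x) UU. Qed.

Lemma daggerK T : bop T -> dag (dag T) = T.
Proof.
move=> Tb; have Tab := bop_adjoint Tb; rewrite /dagger.
rewrite (adjoint_comp (bop_comp Ub Tab) Ub) (adjoint_comp Ub Tab) adjointK // Us.
by apply/funext => x /=; rewrite !UUx.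
Qed.

Lemma dagger_comp S T : bop S -> bop T -> dag (S \o T) = dag T \o dag S.
Proof.
move=> Sb Tb; rewrite /dagger adjoint_comp //; apply/funext => x /=.
by rewrite UUx.
Qed.

Lemma dagger_lincomb a S T : bop S -> bop T -> dag (a *: S + T) = Num.conj a *: dag S + dag T.
Proof.
move=> Sb Tb; rewrite /dagger adjoint_lincomb //; apply/funext => x /=.
by rewrite -[(_ + _) (U x)]/(_ *: _ + _) bopD // bopZ.
Qed.

Lemma daggerD S T : bop S -> bop T -> dag (S + T) = dag S + dag T.
Proof. by move=> Sb Tb; have := dagger_lincomb 1 Sb Tb; rewrite rmorph1 !scale1r. Qed.

Lemma dagger0 : dag 0 = 0.
Proof.
apply: (@addrI _ (dag 0)); rewrite -daggerD ?addr0 //; exact: bop_zero.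
Qed.

Lemma dagger_sub S T : bop S -> bop T -> dag (S - T) = dag S - dag T.
Proof.
move=> Sb Tb; have := dagger_lincomb (-1) Tb Sb.
by rewrite rmorphN1 !scaleN1r addrC => ->; rewrite addrC.
Qed.

Lemma mx_in_dagger n (T : 'M[H -> H]_n) : mx_in bop T -> mx_in bop (map_mx dag T^T).
Proof. by move=> Tb i j; rewrite !mxE; exact: bop_dagger. Qed.

Lemma l2norm_unitary n (x : 'cV[H]_n) : l2norm (map_mx U x) = l2norm x.
Proof.
rewrite /l2norm; congr Num.sqrt; apply: eq_bigr => i _; rewrite mxE !rnorm_sqr_hdot.
by rewrite hdot_adjoint // Us UUx.
Qed.

(** On H^n the transposed matrix of adjoints is the adjoint of [T] and obeys the same bound, and
    applying [U] to every entry of a column is isometric. *)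
Lemma opnorm_dagger_le n (T : 'M[H -> H]_n) : mx_in bop T ->
  operator_mxnorm (map_mx dag T^T) <= operator_mxnorm T.
Proof.
move=> Tb; apply: opnorm_le; [exact: mx_in_dagger | exact: opnorm_ge0 | move=> x].
have -> : mxapp (map_mx dag T^T) x = map_mx U (mxapp (map_mx (@adjoint R H) T^T) (map_mx U x)).
  apply/matrixP => i j; rewrite [RHS]mxE !mxappE bop_sum //.
  by apply: eq_bigr => k _; rewrite !mxE.
rewrite l2norm_unitary -(l2norm_unitary x).
apply: adjoint_mx_bound => //; [exact: opnorm_ge0 | exact: opnorm_ball].
Qed.

Lemma opnorm_dagger n (T : 'M[H -> H]_n) : mx_in bop T ->
  operator_mxnorm (map_mx dag T^T) = operator_mxnorm T.
Proof.
move=> Tb; apply/eqP; rewrite eq_le opnorm_dagger_le //=.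
have := opnorm_dagger_le (mx_in_dagger Tb).
suff -> : map_mx dag (map_mx dag T^T)^T = T by [].
by apply/matrixP => i j; rewrite !mxE daggerK.
Qed.

Lemma operator_norm_dagger_le T : bop T -> operator_norm (dag T) <= operator_norm T.
Proof.
move=> Tb; have := opnorm_dagger_le (mx_in_const Tb).
suff -> : map_mx dag (const_mx T : 'M_1)^T = const_mx (dag T) by [].
by apply/matrixP => i j; rewrite !mxE.
Qed.

Lemma norm_closed_dagger F : norm_closed F -> norm_closed [set T | bop T /\ F (dag T)].
Proof.
move=> Fc; apply: (@norm_closed_preim _ _ F dag 1) => //.
- exact: bop_dagger.
- exact: dagger_sub.
by move=> T Tb; rewrite mul1r operator_norm_dagger_le.
Qed.

Lemma comp_bilinear (E F G : set (H -> H)) : E `<=` bop -> (forall S T, E S -> F T -> G (S \o T)) ->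
  bilinear_on E F G (fun S T : H -> H => S \o T).
Proof.
move=> Eb EFG; split=> // S ES a T T' FT FT'; apply/funext => x /=.
by rewrite -[(_ + _) x]/(a *: T x + T' x) bopD ?bopZ //; exact: Eb.
Qed.

Lemma bh_operator_star_algebra E : closed_subalgebra E -> (forall T, E T -> E (dag T)) ->
  is_operator_star_algebra (bh_staralgebra U E).
Proof.
move=> [Es Em] Ed; have [Eb _ _] := Es.
have b n (x : 'M[H -> H]_n) : mx_in E x -> mx_in bop x by exact: mx_in_sub.
split=> //=.
- split=> /=.
  + exact: bh_operator_space.
  + exact: comp_bilinear.
  + by [].
  + by move=> n x y /b xb /b; exact: opnorm_comp.
- by move=> a x y /Eb xb /Eb; exact: dagger_lincomb.
- by move=> x y /Eb xb /Eb; exact: dagger_comp.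
- by move=> x /Eb; exact: daggerK.
- by move=> n x /b; exact: opnorm_dagger.
Qed.

Lemma bh_operator_star_correspondence (A B X : set (H -> H)) :
  closed_subalgebra A -> (forall T, A T -> A (dag T)) ->
  closed_subalgebra B -> (forall T, B T -> B (dag T)) -> closed_subspace X ->
  (forall S T, A S -> X T -> X (S \o T)) -> (forall S T, X S -> B T -> X (S \o T)) ->
  (forall S T, X S -> X T -> B (dag S \o T)) ->
  is_operator_star_correspondence (bh_correspondence U A B X).
Proof.
move=> Aa Ad Ba Bd Xs AX XB XX.
have [[Ab _ _] _] := Aa; have [[Bb _ _] _] := Ba; have [Xb _ _] := Xs.
have ab n (x : 'M[H -> H]_n) : mx_in A x -> mx_in bop x by exact: mx_in_sub.
have bb n (x : 'M[H -> H]_n) : mx_in B x -> mx_in bop x by exact: mx_in_sub.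
have xb n (x : 'M[H -> H]_n) : mx_in X x -> mx_in bop x by exact: mx_in_sub.
split=> //=.
- exact: bh_operator_star_algebra.
- split=> //=.
  + exact: bh_operator_star_algebra.
  + split=> //=; [exact: bh_operator_space | exact: comp_bilinear | ].
    by move=> n x y /xb ? /bb; exact: opnorm_comp.
  + move=> x /Xb Xx a y z /Xb Xy /Xb Xz; apply/funext => v /=.
    have db := bop_dagger Xx.
    by rewrite -[in LHS]/(dag x ((a *: y + z) v)) -[(_ + _) v]/(a *: y v + z v) bopD // bopZ.
  + by move=> x y /Xb Xx /Xb Xy; rewrite dagger_comp ?daggerK //; exact: bop_dagger.
  + move=> n x y /xb Xx /xb Xy.
    (* The matrix pairing is the product of the matrix involution of [x] with [y], so
       submultiplicativity and [opnorm_dagger] bound it. *)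
    have -> : mulmx_by (fun S T : H -> H => dag S \o T) x^T y =
        mulmx_by (fun S T : H -> H => S \o T) (map_mx dag x^T) y.
      by apply/matrixP => i j; rewrite !mxE; apply: eq_bigr => k _; rewrite !mxE.
    rewrite (le_trans (opnorm_comp _ _)) //; first exact: mx_in_dagger.
    by rewrite opnorm_dagger.
- split=> //=; [exact: bh_operator_space | exact: comp_bilinear | ].
  by move=> n x y /ab ? /xb; exact: opnorm_comp.
- by move=> a x y /Ab Aa' /Xb Xx /Xb Xy; rewrite dagger_comp.
Qed.

End BoundedOperatorAlgebras.

Section Corners.
Variables (R : realType) (H : hilbert R).
Local Notation bop := (@bounded_operators R H).
Implicit Types (S T P Q : H -> H) (E F : set (H -> H)).

(** As P E Q is contained in [E], it is the set of those [T] in [E] that are fixed by T -> P T Q; it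
    is thus cut out of [E] by the kernel of a bounded map, and norm closedness follows. *)
Lemma closed_subspace_corner P Q E : closed_subspace E -> bop P -> bop Q ->
  P \o P = P -> Q \o Q = Q ->
  (forall T, E T -> E (P \o T)) -> (forall T, E T -> E (T \o Q)) -> closed_subspace (corner P E Q).
Proof.
move=> [Eb [E0 El] Ec] Pb Qb PP QQ EP EQ.
have sub : corner P E Q `<=` E by move=> _ [T ET <-]; exact/EQ/EP.
have cE T : corner P E Q T <-> E T /\ P \o T \o Q = T.
  split=> [[S ES <-]|[ET h]]; last by exists T.
  split; first exact/EQ/EP.
  by apply/funext => x /=; rewrite -[Q (Q x)]/((Q \o Q) x) QQ -[P (P _)]/((P \o P) _) PP.
split.
- by move=> T /sub /Eb.
- split; first by apply/cE; split=> //; apply/funext => x /=; rewrite bop_at0.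
  move=> a S T /cE[ES hS] /cE[ET hT]; apply/cE; split; first exact: El.
  apply/funext => x /=; rewrite -![(a *: S + T) _]/(a *: S _ + T _) bopD // bopZ //.
  by rewrite -[in RHS]hS -[in RHS]hT.
have -> : corner P E Q = E `&` [set T | bop T /\ (P \o T \o Q) - T = 0].
  apply/seteqP; split=> T; first by move=> /cE[ET hT]; split=> //; split; [exact: Eb|apply/eqP; rewrite subr_eq0 hT].
  by move=> [ET [_ /eqP]]; rewrite subr_eq0 => /eqP hT; apply/cE.
apply: norm_closedI => //.
apply: (@norm_closed_preim _ _ [set (0 : H -> H)] (fun T => (P \o T \o Q) - T) (operator_norm P * operator_norm Q + 1)).
- exact: norm_closed0.
- by rewrite addr_ge0 ?mulr_ge0 ?operator_norm_ge0.
- by move=> T Tb; apply: bop_sub => //; apply: bop_comp => //; exact: bop_comp.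
- move=> S T Sb Tb; apply/funext => x; rewrite !fctBE /= !fctBE bopB //.
  by rewrite !opprD !opprK addrACA.
move=> T Tb; have PTQ : bop (P \o T \o Q) by apply: bop_comp => //; exact: bop_comp.
apply: operator_norm_le => [||x].
- exact: bop_sub.
- by rewrite mulr_ge0 ?addr_ge0 ?mulr_ge0 ?operator_norm_ge0.
rewrite fctBE (le_trans (rnormD _ _)) // rnormN !mulrDl mul1r lerD ?operator_norm_ball //.
rewrite (le_trans (operator_norm_ball _ Pb)) // -!mulrA ler_wpM2l ?operator_norm_ge0 //.
rewrite (le_trans (operator_norm_ball _ Tb)) // mulrCA ler_wpM2l ?operator_norm_ge0 //.
exact: operator_norm_ball.
Qed.

End Corners.

Section CornerAlgebra.
Variables (R : realType) (H : hilbert R).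
Local Notation bop := (@bounded_operators R H).
Implicit Types (S T P Q U : H -> H) (E : set (H -> H)).

Lemma compE S T (F : H -> H) : S \o T = F -> forall x : H, S (T x) = F x.
Proof. by move=> <-. Qed.

Lemma corner_comp P Q P' E S T : closed_subalgebra E -> Q \o Q = Q ->
  (forall T, E T -> E (T \o Q)) -> corner P E Q S -> corner Q E P' T -> corner P E P' (S \o T).
Proof.
move=> [_ Em] QQ EQ [S0 ES <-] [T0 ET <-]; exists ((S0 \o Q) \o T0); first by apply: Em => //; exact: EQ.
by apply/funext => x /=; rewrite (compE QQ).
Qed.

Lemma corner_dagger U P Q E T : bop U -> bop P -> bop Q -> E `<=` bop ->
  dagger U P = P -> dagger U Q = Q -> U \o U = id -> (forall T, E T -> E (dagger U T)) ->
  corner P E Q T -> corner Q E P (dagger U T).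
Proof.
move=> Ub Pb Qb Eb dP dQ UU Ed [T0 ET <-]; exists (dagger U T0); first exact: Ed.
have T0b := Eb _ ET.
by rewrite (dagger_comp UU (bop_comp Pb T0b) Qb) (dagger_comp UU Pb T0b) dP dQ.
Qed.

Lemma dagger_commuting U P : bop U -> adjoint U = U -> U \o U = id ->
  selfadjoint P -> P \o U = U \o P -> dagger U P = P.
Proof.
move=> Ub Us UU Ps PU; rewrite /dagger Ps; apply/funext => x /=.
by rewrite (compE PU) /= (compE UU).
Qed.

Lemma complement_commuting U P : bop U -> P \o U = U \o P -> complement P \o U = U \o complement P.
Proof.
move=> Ub PU; apply/funext => x; rewrite /complement /= bopB //.
by rewrite (compE PU).
Qed.

Lemma dagger_invariant U (A : set (H -> H)) : dagger U @` A = A -> forall T, A T -> A (dagger U T).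
Proof. by move=> h T AT; rewrite -h; exists T. Qed.

Lemma self_adjoint_unitary_involutive U : selfadjoint U -> unitary U -> U \o U = id.
Proof. by move=> Us [_ + _]; rewrite Us. Qed.

End CornerAlgebra.

Lemma standard_form_corners (R : realType) (L : mnstaralgebra R) (H : hilbert R) (pi : L -> H -> H)
    (U P : H -> H) :
  is_operator_star_algebra L -> is_standard_form pi U -> compatible_projection pi U P ->
  let piL := pi @` carrier L in
  let PLP := corner P piL P in
  let B := corner (complement P) piL (complement P) in
  let X := corner P piL (complement P) in
  [/\ closed_subalgebra PLP /\ is_operator_star_algebra (bh_staralgebra U PLP),
      closed_subalgebra B /\ is_operator_star_algebra (bh_staralgebra U B)
    & forall A : set (H -> H),
        closed_subalgebra A -> A `<=` PLP -> dagger U @` A = A ->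
        closed_subspace X /\ is_operator_star_correspondence (bh_correspondence U A B X)].
Proof.
move=> Lstar sf cp E PLP B X.
have Us := sf_selfadjoint sf; have Uu := sf_unitary sf; have [Ub _ _] := Uu.
have UU := self_adjoint_unitary_involutive Us Uu.
have Ea : closed_subalgebra E := sf_image sf.
have [Es Em] := Ea; have [Eb [E0 El] Ec] := Es.
have [Pb PP Ps] := cp_projection cp; have PU := cp_commute cp.
pose Q := complement P.
have Qb : bounded_operators Q by exact: bop_complement.
have QQ : Q \o Q = Q by exact: complement_idem.
have Qs : selfadjoint Q by exact: selfadjoint_complement.
have dP : dagger U P = P by exact: dagger_commuting.
have dQ : dagger U Q = Q by apply: dagger_commuting => //; exact: complement_commuting.
have EP T : E T -> E (P \o T) by move=> [a La <-]; exact: (cp_left cp La).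
have EPr T : E T -> E (T \o P) by move=> [a La <-]; exact: (cp_right cp La).
have EQ T : E T -> E (Q \o T).
  move=> ET; have -> : Q \o T = (-1) *: (P \o T) + T by rewrite scaleN1r addrC.
  by apply: El => //; exact: EP.
have EQr T : E T -> E (T \o Q).
  move=> ET; have -> : T \o Q = (-1) *: (T \o P) + T.
    by apply/funext => x; rewrite /= /Q /complement bopB ?scaleN1r; [rewrite addrC | exact: Eb].
  by apply: El => //; exact: EPr.
(* The condition pi(a)^* = U pi(a^dagger) U, conjugated by [U]. *)
have Ed T : E T -> E (dagger U T).
  move=> [a La <-]; rewrite /dagger (sf_invol sf) //; exists (invol a); first exact: osa_closed.
  by apply/funext => x /=; rewrite !(compE UU).
have PLPa : closed_subalgebra PLP.
  split; first exact: closed_subspace_corner.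
  by move=> S T; exact: corner_comp.
have Ba : closed_subalgebra B.
  split; first exact: closed_subspace_corner.
  by move=> S T; exact: corner_comp.
have Bd T : B T -> B (dagger U T) by exact: corner_dagger.
split.
- by split=> //; apply: bh_operator_star_algebra => // T; exact: corner_dagger.
- by split=> //; apply: bh_operator_star_algebra.
move=> A Aa AP Ad; have Xs : closed_subspace X by exact: closed_subspace_corner.
split=> //; apply: bh_operator_star_correspondence => //.
- exact: dagger_invariant.
- by move=> S T /AP PS XT; apply: (corner_comp Ea PP EPr PS XT).
- by move=> S T XS BT; apply: (corner_comp Ea QQ EQr XS BT).
- move=> S T XS XT; apply: (corner_comp Ea PP EPr _ XT).
  exact: corner_dagger XS.
Qed.

(** * Hahn-Banach and Douglas factorization *)

Section AlgebraicComplement.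
Variables (K : fieldType) (V : lmodType K) (E : set V).
Hypothesis Es : subspace_set E.

Lemma subspace_setD x y : E x -> E y -> E (x + y).
Proof. by have [_ El] := Es => Ex Ey; rewrite -[x]scale1r; apply: El. Qed.

Lemma subspace_setZ a x : E x -> E (a *: x).
Proof. by have [E0 El] := Es => Ex; rewrite -[_ *: _]addr0; apply: El. Qed.

Lemma subspace_setN x : E x -> E (- x).
Proof. by rewrite -scaleN1r; apply: subspace_setZ. Qed.

Lemma subspace_setB x y : E x -> E y -> E (x - y).
Proof. by move=> Ex Ey; apply: subspace_setD => //; apply: subspace_setN. Qed.

Lemma algebraic_complement : exists A : set V, [/\ subspace_set A,
  forall x, A x -> E x -> x = 0 & forall x, exists2 e, E e & A (x - e)].
Proof.
have [E0 El] := Es.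
pose good (F : set V) := (F = set0 \/ subspace_set F) /\ forall x, F x -> E x -> x = 0.
have [|A [[AA AE] Amax]] := @Zorn_bigcup V good.
  move=> C CP Ctot; split; last by move=> x [F CF Fx]; have [_] := CP _ CF; apply.
  have [[F [CF [x0 Fx0]]]|none] := pselect (exists F, C F /\ exists x, F x); last first.
    by left; apply/seteqP; split=> // x [F CF Fx]; case: none; exists F; split=> //; exists x.
  have sub G : C G -> (exists x, G x) -> subspace_set G.
    by move=> CG [x Gx]; have [[G0|//] _] := CP _ CG; rewrite G0 in Gx.
  right; split; first by exists F => //; have [] := sub F CF (ex_intro _ _ Fx0).
  move=> a x y [G CG Gx] [G' CG' Gy].
  have [GG|GG] := Ctot _ _ CG CG'.
    by exists G' => //; have [_] := sub _ CG' (ex_intro _ _ Gy); apply => //; exact: GG.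
  by exists G => //; have [_] := sub _ CG (ex_intro _ _ Gx); apply => //; exact: GG.
have As : subspace_set A.
  case: AA => // A0; exfalso; apply: (Amax [set 0]).
    by rewrite A0; split=> // /(_ 0 erefl).
  by split; [right; split=> // a x y -> ->; rewrite scaler0 addr0 | move=> x ->].
have [A0 Al] := As; exists A; split=> // x.
apply: contrapT => nx.
pose B := [set y | exists c, A (y - c *: x)].
have AB : A `<=` B by move=> y Ay; exists 0; rewrite scale0r subr0.
have Bx : B x by exists 1; rewrite scale1r subrr.
apply: (Amax B).
  by split=> // BA; apply: nx; exists 0 => //; rewrite subr0; exact: BA.
split; first right.
  split; first exact: AB.
  move=> a y z [c Ac] [d Ad]; exists (a * c + d).
  have -> : a *: y + z - (a * c + d) *: x = a *: (y - c *: x) + (z - d *: x).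
    by rewrite scalerBr scalerDl scalerA opprD addrACA.
  exact: Al.
move=> y [c Ac] Ey; have [c0|c0] := eqVneq c 0.
  by apply: AE => //; rewrite c0 scale0r subr0 in Ac.
exfalso; apply: nx; exists (c^-1 *: y); first exact: subspace_setZ.
have -> : x - c^-1 *: y = (- c^-1) *: (y - c *: x) + 0.
  by rewrite addr0 scalerBr !scaleNr opprK scalerA mulVf // scale1r addrC.
exact: Al.
Qed.

(** A linear projection obtained without any topology. Composition with it extends to the whole
    space a functional that makes sense on [E] only. *)
Lemma algebraic_projection : exists r : V -> V,
  [/\ linear r, forall x, E (r x) & forall x, E x -> r x = x].
Proof.
have [A [As AE EA]] := algebraic_complement; have [A0 Al] := As.
have /choice[r hr] x : exists e, E e /\ A (x - e) by have [e] := EA x; exists e.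
have AN x : A x -> A (- x) by move=> Ax; rewrite -[- x]addr0 -scaleN1r; exact: Al.
have uniq x e : E e -> A (x - e) -> r x = e.
  move=> Ee Ae; have [Er Ar] := hr x; apply/eqP; rewrite -subr_eq0; apply/eqP/AE.
    have -> : r x - e = 1 *: - (x - r x) + (x - e) by rewrite scale1r opprB addrA subrK.
    by apply: Al => //; exact: AN.
  exact: subspace_setB.
exists r; split=> [a x y|x|x Ex]; last by apply: uniq => //; rewrite subrr.
  have [Ex Ax] := hr x; have [Ey Ay] := hr y.
  apply: uniq; first by apply: subspace_setD => //; exact: subspace_setZ.
  by rewrite opprD addrACA -scalerBr; exact: Al.
by have [] := hr x.
Qed.

End AlgebraicComplement.

Lemma exists_functional (K : fieldType) (V : lmodType K) (y : V) : y != 0 ->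
  exists f : V -> K, (forall a u v, f (a *: u + v) = a * f u + f v) /\ f y = 1.
Proof.
move=> y0; have Es : subspace_set [set c *: y | c in [set: K]].
  split; first by exists 0; rewrite ?scale0r.
  by move=> a _ _ [c _ <-] [d _ <-]; exists (a * c + d); rewrite // scalerDl scalerA.
have [r [rl rE rid]] := algebraic_projection Es.
have /choice[f hf] x : exists c, r x = c *: y by have [c _ <-] := rE x; exists c.
have inj c d : c *: y = d *: y -> c = d.
  move=> /eqP; rewrite -subr_eq0 -scalerBl scaler_eq0 (negbTE y0) orbF subr_eq0.
  by move/eqP.
exists f; split=> [a u v|].
  by apply: inj; rewrite -hf rl !hf scalerDl scalerA.
by apply: inj; rewrite -hf scale1r rid //; exists 1; rewrite ?scale1r.
Qed.

Section HahnBanach.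
Variables (R : realType) (W : lmodType R).
Implicit Types (p f g : W -> R) (x y v w : W) (t s : R).

Definition sublinear f : Prop :=
  (forall x y, f (x + y) <= f x + f y) /\ (forall t x, 0 < t -> f (t *: x) = t * f x).

Lemma sublinear0 f : sublinear f -> f 0 = 0.
Proof. by move=> [_ fZ]; have := fZ 2 0 (ltr0n R 2); rewrite scaler0; lra. Qed.

Lemma sublinear_lower f x : sublinear f -> - f (- x) <= f x.
Proof. by move=> fs; have [fD _] := fs; have := fD x (- x); rewrite subrr sublinear0 //; lra. Qed.

Lemma sublinear_homog_le f : (forall t x, 0 < t -> f (t *: x) <= t * f x) ->
  forall t x, 0 < t -> f (t *: x) = t * f x.
Proof.
move=> h t x t0; apply/eqP; rewrite eq_le h //=.
have := h t^-1 (t *: x); rewrite invr_gt0 => /(_ t0); rewrite scalerA mulVf ?gt_eqF // scale1r.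
by rewrite ler_pdivlMl.
Qed.

(** The infimum of f (w + t v) - t f v over t >= 0; the values t = 0 and t = 1 give the two bounds.
    At w = - v the second one says g (- v) <= - f v, so [g] is a smaller functional unless [f] was
    already additive along [v]. *)
Lemma sublinear_tilt f v : sublinear f ->
  exists g, [/\ sublinear g, forall w, g w <= f w & forall w, g w <= f (w + v) - f v].
Proof.
move=> fs; have [fD fZ] := fs; have f0 := sublinear0 fs.
have fZ0 t x : 0 <= t -> f (t *: x) = t * f x.
  by rewrite le_eqVlt => /predU1P[<-|/fZ//]; rewrite scale0r mul0r.
pose A w := [set f (w + t *: v) - t * f v | t in [set t | 0 <= t]].
have Al w t : 0 <= t -> - f (- w) <= f (w + t *: v) - t * f v.
  move=> t0; have := fD (- w) (w + t *: v); rewrite addrA addNr add0r fZ0 //; lra.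
have Ainf w : has_inf (A w).
  split; first by exists (f (w + 0 *: v) - 0 * f v), 0 => //=.
  by exists (- f (- w)) => _ [t /= t0 <-]; exact: Al.
have Ale w t : 0 <= t -> inf (A w) <= f (w + t *: v) - t * f v.
  by move=> t0; apply: inf_lbound; [have [] := Ainf w | exists t].
have Age w c : (forall t, 0 <= t -> c <= f (w + t *: v) - t * f v) -> c <= inf (A w).
  by move=> h; apply: lb_le_inf; [have [] := Ainf w | move=> _ [t /= t0 <-]; exact: h].
exists (fun w => inf (A w)); split; last 2 first.
- by move=> w; have := Ale w 0 (lexx _); rewrite scale0r addr0 mul0r subr0.
- by move=> w; have := Ale w 1 ler01; rewrite scale1r mul1r.
split=> [x y|].
  rewrite -lerBlDl; apply: (Age _) => t t0; rewrite lerBlDl -lerBlDr; apply: (Age _) => s s0.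
  rewrite lerBlDr; apply: (le_trans (Ale _ (s + t) _)); first exact: addr_ge0.
  have := fD (x + s *: v) (y + t *: v); rewrite addrACA -scalerDl; lra.
apply: sublinear_homog_le => t x t0; rewrite -ler_pdivrMl //; apply: (Age _) => s s0.
rewrite ler_pdivrMl //; apply: (le_trans (Ale _ (t * s) _)); first by rewrite mulr_ge0 // ltW.
by rewrite -scalerA -scalerDr fZ // mulrBr mulrA.
Qed.

(** A minimal sublinear functional is linear, because it equals each of its tilts. Zorn's lemma
    yields one below the tilt of [p] along [v0], and the value of that tilt at - v0 forces equality
    with [p] at [v0]. *)
Theorem hahn_banach p v0 : sublinear p -> exists q : W -> R,
  [/\ forall t x y, q (t *: x + y) = t * q x + q y, forall x, q x <= p x & q v0 = p v0].
Proof.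
move=> ps; have [p' [p's p'p p'v]] := sublinear_tilt v0 ps.
pose T := {f : W -> R | sublinear f /\ forall x, f x <= p' x}.
(* The order is reversed: maximal elements for [r] are minimal functionals. *)
pose r (f g : T) : bool := `[< forall x, sval g x <= sval f x >].
have [| | | |[m [ms mp]] mmin] := @Zorn T r.
- by move=> f; apply/asboolP.
- by move=> f g h /asboolP fg /asboolP gh; apply/asboolP => x; exact: le_trans (gh x) (fg x).
- move=> [f fP] [g gP] /asboolP /= fg /asboolP /= gf; apply: eq_exist; apply/funext => x.
  by apply/eqP; rewrite eq_le fg gf.
- move=> A Atot; have [[f0 Af0]|none] := pselect (exists f : T, A f); last first.
    exists (exist _ p' (conj p's (fun x => lexx _))) => f Af.
    by case: none; exists f.
  pose C x := [set sval f x | f in A].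
  have Cinf x : has_inf (C x).
    split; first by exists (sval f0 x), f0.
    exists (- p' (- x)) => _ [[f [fs fp]] _ <-] /=.
    by apply: le_trans (sublinear_lower x fs); rewrite lerN2.
  have Cle x (f : T) : A f -> inf (C x) <= sval f x.
    by move=> Af; apply: inf_lbound; [have [] := Cinf x | exists f].
  have Cge x c : (forall f : T, A f -> c <= sval f x) -> c <= inf (C x).
    by move=> h; apply: lb_le_inf; [have [] := Cinf x | move=> _ [f Af <-]; exact: h].
  have inf_s : sublinear (fun x => inf (C x)).
    split=> [x y|].
      rewrite -lerBlDl; apply: (Cge _) => g Ag; rewrite lerBlDl -lerBlDr; apply: (Cge _) => f Af.
      rewrite lerBlDr; have [/asboolP fg|/asboolP gf] := Atot _ _ Af Ag.
        apply: (le_trans (Cle _ _ Ag)); have [[gD _] _] := svalP g.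
        by apply: (le_trans (gD x y)); rewrite lerD2r.
      apply: (le_trans (Cle _ _ Af)); have [[fD _] _] := svalP f.
      by apply: (le_trans (fD x y)); rewrite lerD2l.
    apply: sublinear_homog_le => t x t0; rewrite -ler_pdivrMl //; apply: (Cge _) => f Af.
    rewrite ler_pdivrMl //; have [[_ fZ] _] := svalP f; rewrite -fZ //; exact: (Cle _).
  have ip x : inf (C x) <= p' x.
    by apply: (le_trans (Cle x f0 Af0)); have [_] := svalP f0; exact.
  by exists (exist (fun f : W -> R => sublinear f /\ forall x, f x <= p' x) _ (conj inf_s ip)) => f Af; apply/asboolP => x /=; exact: (Cle _).
have [mD mZ] := ms; have m0 := sublinear0 ms.
have madd w v : m (w + v) = m w + m v.
  have [g [gs gm gv]] := sublinear_tilt v ms.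
  have gp x : g x <= p' x by exact: le_trans (gm x) (mp x).
  have := mmin (exist _ g (conj gs gp)).
  have rmg : r (exist _ m (conj ms mp)) (exist _ g (conj gs gp)) by apply/asboolP.
  move=> /(_ rmg) /(congr1 sval) /= gE; apply/eqP; rewrite eq_le mD /=.
  by have := gv w; rewrite gE; lra.
have mN x : m (- x) = - m x by have := madd x (- x); rewrite subrr m0; lra.
have mZ' t x : m (t *: x) = t * m x.
  have [t0|t0|->] := ltgtP t 0; last by rewrite scale0r mul0r.
    by rewrite -[t]opprK scaleNr mN mZ ?oppr_gt0 // !mulNr.
  exact: mZ.
exists m; split=> [t x y|x|]; first by rewrite madd mZ'.
  exact: le_trans (mp x) (p'p x).
apply/eqP; rewrite eq_le (le_trans (mp _) (p'p _)) /=.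
have := le_trans (mp (- v0)) (p'v (- v0)).
by rewrite mN addNr (sublinear0 ps); lra.
Qed.

End HahnBanach.

Section ColumnSpace.
Variables (R : realType) (n : nat).
Local Notation V := ('cV[R[i]]_n).

Definition col_dot (x y : V) : R[i] := \sum_j x j 0 * Num.conj (y j 0).

Lemma col_dot_linear a x y z : col_dot (a *: x + y) z = a * col_dot x z + col_dot y z.
Proof.
rewrite /col_dot mulr_sumr -big_split /=; apply: eq_bigr => j _.
by rewrite !mxE mulrDl mulrA.
Qed.

Lemma col_dotC x y : col_dot x y = Num.conj (col_dot y x).
Proof.
rewrite /col_dot rmorph_sum; apply: eq_bigr => j _ /=.
by rewrite rmorphM /= conjCK mulrC.
Qed.

Lemma col_dot_sqr x : col_dot x x = (l2sq x)%:C%C.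
Proof. by rewrite /l2sq rmorph_sum; apply: eq_bigr => j _; rewrite mul_conj. Qed.

Lemma col_dot_ge0 x : 0 <= col_dot x x.
Proof. by rewrite col_dot_sqr ler0c l2sq_ge0. Qed.

Definition col_semiinner : semiinner R := SemiInner col_dot_linear col_dotC col_dot_ge0.
Arguments col_semiinner : simpl never.
Local Notation E := col_semiinner.
Local Notation dot := (@si_form R E).

Definition orthonormal_family k (e : 'I_k -> E) := forall a b, dot (e a) (e b) = (a == b)%:R.

Lemma dot_suml (I : finType) (F : I -> E) z : dot (\sum_i F i) z = \sum_i dot (F i) z.
Proof. exact: (big_morph (fun u => dot u z) (fun u v => si_formDl u v z) (si_form0l z)). Qed.

Section Orthonormal.
Variables (k : nat) (e : 'I_k -> E).
Hypothesis on : orthonormal_family e.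

Lemma orthonormal_sum_dot (c : 'I_k -> R[i]) b : dot (\sum_a c a *: e a) (e b) = c b.
Proof.
rewrite dot_suml (bigD1 b) // big1 => [|a /andP[_ ab]]; last by rewrite si_formZl on (negbTE ab) mulr0.
by rewrite Monoid.mulm1 si_formZl on eqxx mulr1.
Qed.

Lemma orthonormal_l2sq (c : 'I_k -> R[i]) : l2sq (\sum_a c a *: e a : V) = \sum_a rnorm (c a) ^+ 2.
Proof.
apply: (@complexI R); rewrite -col_dot_sqr -[LHS]/(dot (\sum_a c a *: e a) (\sum_a c a *: e a)).
rewrite dot_suml rmorph_sum; apply: eq_bigr => a _.
by rewrite si_formZl si_conj orthonormal_sum_dot mul_conj.
Qed.

Lemma bessel (x : E) : \sum_a rnorm (dot x (e a)) ^+ 2 <= l2sq (x : V).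
Proof.
have := si_re_ge0 (x - \sum_a dot x (e a) *: e a).
rewrite si_reB -!/(complex.Re _) -[si_form x x]/(col_dot x x) col_dot_sqr /=.
have -> : complex.Re (dot (\sum_a dot x (e a) *: e a) (\sum_a dot x (e a) *: e a)) = \sum_a rnorm (dot x (e a)) ^+ 2.
  by rewrite -[si_form _ _]/(col_dot _ _) col_dot_sqr /= orthonormal_l2sq.
have -> : complex.Re (dot x (\sum_a dot x (e a) *: e a)) = \sum_a rnorm (dot x (e a)) ^+ 2.
  rewrite si_conj ReJ dot_suml Re_sum; apply: eq_bigr => a _.
  by rewrite si_formZl [dot (e a) x]si_conj mul_conj.
lra.
Qed.

Lemma orthonormal_size : (k <= n)%N.
Proof.
pose A : 'M[R[i]]_(k, n) := \matrix_(a, j) (e a : V) j 0.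
pose B : 'M[R[i]]_(n, k) := \matrix_(j, b) Num.conj ((e b : V) j 0).
have AB : A *m B = 1%:M.
  apply/matrixP => a b; rewrite !mxE -on /= /col_dot; apply: eq_bigr => j _.
  by rewrite !mxE.
have := mxrankM_maxl A B; rewrite AB mxrank1 => h; exact: leq_trans h (rank_leq_col A).
Qed.

End Orthonormal.

(** An orthonormal family in [G] of maximal size, which exists since sizes are at most [n]; a
    nonzero residual of some [g] could be normalized and added to it. *)
Lemma orthonormal_basis (G : set E) : subspace_set G ->
  exists k (e : 'I_k -> E), [/\ orthonormal_family e, forall a, G (e a)
    & forall g, G g -> g = \sum_a dot g (e a) *: e a].
Proof.
move=> [G0 Gl].
pose P k := `[< exists e : 'I_k -> E, orthonormal_family e /\ forall a, G (e a) >].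
have exP : exists k, P k by exists 0%N; apply/asboolP; exists (fun=> 0); split=> [[]|[]].
have leP k : P k -> (k <= n)%N by move=> /asboolP[e [on _]]; exact: orthonormal_size on.
case: (ex_maxnP exP leP) => k /asboolP[e [on Ge]] kmax.
exists k, e; split=> // g Gg; pose y := g - \sum_a dot g (e a) *: e a.
have Gsum (c : 'I_k -> R[i]) : G (\sum_a c a *: e a).
  by elim/big_ind: _ => // [u v Gu Gv|a _]; [rewrite -[u]scale1r; exact: Gl | rewrite -[_ *: _]addr0; exact: Gl].
have Gy : G y by rewrite /y addrC -scaleN1r; apply: Gl.
have yo b : dot y (e b) = 0.
  by rewrite si_formDl si_formNl orthonormal_sum_dot // subrr.
apply/eqP; rewrite -subr_eq0; apply/eqP/(@l2sq_eq0 _ _ n (_ : V)); apply/eqP.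
rewrite -/y; apply: contraTT (leqnn k) => y0; rewrite -ltnNge.
have yp : 0 < l2sq (y : V) by rewrite lt0r y0 l2sq_ge0.
apply: (kmax k.+1); apply/asboolP.
pose f := ((Num.sqrt (l2sq (y : V)))^-1)%:C%C *: y.
have ff : dot f f = 1.
  rewrite si_formZl si_formZr conj_realc -[si_form y y]/(col_dot y y) col_dot_sqr -!rmorphM /=.
  rewrite (_ : _^-1 * _ = 1) // -[l2sq (y : V) in X in _ * (_ * X)]sqr_sqrtr ?l2sq_ge0 // expr2.
  by rewrite mulKf ?mulVf // sqrtr_eq0 -ltNge.
have fo b : dot f (e b) = 0 by rewrite si_formZl yo mulr0.
exists (fun a : 'I_k.+1 => if unlift ord0 a is Some b then e b else f); split=> [a b|a].
  case: (unliftP ord0 a) => [a'|] ->; case: (unliftP ord0 b) => [b'|] ->; rewrite ?liftK ?unlift_none.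
  - by rewrite on (inj_eq lift_inj).
  - by rewrite si_conj fo rmorph0 eq_sym (negbTE (neq_lift _ _)).
  - by rewrite fo (negbTE (neq_lift _ _)).
  - by rewrite ff eqxx.
by case: (unliftP ord0 a) => [a'|] _ //; rewrite /f -[_ *: _]addr0; exact: Gl.
Qed.

End ColumnSpace.

Section Douglas.
Variables (R : realType) (V : lmodType R[i]).
Implicit Types f : V -> R[i].

Definition functional f : Prop := forall a x y, f (a *: x + y) = a * f x + f y.

Lemma functionalD f x y : functional f -> f (x + y) = f x + f y.
Proof. by move=> fl; rewrite -[x in LHS]scale1r fl mul1r. Qed.

Lemma functional0 f : functional f -> f 0 = 0.
Proof. by move=> fl; apply: (@addrI _ (f 0)); rewrite -functionalD // !addr0. Qed.

Lemma functionalZ f a x : functional f -> f (a *: x) = a * f x.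
Proof. by move=> fl; rewrite -[_ *: _]addr0 fl functional0 // addr0. Qed.

Lemma functional_sum f (I : finType) (F : I -> V) : functional f -> f (\sum_i F i) = \sum_i f (F i).
Proof. by move=> fl; apply: (big_morph f) => [x y|]; [exact: functionalD | exact: functional0]. Qed.

Lemma functional_lincomb (I : finType) (c : I -> R[i]) (g : I -> V -> R[i]) :
  (forall i, functional (g i)) -> functional (fun x => \sum_i c i * g i x).
Proof.
move=> gl a x y; rewrite mulr_sumr -big_split /=; apply: eq_bigr => i _.
by rewrite gl mulrDr mulrCA.
Qed.

(* The value vectors of functionals on [z] form a finite dimensional space; an
   orthonormal basis [e a] of it, with [e a] the value vector of [g a], gives
   [u i j = \sum_a g a (x i) * (e a j)^*]. *)
Lemma douglas_factorization m n (x : 'I_m -> V) (z : 'I_n -> V) :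
  (forall f, functional f -> \sum_i rnorm (f (x i)) ^+ 2 <= \sum_j rnorm (f (z j)) ^+ 2) ->
  exists u : 'M[R[i]]_(m, n), (forall i, x i = \sum_j u i j *: z j) /\
    forall c : 'cV[R[i]]_n, l2sq (u *m c) <= l2sq c.
Proof.
move=> H; pose E := col_semiinner R n.
pose val f : E := (\col_j f (z j) : 'cV[R[i]]_n).
pose G : set E := [set val f | f in functional].
have lin2 a f g : functional f -> functional g -> functional (fun v => a * f v + g v).
  by move=> fl gl b v w; rewrite fl gl !mulrDr addrACA mulrCA.
have Gs : subspace_set G.
  split.
    exists (fun=> 0); first by move=> a v w; rewrite mulr0 addr0.
    by apply/matrixP => i j; rewrite !mxE.
  move=> a _ _ [f fl <-] [g gl <-]; exists (fun v => a * f v + g v); first exact: lin2.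
  by apply/matrixP => i j; rewrite !mxE.
have [k [e [on Ge eG]]] := orthonormal_basis Gs.
have /choice[g hg] a : exists g, functional g /\ val g = e a by have [g] := Ge a; exists g.
have gl a : functional (g a) by have [] := hg a.
have ge a j : g a (z j) = (e a : 'cV_n) j 0 by have [_ <-] := hg a; rewrite mxE.
pose u : 'M[R[i]]_(m, n) := \matrix_(i, j) \sum_a g a (x i) * Num.conj ((e a : 'cV_n) j 0).
have uc (c : 'cV[R[i]]_n) i : (u *m c) i 0 = \sum_a @si_form R E c (e a) * g a (x i).
  rewrite mxE; under eq_bigr => j _ do rewrite mxE mulr_suml.
  rewrite exchange_big /=; apply: eq_bigr => a _; rewrite /col_dot mulr_suml.
  by apply: eq_bigr => j _; rewrite mulrC mulrA mulrAC -mulrA.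
exists u; split=> [i|c].
  apply/eqP; rewrite -subr_eq0; apply: contraT => /exists_functional[f [fl]].
  rewrite functionalD // -scaleN1r functionalZ // mulN1r functional_sum //.
  suff -> : f (x i) = \sum_j f (u i j *: z j) by rewrite subrr => /esym/eqP; rewrite oner_eq0.
  have -> : \sum_j f (u i j *: z j) = (u *m (val f : 'cV_n)) i 0.
    by rewrite [RHS]mxE; apply: eq_bigr => j _; rewrite functionalZ // [val f _ _]mxE.
  (* [h] comes from expanding the value vector of [f] in the basis, so [f - h] vanishes at all
     [z j]; the domination then makes it vanish at all [x i]. *)
  rewrite uc; pose h v := \sum_a @si_form R E (val f) (e a) * g a v; rewrite -[RHS]/(h (x i)).
  have hl : functional h by exact: functional_lincomb.
  have dl := lin2 (-1) _ _ hl fl.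
  have := H _ dl; rewrite [leRHS]big1 => [|j _]; last first.
    have -> : f (z j) = h (z j).
      have := eG (val f) (ex_intro2 _ _ f fl erefl) => /(congr1 (fun v : 'cV_n => v j 0)).
      rewrite mxE => ->; rewrite summxE; apply: eq_bigr => a _.
      by rewrite mxE ge.
    by rewrite mulN1r addNr rnorm0 expr0n.
  move=> le0; have := le0; rewrite (bigD1 i) //= => h0.
  have {h0} : rnorm (-1 * h (x i) + f (x i)) ^+ 2 <= 0.
    by apply: le_trans h0; rewrite lerDl sumr_ge0 // => j _; rewrite sqr_ge0.
  move=> h0; have : rnorm (-1 * h (x i) + f (x i)) = 0.
    by apply/eqP; rewrite -sqrf_eq0 eq_le h0 sqr_ge0.
  by move=> /rnorm0_eq0 /eqP; rewrite mulN1r addrC subr_eq0 => /eqP.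
(* For arbitrary [c] the entries of [u c] are the values of this [h] at [x]. The domination replaces
   them by its values at [z], which are the orthogonal projection of [c], and Bessel's inequality
   concludes. *)
pose h v := \sum_a @si_form R E c (e a) * g a v.
have hl : functional h by exact: functional_lincomb.
have -> : l2sq (u *m c) = \sum_i rnorm (h (x i)) ^+ 2.
  by apply: eq_bigr => i _; rewrite uc.
rewrite (le_trans (H _ hl)) // (le_trans _ (bessel on c)) // -(orthonormal_l2sq on).
apply: ler_sum => j _; rewrite summxE /h le_eqVlt; apply/orP; left; apply/eqP; congr (rnorm _ ^+ 2).
by apply: eq_bigr => a _; rewrite mxE ge.
Qed.

End Douglas.

(** * The positive form *)

Section PositiveForm.
Variable R : realType.
Variables (X : lmodType R[i]) (p : bool -> X -> X) (e : X).
Variables (S : zmodType) (act : S -> X -> X).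
(* The matrices in [adm] have to act contractively for the form to be found,
   and the form has to recover [nu] on the orbit of [e]. *)
Variables (adm : forall r, 'M[S]_r -> Prop) (nu : forall n, 'M[X]_n -> R).
Hypothesis p_linear : forall b a x y, p b (a *: x + y) = a *: p b x + p b y.
Hypothesis p_proj : forall b b' x, p b (p b' x) = if b == b' then p b x else 0.
Hypothesis act_linear : forall s a x y, act s (a *: x + y) = a *: act s x + act s y.
Hypothesis act0 : forall x, act 0 x = 0.
Hypothesis adm0 : forall r, adm (0 : 'M[S]_r).
Hypothesis adm_block : forall r r' (s : 'M[S]_r) (s' : 'M[S]_r'), adm s -> adm s' -> adm (block_mx s 0 0 s').
Hypothesis cyclic_e : forall x, exists (s : S) (d : R[i]) (l : bool -> R[i]),
  adm (const_mx s : 'M_1) /\ x = d *: act s e + (l true *: p true e + l false *: p false e).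
Hypothesis nuD : forall n (x y : 'M[X]_n), nu (x + y) <= nu x + nu y.
Hypothesis nu_scale : forall n t (x : 'M[X]_n), 0 <= t -> nu (map_mx ( *:%R t%:C%C) x) <= t * nu x.
(** Two independent contractions, one for each summand of the grading: the Douglas factorization is
    carried out separately on the two projected families. *)
Hypothesis nu_contraction : forall n (u : bool -> 'M[R[i]]_n) (x : 'M[X]_n),
  (forall b (c : 'cV_n), l2sq (u b *m c) <= l2sq c) ->
  nu (\matrix_(i, j) (\sum_k u true i k *: p true (x k j) + \sum_k u false i k *: p false (x k j))) <= nu x.
Hypothesis nu_act : forall n (s : 'M[S]_n) (x : 'M[X]_n), adm s -> nu (mulmx_by act s x) <= nu x / 2.
Definition e_mx n : 'M[X]_n := \matrix_(i, j) (if i == j then e else 0).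
Hypothesis nu_e : forall r n, nu (block_mx (0 : 'M[X]_r) 0 0 (e_mx n)) <= 2.
Hypothesis nu_pad : forall r n (x : 'M[X]_(r, n)) (y : 'M[X]_n), nu y <= nu (block_mx 0 x 0 y).
Hypothesis p_sum : forall x, p true x + p false x = x.

(** Sequences instead of columns of length n, so that the forms found for matrices of different
    sizes live on one space and can be added. *)
Local Notation V := (nat -> X).

Lemma act_linear0 s : act s 0 = 0.
Proof.
have := act_linear s 1 0 0; rewrite !scale1r addr0 => h.
by apply: (@addrI _ (act s 0)); rewrite -h addr0.
Qed.

Definition seq_act (s : S) (x : V) : V := fun k => act s (x k).
Definition seq_proj b (x : V) : V := fun k => p b (x k).
Definition seq_single j (x : X) : V := fun k => if k == j then x else 0.
Definition seq_mxact r r' (s : 'M[S]_(r, r')) (x : 'I_r' -> V) (i : 'I_r) : V :=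
  \sum_k seq_act (s i k) (x k).
Definition seq_trunc n (x : V) : V := fun k => if (k < n)%N then x k else 0.

Lemma seq_sumE (I : finType) (F : I -> V) k : (\sum_i F i) k = \sum_i F i k.
Proof. by elim/big_rec2: _ => // i a b _ <-. Qed.

(** On such an [f] the projections act as the identity or as 0. Testing forms on graded functionals
    only makes the projections contractive for the resulting form, and this is what later turns them
    into orthogonal projections. *)
Definition graded (f : V -> R[i]) : Prop :=
  functional f /\ exists b, forall x, f (seq_proj b x) = f x.

Lemma graded_proj f b x : graded f -> f (seq_proj b x) = f x \/ f (seq_proj b x) = 0.
Proof.
move=> [fl [b' fb]]; have [->|nb] := eqVneq b b'; first by left.
right; rewrite -fb (_ : seq_proj b' _ = 0) ?functional0 //.
by apply/funext => k; rewrite /seq_proj p_proj eq_sym (negbTE nb).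
Qed.

Section Level.
Variables (n : nat) (a0 : 'M[S]_n).
Local Notation W := ((V -> R[i]) -> R^o).

(** A vector is recorded by the squares of its values under all functionals. A positive form h then
    corresponds to a real linear functional q with q ([sqf] x) = h x x. *)
Definition sqf (x : V) : W := fun f => rnorm (f x) ^+ 2.
Definition unit_form : W := fun f => \sum_(j < n) rnorm (f (seq_single j e)) ^+ 2.
Definition cyclic_row (i : 'I_n) : V := seq_mxact a0 (fun j : 'I_n => seq_single j e) i.
Definition target_form : W := fun f => \sum_i rnorm (f (cyclic_row i)) ^+ 2.

(* [dominated v t]: the form [v] is at most [t] times the unit form, modulo the
   forms that an [adm]-contractive positive form has to annihilate or make
   nonpositive. *)
Definition dominated (v : W) (t : R) : Prop :=
  0 <= t /\ exists r (s : 'M[S]_r) (x : 'I_r -> V), adm s /\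
    forall f, graded f -> v f + \sum_i rnorm (f (x i)) ^+ 2
      <= t * unit_form f + \sum_i rnorm (f (seq_mxact s x i)) ^+ 2.

Lemma unit_form_ge0 f : 0 <= unit_form f.
Proof. by apply: sumr_ge0 => i _; rewrite sqr_ge0. Qed.

Lemma dominated_le v t : 0 <= t -> (forall f, graded f -> v f <= t * unit_form f) -> dominated v t.
Proof.
move=> t0 h; split=> //; exists 0%N, 0, (fun=> 0); split; first exact: adm0.
by move=> f /h; rewrite !big_ord0 !addr0.
Qed.

Lemma dominated_mono v w t : (forall f, graded f -> w f <= v f) -> dominated v t -> dominated w t.
Proof.
move=> h [t0 [r [s [x [as_ hx]]]]]; split=> //; exists r, s, x; split=> // f fg.
by apply: le_trans (hx f fg); rewrite lerD2r h.
Qed.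

Lemma seq_actZ s a x : seq_act s (a *: x) = a *: seq_act s x.
Proof.
apply/funext => k; rewrite /seq_act -[(a *: x) k]/(a *: x k) -[_ *: x k]addr0 act_linear.
by rewrite act_linear0 addr0.
Qed.

Lemma seq_act0l x : seq_act 0 x = 0.
Proof. by apply/funext => k; exact: act0. Qed.

Lemma dominatedD v w t t' : dominated v t -> dominated w t' -> dominated (v + w) (t + t').
Proof.
move=> [t0 [r [s [x [as_ hx]]]]] [t0' [r' [s' [x' [as_' hx']]]]]; split; first exact: addr_ge0.
pose y (i : 'I_(r + r')) := match fintype.split i with inl j => x j | inr j => x' j end.
have yl i : y (lshift r' i) = x i by rewrite /y (unsplitK (inl i)).
have yr i : y (rshift r i) = x' i by rewrite /y (unsplitK (inr i)).
exists (r + r')%N, (block_mx s 0 0 s'), y; split; first exact: adm_block.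
move=> f fg; rewrite !big_split_ord /=.
have -> : \sum_i rnorm (f (y (lshift r' i))) ^+ 2 = \sum_i rnorm (f (x i)) ^+ 2.
  by apply: eq_bigr => i _; rewrite yl.
have -> : \sum_i rnorm (f (y (rshift r i))) ^+ 2 = \sum_i rnorm (f (x' i)) ^+ 2.
  by apply: eq_bigr => i _; rewrite yr.
have -> : \sum_i rnorm (f (seq_mxact (block_mx s 0 0 s') y (lshift r' i))) ^+ 2 =
    \sum_i rnorm (f (seq_mxact s x i)) ^+ 2.
  apply: eq_bigr => i _; congr (rnorm (f _) ^+ 2); rewrite /seq_mxact big_split_ord /=.
  rewrite [X in _ + X]big1 ?addr0 => [|k _]; last by rewrite block_mxEur mxE seq_act0l.
  by apply: eq_bigr => k _; rewrite block_mxEul yl.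
have -> : \sum_i rnorm (f (seq_mxact (block_mx s 0 0 s') y (rshift r i))) ^+ 2 =
    \sum_i rnorm (f (seq_mxact s' x' i)) ^+ 2.
  apply: eq_bigr => i _; congr (rnorm (f _) ^+ 2); rewrite /seq_mxact big_split_ord /=.
  rewrite [X in X + _]big1 ?add0r => [|k _]; last by rewrite block_mxEdl mxE seq_act0l.
  by apply: eq_bigr => k _; rewrite block_mxEdr yr.
move: (hx f fg) (hx' f fg); rewrite -[(v + w) f]/(v f + w f) mulrDl.
move: (v f) (w f) (t * _) (t' * _) => A B C D; move: (\sum_i _) (\sum_i _) (\sum_i _) (\sum_i _).
by move=> *; lra.
Qed.

Lemma dominatedZ c v t : 0 < c -> dominated v t -> dominated (c *: v) (c * t).
Proof.
move=> c0 [t0 [r [s [x [as_ hx]]]]]; split; first by rewrite mulr_ge0 ?(ltW c0).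
pose d : R[i] := (Num.sqrt c)%:C%C.
have dsq z : rnorm (d * z) ^+ 2 = c * rnorm z ^+ 2.
  by rewrite rnormM rnorm_real ger0_norm ?sqrtr_ge0 // exprMn sqr_sqrtr ?ltW.
exists r, s, (fun i => d *: x i); split=> // f fg; have [fl _] := fg.
have -> : \sum_i rnorm (f (d *: x i)) ^+ 2 = c * \sum_i rnorm (f (x i)) ^+ 2.
  by rewrite mulr_sumr; apply: eq_bigr => i _; rewrite functionalZ // dsq.
have -> : \sum_i rnorm (f (seq_mxact s (fun i => d *: x i) i)) ^+ 2 =
    c * \sum_i rnorm (f (seq_mxact s x i)) ^+ 2.
  rewrite mulr_sumr; apply: eq_bigr => i _; rewrite -dsq -functionalZ //.
  congr (rnorm (f _) ^+ 2); rewrite /seq_mxact scaler_sumr; apply: eq_bigr => k _.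
  exact: seq_actZ.
rewrite -[(c *: v) f]/(c * v f) -mulrA -!mulrDr ler_pM2l //; exact: hx.
Qed.

(** Bound 0 is the point: a functional below the gauge is nonpositive on this difference, which says
    that [s] is contractive for the form. *)
Lemma dominated_act r (s : 'M[S]_r) (x : 'I_r -> V) : adm s ->
  dominated (fun f => \sum_i rnorm (f (seq_mxact s x i)) ^+ 2 - \sum_i rnorm (f (x i)) ^+ 2) 0.
Proof.
move=> as_; split=> //; exists r, s, x; split=> // f _.
by rewrite subrK mul0r add0r.
Qed.

(* The two sides of the domination are Gram-type sums over all functionals, so
   by [douglas_factorization] the rows of [x] and [a0 e] are contractive
   combinations of those of [s x] and [sqrt t e]; [nu_act] then bounds them. *)
Lemma dominated_target t : dominated target_form t ->
  nu (\matrix_(i, j) act (a0 i j) e) <= 4 * Num.sqrt t.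
Proof.
move=> [t0 [r [s [x [as_ hx]]]]].
pose st : R[i] := (Num.sqrt t)%:C%C.
pose lhs (i : 'I_(r + n)) := match fintype.split i with inl j => x j | inr j => cyclic_row j end.
pose rhs (i : 'I_(r + n)) := match fintype.split i with
  inl j => seq_mxact s x j | inr j => st *: seq_single j e end.
have lhsl i : lhs (lshift n i) = x i by rewrite /lhs (unsplitK (inl i)).
have lhsr i : lhs (rshift r i) = cyclic_row i by rewrite /lhs (unsplitK (inr i)).
have rhsl i : rhs (lshift n i) = seq_mxact s x i by rewrite /rhs (unsplitK (inl i)).
have rhsr i : rhs (rshift r i) = st *: seq_single i e by rewrite /rhs (unsplitK (inr i)).
have stsq z : rnorm (st * z) ^+ 2 = t * rnorm z ^+ 2.
  by rewrite rnormM rnorm_real ger0_norm ?sqrtr_ge0 // exprMn sqr_sqrtr.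
have proj_lin b a u v : seq_proj b (a *: u + v) = a *: seq_proj b u + seq_proj b v.
  by apply/funext => k; exact: p_linear.
have /choice[u hu] b : exists u : 'M[R[i]]_(r + n),
    (forall i, seq_proj b (lhs i) = \sum_j u i j *: seq_proj b (rhs j)) /\
    forall c : 'cV[R[i]]_(r + n), l2sq (u *m c) <= l2sq c.
  apply: (@douglas_factorization _ V) => f fl.
  (* Composition with [seq_proj b] makes an arbitrary functional graded, so the domination applies
     to it. *)
  pose g v := f (seq_proj b v).
  have gg : graded g.
    split=> [a v w|]; first by rewrite /g proj_lin fl.
    by exists b => v; rewrite /g; congr f; apply/funext => k; rewrite /seq_proj p_proj eqxx.
  have gl : functional g by have [] := gg.
  rewrite -[leLHS]/(\sum_i rnorm (g (lhs i)) ^+ 2) -[leRHS]/(\sum_i rnorm (g (rhs i)) ^+ 2).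
  rewrite !big_split_ord /=.
  have := hx g gg; rewrite /target_form /unit_form.
  have -> : \sum_i rnorm (g (lhs (lshift n i))) ^+ 2 = \sum_i rnorm (g (x i)) ^+ 2.
    by apply: eq_bigr => i _; rewrite lhsl.
  have -> : \sum_i rnorm (g (lhs (rshift r i))) ^+ 2 = \sum_i rnorm (g (cyclic_row i)) ^+ 2.
    by apply: eq_bigr => i _; rewrite lhsr.
  have -> : \sum_i rnorm (g (rhs (lshift n i))) ^+ 2 = \sum_i rnorm (g (seq_mxact s x i)) ^+ 2.
    by apply: eq_bigr => i _; rewrite rhsl.
  have -> : \sum_i rnorm (g (rhs (rshift r i))) ^+ 2 = t * \sum_(j < n) rnorm (g (seq_single j e)) ^+ 2.
    by rewrite mulr_sumr; apply: eq_bigr => i _; rewrite rhsr functionalZ // stsq.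
  by rewrite addrC [leRHS]addrC.
pose mxof m (z : 'I_m -> V) : 'M[X]_(m, n) := \matrix_(i, j) z i j.
pose Y : 'M[X]_n := \matrix_(i, j) act (a0 i j) e.
have YE : Y = mxof n cyclic_row.
  apply/matrixP => i j; rewrite !mxE /cyclic_row /seq_mxact seq_sumE (bigD1 j) //= big1 ?addr0.
    by rewrite /seq_act /seq_single eqxx.
  move=> k kj; rewrite /seq_act /seq_single (_ : (j == k :> nat) = false) ?act_linear0 //.
  by apply/negbTE; rewrite eq_sym.
(* [nu] is defined on square matrices, so the r + n rows of length n are padded by r zero columns;
   [nu_pad] recovers [Y] from the result. *)
pose big : 'M[X]_(r + n) := block_mx 0 (mxof r x) 0 Y.
pose rhs_mx : 'M[X]_(r + n) := block_mx 0 (mxof r (seq_mxact s x)) 0 (mxof n (fun i => st *: seq_single i e)).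
have bigE i j : big i j = match fintype.split j with inl _ => 0 | inr k => lhs i k end.
  case: (split_ordP i) => i' ->; case: (split_ordP j) => j' ->; rewrite ?(unsplitK (inl _)) ?(unsplitK (inr _)).
  - by rewrite block_mxEul mxE.
  - by rewrite block_mxEur mxE lhsl.
  - by rewrite block_mxEdl mxE.
  - by rewrite block_mxEdr YE mxE lhsr.
have rhsE i j : rhs_mx i j = match fintype.split j with inl _ => 0 | inr k => rhs i k end.
  case: (split_ordP i) => i' ->; case: (split_ordP j) => j' ->; rewrite ?(unsplitK (inl _)) ?(unsplitK (inr _)).
  - by rewrite block_mxEul mxE.
  - by rewrite block_mxEur mxE rhsl.
  - by rewrite block_mxEdl mxE.
  - by rewrite block_mxEdr mxE rhsr.
have p0 b : p b 0 = 0.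
  have := p_linear b 1 0 0; rewrite !scale1r addr0 => h.
  by apply: (@addrI _ (p b 0)); rewrite -h addr0.
have big_le : nu big <= nu rhs_mx.
  have -> : big = \matrix_(i, j) (\sum_k u true i k *: p true (rhs_mx k j) +
      \sum_k u false i k *: p false (rhs_mx k j)).
    apply/matrixP => i j; rewrite bigE mxE.
    under eq_bigr => k _ do rewrite rhsE.
    under [X in _ = _ + X]eq_bigr => k _ do rewrite rhsE.
    case: (fintype.split j) => [j'|j'].
      by rewrite !big1 ?addr0 // => k _; rewrite p0 scaler0.
    rewrite -[lhs i j']p_sum; congr (_ + _).
      have [/(_ i) /(congr1 (fun z : V => z j')) + _] := hu true.
      by rewrite seq_sumE.
    have [/(_ i) /(congr1 (fun z : V => z j')) + _] := hu false.
    by rewrite seq_sumE.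
  by apply: nu_contraction => b; have [] := hu b.
pose s' : 'M[S]_(r + n) := block_mx s 0 0 0.
have as' : adm s' by apply: adm_block => //; exact: adm0.
have bigl i j : big i (lshift n j) = 0 by rewrite bigE (unsplitK (inl j)).
have bigur i j : big (lshift n i) (rshift r j) = x i j by rewrite bigE (unsplitK (inr j)) lhsl.
have s'ul i k : s' (lshift n i) (lshift n k) = s i k by rewrite block_mxEul.
have s'ur i k : s' (lshift n i) (rshift r k) = 0 by rewrite block_mxEur mxE.
have s'd i k : s' (rshift r i) k = 0.
  by case: (split_ordP k) => k' ->; rewrite ?block_mxEdl ?block_mxEdr mxE.
(* The first r rows are [s] applied to the rows of [x], the last n rows are sqrt t times those of
   the diagonal matrix of [e]; padding [s] by zeros joins both into one identity. *)
have rhs_split : rhs_mx = mulmx_by act s' big + map_mx ( *:%R st) (block_mx (0 : 'M[X]_r) 0 0 (e_mx n)).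
  apply/matrixP => i j; rewrite [RHS]mxE [X in _ = X + _]mxE [X in _ = _ + X]mxE big_split_ord /= rhsE.
  case: (split_ordP j) => j' ->; rewrite ?(unsplitK (inl _)) ?(unsplitK (inr _)).
    have -> : block_mx (0 : 'M[X]_r) 0 0 (e_mx n) i (lshift n j') = 0.
      by case: (split_ordP i) => i' ->; rewrite ?block_mxEul ?block_mxEdl mxE.
    by rewrite scaler0 addr0 !big1 ?addr0 // => k _; rewrite bigl act_linear0.
  case: (split_ordP i) => i' ->.
    rewrite rhsl block_mxEur mxE scaler0 addr0 [X in _ + X]big1 ?addr0 => [|k _]; last by rewrite s'ur act0.
    by rewrite /seq_mxact seq_sumE; apply: eq_bigr => k _; rewrite s'ul bigur.
  rewrite rhsr block_mxEdr mxE !big1 ?add0r => [|k _|k _]; try by rewrite s'd act0.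
  by rewrite -[(_ *: _) _]/(st *: _) /seq_single eq_sym.
(* Now nu big <= nu big / 2 + 2 sqrt t: the halving absorbs the term with [s'] and leaves nu big <=
   4 sqrt t. *)
have := le_trans big_le (eq_ind _ (fun z => nu rhs_mx <= nu z) (lexx _) _ rhs_split).
move=> /le_trans/(_ (nuD _ _)).
have h1 := nu_act big as'.
have h2 : nu (map_mx ( *:%R st) (block_mx (0 : 'M[X]_r) 0 0 (e_mx n))) <= Num.sqrt t * 2.
  rewrite (le_trans (nu_scale _ (sqrtr_ge0 t))) // ler_wpM2l ?sqrtr_ge0 //; exact: nu_e.
have := nu_pad (mxof r x) Y; rewrite -/big -/Y; move: h1 h2.
move: (nu big) (nu (mulmx_by _ _ _)) (nu (map_mx _ _)) (nu Y) (Num.sqrt t) => A B C D F.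
by lra.
Qed.

(** Both signs are asked for, so that these forms make up a real subspace. *)
Definition bounded_form : set W :=
  [set v | (exists t, dominated v t) /\ (exists t, dominated (- v) t)].

Lemma bounded_formZ a v : bounded_form v -> exists t, dominated (a *: v) t.
Proof.
move=> [[t ht] [t' ht']]; have [a0'|a0'|->] := ltgtP a 0.
- exists (- a * t'); have -> : a *: v = (- a) *: (- v) by rewrite scaleNr scalerN opprK.
  by apply: dominatedZ => //; rewrite oppr_gt0.
- by exists (a * t); exact: dominatedZ.
by exists 0; rewrite scale0r; apply: dominated_le => // f _; rewrite mul0r.
Qed.

Lemma bounded_form_subspace : subspace_set bounded_form.
Proof.
split.
  by split; exists 0; rewrite ?oppr0; apply: dominated_le => // f _; rewrite mul0r.
move=> a v w vb wb; have [[t' ht'] [t2' ht2']] := wb.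
have [t ht] := bounded_formZ a vb; have [t2 ht2] := bounded_formZ (- a) vb.
split; first by exists (t + t'); exact: dominatedD.
by exists (t2 + t2'); rewrite opprD -scaleNr; exact: dominatedD.
Qed.

(** Nonnegative, as [dominated] includes 0 <= t. Outside [bounded_form] the infimum may be over the
    empty set. *)
Definition form_gauge (v : W) : R := inf [set t | dominated v t].

Lemma form_gauge_le v t : dominated v t -> form_gauge v <= t.
Proof. by move=> vt; apply: inf_lbound => //; exists 0 => s []. Qed.

Lemma form_gauge_ge v c : bounded_form v -> (forall t, dominated v t -> c <= t) -> c <= form_gauge v.
Proof. by move=> [[t vt] _] h; apply: lb_le_inf; [exists t | exact: h]. Qed.

Lemma form_gauge_sublinear (r : W -> W) :
  linear r -> (forall v, bounded_form (r v)) -> sublinear (fun v => form_gauge (r v)).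
Proof.
move=> rl rb; have rZ t v : r (t *: v) = t *: r v.
  have r0 : r 0 = 0 by apply: (@addrI _ (r 0)); rewrite -{1}[r 0]scale1r -rl scale1r !addr0.
  by rewrite -[t *: v]addr0 rl r0 addr0.
have rD v w : r (v + w) = r v + r w by rewrite -[v in LHS]scale1r rl scale1r.
split=> [v w|].
  rewrite -lerBlDl; apply: form_gauge_ge => // t wt; rewrite lerBlDl -lerBlDr.
  apply: form_gauge_ge => // t' vt; rewrite lerBlDr rD.
  by apply: form_gauge_le; exact: dominatedD.
apply: sublinear_homog_le => t v t0; rewrite -ler_pdivrMl //.
apply: form_gauge_ge => // t' vt; rewrite ler_pdivrMl // rZ.
by apply: form_gauge_le; exact: dominatedZ.
Qed.

Definition finite_form (x : V) : Prop := exists t, dominated (sqf x) t.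

(** By cyclicity [x] is a combination of [act s e] and the two projections of [e]. The form of the
    first is finite because [s] is contractive up to domination, the others are bounded by the form
    of [e] on graded functionals; the index has to be below [n] for [unit_form] to contain that
    term. *)
Lemma finite_form_single j x : (j < n)%N -> finite_form (seq_single j x).
Proof.
move=> jn; have sle f : rnorm (f (seq_single j e)) ^+ 2 <= unit_form f.
  rewrite /unit_form (bigD1 (Ordinal jn)) //= lerDl sumr_ge0 // => i _.
  by rewrite sqr_ge0.
have finD y z : finite_form y -> finite_form z -> finite_form (y + z).
  move=> [t ht] [t' ht']; exists (2 * t + 2 * t').
  have two : 0 < 2 :> R by [].
  apply: dominated_mono (dominatedD (dominatedZ two ht) (dominatedZ two ht')).
  move=> f [fl _]; rewrite -[leRHS]/(2 * rnorm (f y) ^+ 2 + 2 * rnorm (f z) ^+ 2) /sqf functionalD //.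
  apply: le_trans (sqrD_le _ _); rewrite ler_sqr ?nnegrE ?addr_ge0 ?rnorm_ge0 //; exact: rnormD.
have finZ a y : finite_form y -> finite_form (a *: y).
  move=> [t ht]; have [->|a0'] := eqVneq a 0.
    exists 0; apply: dominated_le => // f [fl _].
    by rewrite /sqf scale0r functional0 // rnorm0 expr0n mul0r.
  have na : 0 < rnorm a ^+ 2.
    by rewrite exprn_gt0 // lt0r rnorm_ge0 andbT; apply: contraNneq a0' => /rnorm0_eq0 ->.
  exists (rnorm a ^+ 2 * t); apply: dominated_mono (dominatedZ na ht) => f [fl _].
  by rewrite /sqf functionalZ // rnormM exprMn.
have finp b : finite_form (seq_proj b (seq_single j e)).
  exists 1; apply: dominated_le => // f fg; rewrite mul1r /sqf.
  by have [->|->] := graded_proj b (seq_single j e) fg; rewrite ?sle // rnorm0 expr0n unit_form_ge0.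
have fina s : adm (const_mx s : 'M_1) -> finite_form (seq_act s (seq_single j e)).
  move=> as_; exists (0 + 1).
  have u1 : dominated unit_form 1 by apply: dominated_le => // f _; rewrite mul1r.
  apply: dominated_mono (dominatedD (dominated_act (fun=> seq_single j e) as_) u1).
  move=> f fg; rewrite -[leRHS]/(_ - _ + unit_form f) !big_ord1 /seq_mxact big_ord1 mxE.
  by rewrite -addrA lerDl addrC subr_ge0 sle.
have [s [d [l [as_ ->]]]] := cyclic_e x.
have -> : seq_single j (d *: act s e + (l true *: p true e + l false *: p false e)) =
   d *: seq_act s (seq_single j e) + (l true *: seq_proj true (seq_single j e)
     + l false *: seq_proj false (seq_single j e)).
  apply/funext => k; rewrite -[RHS]/(d *: act s _ + (_ *: p true _ + _ *: p false _)) /seq_single.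
  case: eqP => // _; rewrite act_linear0.
  have p0 b : p b 0 = 0.
    have := p_linear b 1 0 0; rewrite !scale1r addr0 => h.
    by apply: (@addrI _ (p b 0)); rewrite -h addr0.
  by rewrite !p0 !scaler0 !addr0.
by apply: (finD); [apply: (finZ); exact: fina | apply: (finD); apply: (finZ); exact: finp].
Qed.

Lemma finite_form_trunc x : finite_form (seq_trunc n x).
Proof.
have -> : seq_trunc n x = \sum_(j < n) seq_single j (x j).
  apply/funext => k; rewrite seq_sumE /seq_trunc; case: ifPn => [kn|].
    rewrite (bigD1 (Ordinal kn)) //= /seq_single eqxx big1 ?addr0 // => i ik.
    by rewrite ifN // eq_sym; apply: contraNneq ik => h; apply/eqP/val_inj.
  rewrite -leqNgt => nk; rewrite big1 // => i _; rewrite /seq_single ifN //.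
  by rewrite neq_ltn orbC (leq_trans (ltn_ord i) nk).
have two : 0 < 2 :> R by [].
elim/big_ind: _ => [|y z [t ht] [t' ht']|j _]; last exact: finite_form_single.
  by exists 0; apply: dominated_le => // f [fl _]; rewrite /sqf functional0 // rnorm0 expr0n mul0r.
exists (2 * t + 2 * t').
apply: dominated_mono (dominatedD (dominatedZ two ht) (dominatedZ two ht')).
move=> f [fl _]; rewrite -[leRHS]/(2 * rnorm (f y) ^+ 2 + 2 * rnorm (f z) ^+ 2) /sqf functionalD //.
apply: le_trans (sqrD_le _ _); rewrite ler_sqr ?nnegrE ?addr_ge0 ?rnorm_ge0 //; exact: rnormD.
Qed.

Lemma bounded_form_cross x y (v : W) : finite_form x -> finite_form y ->
  (forall f, `|v f| <= rnorm (f x) * rnorm (f y)) -> bounded_form v.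
Proof.
move=> [t ht] [t' ht'] h.
have le (a b : R) : a * b <= a ^+ 2 + b ^+ 2.
  by have := sqr_ge0 (a - b); have := sqr_ge0 (a + b); rewrite sqrrB sqrrD -mulr_natl; lra.
split; exists (t + t'); apply: dominated_mono (dominatedD ht ht') => f _;
  rewrite -[leRHS]/(rnorm (f x) ^+ 2 + rnorm (f y) ^+ 2); apply: le_trans (le _ _); apply: le_trans (h f).
  exact: ler_norm.
by rewrite -normrN ler_norm.
Qed.

Lemma cyclic_row_trunc i : seq_trunc n (cyclic_row i) = cyclic_row i.
Proof.
apply/funext => k; rewrite /seq_trunc; case: ifPn => // nk.
rewrite /cyclic_row /seq_mxact seq_sumE big1 // => j _; rewrite /seq_act /seq_single ifN ?act_linear0 //.
by apply: contraNneq nk => ->.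
Qed.

Lemma seq_trunc_mxact r (s : 'M[S]_r) (x : 'I_r -> V) i :
  seq_trunc n (seq_mxact s x i) = seq_mxact s (fun k => seq_trunc n (x k)) i.
Proof.
apply/funext => k; rewrite /seq_trunc /seq_mxact !seq_sumE; case: ifPn => nk; last first.
  by rewrite big1 // => j _; rewrite /seq_act ifN ?act_linear0.
by apply: eq_bigr => j _; rewrite /seq_act nk.
Qed.

(** The form is read off from a real functional [q] below the gauge that attains it at
    [target_form]: lying below the gauge gives positivity and the contractions, attaining it gives
    the lower bound. *)
Theorem exists_positive_form : exists h : V -> V -> R[i],
  [/\ forall a x y z, h (a *: x + y) z = a * h x z + h y z,
      forall x y, h x y = Num.conj (h y x),
      forall x, 0 <= h x x
    & [/\ forall r (s : 'M[S]_r) (x : 'I_r -> V), adm s ->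
            \sum_i complex.Re (h (seq_mxact s x i) (seq_mxact s x i)) <= \sum_i complex.Re (h (x i) (x i)),
          forall b x, complex.Re (h (seq_proj b x) (seq_proj b x)) <= complex.Re (h x x),
          \sum_(j < n) complex.Re (h (seq_single j e) (seq_single j e)) <= 1
        & forall c, 0 <= c -> c <= nu (\matrix_(i, j) act (a0 i j) e) ->
            c ^+ 2 <= 16 * \sum_i complex.Re (h (cyclic_row i) (cyclic_row i))]].
Proof.
(* The gauge makes sense on [bounded_form] only; after composition with the projection [r] it is
   sublinear on all of [W]. *)
have [r [rl rb rid]] := algebraic_projection bounded_form_subspace.
have [q [ql qle qt]] := hahn_banach target_form (form_gauge_sublinear rl rb).
have qD v w : q (v + w) = q v + q w by rewrite -[v in LHS]scale1r ql mul1r.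
have q0 : q 0 = 0 by apply: (@addrI _ (q 0)); rewrite -qD !addr0.
have qZ t v : q (t *: v) = t * q v by rewrite -[t *: v]addr0 ql q0 addr0.
have qN v : q (- v) = - q v by rewrite -scaleN1r qZ mulN1r.
have qdom v t : bounded_form v -> dominated v t -> q v <= t.
  by move=> vb vt; apply: (le_trans (qle v)); rewrite rid // form_gauge_le.
have [b0 bl] := bounded_form_subspace.
have bD v w : bounded_form v -> bounded_form w -> bounded_form (v + w).
  by move=> vb wb; rewrite -[v]scale1r; apply: bl.
have bZ t v : bounded_form v -> bounded_form (t *: v).
  by move=> vb; rewrite -[_ *: _]addr0; apply: bl.
have q_mono v w : bounded_form v -> bounded_form w -> (forall f, graded f -> v f <= w f) -> q v <= q w.
  move=> vb wb h; rewrite -subr_le0 -qN -qD; apply: qdom.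
    by apply: bD => //; rewrite -scaleN1r; exact: bZ.
  by apply: dominated_le => // f fg; rewrite mul0r -[(v - w) f]/(v f - w f) subr_le0 h.
(* On bounded forms [q] depends on the values at graded functionals alone. This matters below, where
   sesquilinearity of [re] and [im] holds at linear [f] only. *)
have q_eq v w : bounded_form v -> bounded_form w -> (forall f, graded f -> v f = w f) -> q v = q w.
  by move=> vb wb h; apply/eqP; rewrite eq_le !q_mono // => f fg; rewrite h.
(* Finiteness is available for entries below [n], so the form is defined through truncated
   sequences. *)
pose T := seq_trunc n.
pose re x y : W := fun f => complex.Re (f (T x) * Num.conj (f (T y))).
pose im x y : W := fun f => complex.Im (f (T x) * Num.conj (f (T y))).
have Re_abs (z : R[i]) : `|complex.Re z| <= rnorm z.
  by rewrite -ler_sqr ?nnegrE ?rnorm_ge0 // rnorm_sqr real_normK ?num_real // lerDl sqr_ge0.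
have Im_abs (z : R[i]) : `|complex.Im z| <= rnorm z.
  by rewrite -ler_sqr ?nnegrE ?rnorm_ge0 // rnorm_sqr real_normK ?num_real // lerDr sqr_ge0.
have reb x y : bounded_form (re x y).
  apply: (bounded_form_cross (finite_form_trunc x) (finite_form_trunc y)) => f.
  by rewrite (le_trans (Re_abs _)) // rnormM rnormJ.
have imb x y : bounded_form (im x y).
  apply: (bounded_form_cross (finite_form_trunc x) (finite_form_trunc y)) => f.
  by rewrite (le_trans (Im_abs _)) // rnormM rnormJ.
(* The complex function f -> f (T x) times the conjugate of f (T y) is split into two real forms, to
   which [q] applies. *)
pose h x y : R[i] := Complex (q (re x y)) (q (im x y)).
have TD a x y : T (a *: x + y) = a *: T x + T y.
  apply/funext => k; rewrite -[RHS]/(a *: T x k + T y k) /T /seq_trunc.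
  by case: ifP => // _; rewrite scaler0 addr0.
have diag x : h x x = (q (sqf (T x)))%:C%C.
  rewrite /h; apply: eqc_ReIm => /=.
    by congr q; apply/funext => f; rewrite /re mul_conj.
  by rewrite -q0; congr q; apply/funext => f; rewrite /im mul_conj.
have sqb x : bounded_form (sqf (T x)).
  by have := reb x x; congr bounded_form; apply/funext => f; rewrite /re mul_conj.
have q_sum (I : finType) (F : I -> W) : q (\sum_i F i) = \sum_i q (F i) by exact: (big_morph q qD q0).
have b_sum (I : finType) (F : I -> W) : (forall i, bounded_form (F i)) -> bounded_form (\sum_i F i).
  by move=> Fb; elim/big_ind: _ => //; exact: bD.
have sumE (I : finType) (F : I -> W) f : (\sum_i F i) f = \sum_i F i f.
  by elim/big_rec2: _ => // i u v _ <-.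
exists h; split.
- move=> a x y z; case: a => a b; apply: eqc_ReIm => /=.
    rewrite -!qZ -qN -!qD; apply: q_eq => //.
      by apply: (bD) => //; apply: (bD); [exact: bZ | rewrite -scaleN1r; apply: (bZ); exact: bZ].
    move=> f [fl _]; rewrite -[RHS]/(a * re x z f - b * im x z f + re y z f) /re /im.
    rewrite TD fl mulrDl ReD; congr (_ + _); rewrite -mulrA.
    by move: (f (T x) * _) => [u v].
  rewrite -!qZ -!qD; apply: q_eq => //.
    by apply: (bD) => //; apply: (bD); exact: bZ.
  move=> f [fl _]; rewrite -[RHS]/(a * im x z f + b * re x z f + im y z f) /re /im.
  rewrite TD fl mulrDl ImD; congr (_ + _); rewrite -mulrA.
  by move: (f (T x) * _) => [u v].
- move=> x y; apply: eqc_ReIm => /=.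
    congr q; apply/funext => f; rewrite /re -ReJ rmorphM /= conjCK mulrC; by [].
  rewrite -qN; congr q; apply/funext => f; rewrite -[RHS]/(- im y x f) /im -ImJ rmorphM /= conjCK mulrC; by [].
- move=> x; rewrite diag ler0c -q0; apply: q_mono => // f _; exact: sqr_ge0.
split.
- move=> m s x as_.
  under eq_bigr => i _ do rewrite diag /=.
  under [leRHS]eq_bigr => i _ do rewrite diag /=.
  rewrite -!q_sum -subr_le0 -qN -qD; apply: qdom.
    by apply: (bD); [exact: b_sum | rewrite -scaleN1r; apply: (bZ); exact: b_sum].
  apply: dominated_mono (dominated_act (fun k => T (x k)) as_) => f _.
  rewrite -[leLHS]/((\sum_i sqf (T (seq_mxact s x i))) f - (\sum_i sqf (T (x i))) f) !sumE.
  rewrite lerB // le_eqVlt; apply/orP; left; apply/eqP; apply: eq_bigr => i _.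
  by rewrite /sqf /T seq_trunc_mxact.
- move=> b x; rewrite !diag /=; apply: q_mono => // f fg.
  have -> : T (seq_proj b x) = seq_proj b (T x).
    apply/funext => k; rewrite /T /seq_trunc /seq_proj; case: ifP => // _.
    have := p_linear b 1 0 0; rewrite !scale1r addr0 => hp.
    by apply: (@addrI _ (p b 0)); rewrite -hp addr0.
  by rewrite /sqf; have [->|->] := graded_proj b (T x) fg; rewrite // rnorm0 expr0n sqr_ge0.
- under eq_bigr => j _ do rewrite diag /=.
  rewrite -q_sum; apply: qdom; first exact: b_sum.
  apply: dominated_le => // f _; rewrite mul1r sumE.
  rewrite le_eqVlt; apply/orP; left; apply/eqP; apply: eq_bigr => j _.
  rewrite /sqf; congr (rnorm (f _) ^+ 2); apply/funext => k; rewrite /T /seq_trunc /seq_single.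
  by case: (k =P j) => [->|]; rewrite ?ltn_ord //; case: ifP.
move=> c c0 cnu.
under eq_bigr => i _ do rewrite diag /=.
rewrite -q_sum.
have -> : \sum_i sqf (T (cyclic_row i)) = target_form.
  by apply/funext => f; rewrite sumE; apply: eq_bigr => i _; rewrite /sqf /T cyclic_row_trunc.
have tb : bounded_form target_form.
  rewrite (_ : target_form = \sum_i sqf (T (cyclic_row i))); first exact: b_sum.
  by apply/funext => f; rewrite sumE; apply: eq_bigr => i _; rewrite /sqf /T cyclic_row_trunc.
(* Every [t] that dominates [target_form] satisfies c <= 4 sqrt t, and the value of [q] is the
   infimum of these [t]; squaring gives the factor 16. *)
rewrite qt rid // -ler_pdivrMl //; apply: form_gauge_ge => // t tt.
have [t0 _] := tt; rewrite ler_pdivrMl //.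
have := le_trans cnu (dominated_target tt); rewrite -ler_sqr ?nnegrE ?mulr_ge0 ?sqrtr_ge0 //.
by rewrite exprMn sqr_sqrtr // (_ : 4 ^+ 2 = 16) //; ring.
Qed.

End Level.
End PositiveForm.

(** * Direct sums of positive forms *)

Section FiniteSupport.
Variables (R : realType) (I : choiceType) (V : lmodType R[i]).

Definition finite_support_pred : {pred (I -> V)} := fun m => `[< finite_set [set i | m i <> 0] >].

Lemma finite_support_closed : submod_closed finite_support_pred.
Proof.
split=> [|a x y /asboolP fx /asboolP fy]; apply/asboolP.
  by rewrite (_ : [set i | _] = set0) // -subset0 => i /=.
have : finite_set ([set i | x i <> 0] `|` [set i | y i <> 0]) by rewrite finite_setU.
apply: sub_finite_set => i /= h.
have [xi|xi] := pselect (x i = 0); last by left.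
right=> yi; apply: h; rewrite -[(a *: x + y) i]/(a *: x i + y i) xi yi scaler0 addr0 //.
Qed.

HB.instance Definition _ := GRing.isSubmodClosed.Build R[i] (I -> V) finite_support_pred finite_support_closed.

Record finsupp := FinSupp { finsupp_val :> I -> V; _ : finsupp_val \in finite_support_pred }.
HB.instance Definition _ := [isSub for finsupp_val].
HB.instance Definition _ := [Choice of finsupp by <:].
HB.instance Definition _ := [SubChoice_isSubLmodule of finsupp by <:].

Implicit Types m : finsupp.

Lemma finsupp_ext m m' : (forall i, m i = m' i) -> m = m'.
Proof. by move=> h; apply/val_inj/funext. Qed.

Lemma finsuppDE m m' i : (m + m') i = m i + m' i. Proof. by []. Qed.
Lemma finsuppZE a m i : (a *: m) i = a *: m i. Proof. by []. Qed.

Lemma finsupp_sumE (J : finType) (F : J -> finsupp) i : (\sum_j F j) i = \sum_j F j i.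
Proof. by elim/big_rec2: _ => // j a b _ <-. Qed.

Lemma finsupp_cover (J : finType) (x : J -> finsupp) :
  exists A : seq I, uniq A /\ forall j i, i \notin A -> x j i = 0.
Proof.
have fin : finite_set (\bigcup_(j in [set: J]) [set i | x j i <> 0]).
  apply: bigcup_finite => // j _; by case: (x j) => m /= /asboolP.
have [A hA] := (finite_seqP _).1 fin; exists (undup A); split=> [|j i]; first exact: undup_uniq.
rewrite mem_undup => iA; apply: contrapT => xi.
have : [set` A] i by rewrite -hA; exists j.
by move=> /= Ai; rewrite Ai in iA.
Qed.

Variable h : I -> V -> V -> R[i].
Hypothesis h_linear : forall i a x y z, h i (a *: x + y) z = a * h i x z + h i y z.
Hypothesis h_conj : forall i x y, h i x y = Num.conj (h i y x).
Hypothesis h_ge0 : forall i x, 0 <= h i x x.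

Definition finsupp_form (m m' : finsupp) : R[i] := \sum_(i \in [set: I]) h i (m i) (m' i).

Lemma h_0l i z : h i 0 z = 0.
Proof. by have := h_linear i 1 0 0 z; rewrite scale1r addr0 mul1r => e; apply: (@addrI _ (h i 0 z)); rewrite -e addr0. Qed.

Lemma finsupp_formE (A : seq I) m m' : uniq A -> (forall i, i \notin A -> m i = 0) ->
  finsupp_form m m' = \sum_(i <- A) h i (m i) (m' i).
Proof.
move=> uA hA; rewrite /finsupp_form -(fsbig_widen [set` A] setT) //; last first.
  by move=> i [_ /= nA] /=; rewrite hA ?h_0l //; apply/negP.
exact/esym/fsbig_seq.
Qed.

Lemma finsupp_form_linear a m m' z : finsupp_form (a *: m + m') z = a * finsupp_form m z + finsupp_form m' z.
Proof.
have [A [uA hA]] := finsupp_cover (fun j : 'I_2 => if j == ord0 then m else m').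
have hm i : i \notin A -> m i = 0 by exact: (hA ord0).
have hm' i : i \notin A -> m' i = 0 by exact: (hA ord_max).
rewrite !(finsupp_formE _ uA) // => [|i iA]; last by rewrite finsuppDE finsuppZE hm // hm' // scaler0 addr0.
by rewrite mulr_sumr -big_split /=; apply: eq_bigr => i _; rewrite -h_linear.
Qed.

Lemma finsupp_form_conj m m' : finsupp_form m m' = Num.conj (finsupp_form m' m).
Proof.
have [A [uA hA]] := finsupp_cover (fun j : 'I_2 => if j == ord0 then m else m').
rewrite (finsupp_formE _ uA (hA ord0)) (finsupp_formE _ uA (hA ord_max)) rmorph_sum.
by apply: eq_bigr => i _ /=; rewrite -h_conj.
Qed.

Lemma finsupp_form_ge0 m : 0 <= finsupp_form m m.
Proof.
have [A [uA hA]] := finsupp_cover (fun j : 'I_1 => m).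
by rewrite (finsupp_formE _ uA (hA ord0)); apply: sumr_ge0 => i _.
Qed.

Definition finsupp_semiinner : semiinner R :=
  SemiInner finsupp_form_linear finsupp_form_conj finsupp_form_ge0.

Lemma finsupp_single_subproof i0 (x : V) : (fun i => if i == i0 then x else 0) \in finite_support_pred.
Proof.
apply/asboolP; apply: sub_finite_set (finite_set1 i0) => i /=.
by case: eqP.
Qed.

Definition finsupp_single i0 x := FinSupp (finsupp_single_subproof i0 x).

Lemma finsupp_form_single i0 x : finsupp_form (finsupp_single i0 x) (finsupp_single i0 x) = h i0 x x.
Proof.
rewrite (@finsupp_formE [:: i0]) ?big_seq1 /= ?eqxx // => i; rewrite inE => /negbTE -> //.
Qed.

End FiniteSupport.

Section SemiInnerModule.
Variable R : realType.
Variables (X : lmodType R[i]) (p : bool -> X -> X) (e : X).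
Variables (S : zmodType) (act : S -> X -> X).
Variables (adm : forall r, 'M[S]_r -> Prop) (nu : forall n, 'M[X]_n -> R).
Hypothesis p_linear : forall b a x y, p b (a *: x + y) = a *: p b x + p b y.
Hypothesis p_proj : forall b b' x, p b (p b' x) = if b == b' then p b x else 0.
Hypothesis act_linear : forall s a x y, act s (a *: x + y) = a *: act s x + act s y.
Hypothesis act0 : forall x, act 0 x = 0.
Hypothesis adm0 : forall r, adm (0 : 'M[S]_r).
Hypothesis adm_block : forall r r' (s : 'M[S]_r) (s' : 'M[S]_r'), adm s -> adm s' -> adm (block_mx s 0 0 s').
Hypothesis cyclic_e : forall x, exists (s : S) (d : R[i]) (l : bool -> R[i]),
  adm (const_mx s : 'M_1) /\ x = d *: act s e + (l true *: p true e + l false *: p false e).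
Hypothesis nuD : forall n (x y : 'M[X]_n), nu (x + y) <= nu x + nu y.
Hypothesis nu_scale : forall n t (x : 'M[X]_n), 0 <= t -> nu (map_mx ( *:%R t%:C%C) x) <= t * nu x.
Hypothesis nu_contraction : forall n (u : bool -> 'M[R[i]]_n) (x : 'M[X]_n),
  (forall b (c : 'cV_n), l2sq (u b *m c) <= l2sq c) ->
  nu (\matrix_(i, j) (\sum_k u true i k *: p true (x k j) + \sum_k u false i k *: p false (x k j))) <= nu x.
Hypothesis nu_act : forall n (s : 'M[S]_n) (x : 'M[X]_n), adm s -> nu (mulmx_by act s x) <= nu x / 2.
Hypothesis nu_e : forall r n, nu (block_mx (0 : 'M[X]_r) 0 0 (e_mx e n)) <= 2.
Hypothesis nu_pad : forall r n (x : 'M[X]_(r, n)) (y : 'M[X]_n), nu y <= nu (block_mx 0 x 0 y).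
Hypothesis p_sum : forall x, p true x + p false x = x.

Local Notation I := {n : nat & 'M[S]_n}.
Local Notation V := (nat -> X).

Lemma finsupp_lift_subproof (phi : X -> X) (m : finsupp I V) :
  (fun (i : I) k => phi (m i k) - phi 0) \in @finite_support_pred R I V.
Proof.
apply/asboolP; case: m => m /= /asboolP; apply: sub_finite_set => i /= h mi; apply: h.
by apply/funext => k; rewrite mi subrr.
Qed.

(* Subtracting [phi 0] only serves to keep the support finite for arbitrary [phi]. *)
Definition finsupp_lift (phi : X -> X) (m : finsupp I V) : finsupp I V :=
  FinSupp (finsupp_lift_subproof phi m).

(** The sum runs over all square matrices over [S] of all sizes, and [lift phi] applies [phi] to
    every entry of every component. Contractivity holds in each summand and adds up; the lower bound
    for [s] is witnessed by the column of copies of [e] placed in the component indexed by [s]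
    itself. *)
Theorem exists_semiinner_module : exists (E : semiinner R) (lift : (X -> X) -> E -> E),
  [/\ forall phi, linear phi -> linear (lift phi),
      forall phi psi m, linear phi -> linear psi -> lift phi (lift psi m) = lift (phi \o psi) m,
      forall a phi psi m, linear phi -> linear psi ->
        lift (fun x => a *: phi x + psi x) m = a *: lift phi m + lift psi m,
      forall m, lift id m = m
    & [/\ forall r (s : 'M[S]_r) (x : 'I_r -> E), adm s ->
            \sum_i complex.Re (si_form (\sum_k lift (act (s i k)) (x k)) (\sum_k lift (act (s i k)) (x k)))
              <= \sum_i complex.Re (si_form (x i) (x i)),
          forall b x, complex.Re (si_form (lift (p b) x) (lift (p b) x)) <= complex.Re (si_form x x)
        & forall n (s : 'M[S]_n), exists z : 'I_n -> E,
            \sum_j complex.Re (si_form (z j) (z j)) <= 1 /\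
            forall c, 0 <= c -> c <= nu (\matrix_(i, j) act (s i j) e) ->
              c ^+ 2 <= 16 * \sum_i complex.Re (si_form (\sum_j lift (act (s i j)) (z j)) (\sum_j lift (act (s i j)) (z j)))]].
Proof.
have H n (s : 'M[S]_n) := exists_positive_form p_linear p_proj act_linear act0 adm0 adm_block cyclic_e
  nuD nu_scale nu_contraction nu_act nu_e nu_pad p_sum s.
have /choice[h hP] (i : I) := H (projT1 i) (projT2 i).
have hl i : forall a x y z, h i (a *: x + y) z = a * h i x z + h i y z by have [] := hP i.
have hc i : forall x y, h i x y = Num.conj (h i y x) by have [] := hP i.
have hp i : forall x, 0 <= h i x x by have [] := hP i.
pose E := @finsupp_semiinner R I V h hl hc hp.
have lin0 (phi : X -> X) : linear phi -> phi 0 = 0.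
  by move=> pl; apply: (@addrI _ (phi 0)); rewrite -{1}[phi 0]scale1r -pl scale1r !addr0.
have liftE phi (m : finsupp I V) i k : linear phi -> finsupp_lift phi m i k = phi (m i k).
  by move=> /lin0 p0; rewrite /= p0 subr0.
have qE (J : finType) (x : J -> finsupp I V) : exists A : seq I,
    (forall j i, i \notin A -> x j i = 0) /\
    forall y : finsupp I V, (forall i, i \notin A -> y i = 0) ->
      complex.Re (@si_form R E y y) = \sum_(i <- A) complex.Re (h i (y i) (y i)).
  have [A [uA hA]] := finsupp_cover x; exists A; split=> // y yA.
  transitivity (complex.Re (finsupp_form h y y)); first by [].
  by rewrite -Re_sum (finsupp_formE hl _ uA yA).
have sE r (s : 'M[S]_r) (x : 'I_r -> finsupp I V) i a :
    (\sum_k finsupp_lift (act (s i k)) (x k)) a = seq_mxact act s (fun k => x k a) i.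
  rewrite finsupp_sumE /seq_mxact; apply: eq_bigr => k _; apply/funext => j.
  by rewrite liftE //; move=> *; exact: act_linear.
exists E, finsupp_lift; split.
- move=> phi pl a x y; apply: finsupp_ext => i; apply/funext => k.
  by rewrite liftE // finsuppDE finsuppZE -[RHS]/(a *: finsupp_lift phi x i k + finsupp_lift phi y i k) !liftE // -pl.
- move=> phi psi m pl ql; apply: finsupp_ext => i; apply/funext => k.
  by rewrite !liftE // => a x y /=; rewrite ql pl.
- move=> a phi psi m pl ql; apply: finsupp_ext => i; apply/funext => k.
  rewrite liftE; first by rewrite -[RHS]/(a *: finsupp_lift phi m i k + finsupp_lift psi m i k) !liftE.
  by move=> b x y; rewrite pl ql scalerDr !scalerDr !scalerA mulrC addrACA.
- by move=> m; apply: finsupp_ext => i; apply/funext => k; rewrite liftE.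
split.
- move=> r s x as_; have [A [xA qA]] := qE _ x.
  have zA i a : a \notin A -> (\sum_k finsupp_lift (act (s i k)) (x k)) a = 0.
    move=> aA; rewrite sE /seq_mxact big1 // => k _; rewrite (xA k a aA); apply/funext => j.
    by apply: act_linear0 => *; exact: act_linear.
  rewrite (eq_bigr _ (fun i _ => qA _ (zA i))) [leRHS](eq_bigr _ (fun i _ => qA _ (xA i))).
  rewrite exchange_big [leRHS]exchange_big /=; apply: ler_sum => a _.
  have [_ _ _ [hs _ _ _]] := hP a.
  by under eq_bigr => i _ do rewrite sE; exact: hs.
- move=> b x; have [A [xA qA]] := qE _ (fun _ : 'I_1 => x).
  have pl : linear (p b) by move=> *; exact: p_linear.
  rewrite !qA; [|exact: (xA ord0)|]; last first.
    by move=> i iA; apply/funext => k; rewrite liftE // (xA ord0 i iA); exact: lin0.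
  apply: ler_sum => a _; have [_ _ _ [_ hb _ _]] := hP a.
  have -> : finsupp_lift (p b) x a = seq_proj p b (x a) by apply/funext => k; rewrite liftE.
  exact: hb.
move=> n s; pose i0 : I := existT _ n s; have [_ _ _ [_ _ h1 h2]] := hP i0.
exists (fun j : 'I_n => finsupp_single i0 (seq_single j e)); split.
  under eq_bigr => j _ do rewrite -[si_form _ _]/(finsupp_form h _ _) finsupp_form_single //.
  exact: h1.
move=> c c0 cn; apply: (le_trans (h2 c c0 cn)); rewrite ler_pM2l // le_eqVlt; apply/orP; left; apply/eqP.
apply: eq_bigr => i _; rewrite -[si_form _ _]/(finsupp_form h _ _) -[in LHS](finsupp_form_single hl).
congr (complex.Re (finsupp_form h _ _)); apply: finsupp_ext => a; rewrite sE /= /cyclic_row;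
case: eqP => // _; rewrite /seq_mxact big1 // => k _; apply/funext => j;
by apply: act_linear0 => *; exact: act_linear.
Qed.

End SemiInnerModule.

(** * Doubling *)

Section ContractiveIdempotent.
Variables (R : realType) (H : hilbert R).

(** For [u] in the range and [w] in the kernel, T (u + l w) = u, so |u| <= |u + l w| for every
    scalar [l]; this forces <u, w> = 0, and a projection whose range and kernel are orthogonal is
    selfadjoint. *)
Lemma contractive_idempotent_selfadjoint (T : H -> H) : bounded_operators T -> T \o T = T ->
  (forall x, rnorm (T x) <= rnorm x) -> selfadjoint T.
Proof.
move=> Tb TT Tc.
have key u w : T u = u -> T w = 0 -> hdot u w = 0.
  move=> Tu Tw.
  have [z z1 hz] := rnorm_phase (hdot u w).
  apply: rnorm0_eq0; apply/eqP; rewrite -sqrf_eq0 eq_le sqr_ge0 andbT.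
  rewrite -[leRHS](mul0r (rnorm w ^+ 2)).
  apply: ler_of_quadratic => [|t t0|]; rewrite ?sqr_ge0 ?rnorm_ge0 //.
  pose l : R[i] := (- t)%:C%C * Num.conj z.
  have := Tc (u + l *: w); rewrite bopD // bopZ // Tu Tw scaler0 addr0.
  rewrite -ler_sqr ?nnegrE ?rnorm_ge0 // [leRHS]rnorm_sqr_hdot.
  rewrite !(hdotDl, hdotDr) !ReD hdotZl [hdot (l *: w) _]hdotZl !hdotZr.
  have -> : complex.Re (l * hdot w u) = complex.Re (Num.conj l * hdot u w).
    by rewrite -ReJ rmorphM /= -hdotC.
  rewrite mulrA mul_conj ReMr -!rnorm_sqr_hdot /l rmorphM /= conj_realc conjCK -mulrA hz -rmorphM /=.
  rewrite rnormM rnormJ z1 mulr1 rnorm_real real_normK ?num_real // sqrrN.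
  move: (rnorm u ^+ 2) (rnorm w ^+ 2) (rnorm (hdot u w)) => a b c; lra.
have ortho x y : hdot (T x) (y - T y) = 0.
  by apply: key; rewrite ?bopB // (compE TT) ?subrr.
apply: adjoint_unique => // x y.
have h1 : hdot (T x) y = hdot (T x) (T y).
  by apply/eqP; rewrite -subr_eq0 -hdotNr -hdotDr ortho.
have h2 : hdot (T y) x = hdot (T y) (T x).
  by apply/eqP; rewrite -subr_eq0 -hdotNr -hdotDr ortho.
by rewrite h1 hdotC -h2 -hdotC.
Qed.

End ContractiveIdempotent.

Lemma l2sq_of_l2norm (R : realType) (V : normedZmodType R[i]) n (x y : 'cV[V]_n) :
  l2norm x <= 1 * l2norm y -> l2sq x <= l2sq y.
Proof. by rewrite mul1r -!l2norm_sqr ler_sqr ?nnegrE ?l2norm_ge0. Qed.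

Lemma l2norm_of_l2sq (R : realType) (V : normedZmodType R[i]) n (x y : 'cV[V]_n) :
  l2sq x <= l2sq y -> l2norm x <= 1 * l2norm y.
Proof. by rewrite mul1r -!l2norm_sqr ler_sqr ?nnegrE ?l2norm_ge0. Qed.

Section DualMaps.
Variables (R : realType) (E : semiinner R).
Local Notation H := (dual_hilbert E).
Local Notation q x := (complex.Re (@si_form R E x x)).
Implicit Types (sg tau : E -> E) (g : H) (x y : E).

Definition bounded_linear_map sg : Prop := linear sg /\ exists c : R, forall x, q (sg x) <= c * q x.

Lemma si_dualE_linear (g : si_dual E) sg a x y : linear sg ->
  g (sg (a *: x + y)) = Num.conj a * g (sg x) + g (sg y).
Proof. by move=> sl; rewrite sl si_dualD si_dualZ. Qed.

(** The transpose of [sg]: contravariant and conjugate-linear in it. [insubd] makes it total; the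
    intended values are those for a [bounded_linear_map]. *)
Definition dual_map sg (g : H) : H := insubd (0 : si_dual E) ((g : si_dual E) \o sg : E -> R[i]^o).

Lemma dual_mapE sg g x : bounded_linear_map sg -> (dual_map sg g : si_dual E) x = (g : si_dual E) (sg x).
Proof.
move=> [sl [c sc]]; rewrite /dual_map insubdK //; apply/asboolP; split=> [a y z|].
  exact: si_dualE_linear.
exists (si_dual_N g * `|c|) => y; rewrite (le_trans (si_dual_bound _ _)) // -mulrA ler_wpM2l ?si_dual_N_ge0 //.
by rewrite (le_trans (sc y)) // ler_wpM2r ?si_re_ge0 // ler_norm.
Qed.

Lemma dual_ext (g h : H) : (forall x, (g : si_dual E) x = (h : si_dual E) x) -> g = h.
Proof. exact: si_dual_eq. Qed.

Lemma dual_addE (g h : H) x : ((g + h : H) : si_dual E) x = (g : si_dual E) x + (h : si_dual E) x.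
Proof. by []. Qed.

Lemma dual_scaleE a (g : H) x : ((a *: g : H) : si_dual E) x = a * (g : si_dual E) x.
Proof. by []. Qed.

Lemma dual_sumE (I : finType) (F : I -> H) x :
  ((\sum_i F i : H) : si_dual E) x = \sum_i (F i : si_dual E) x.
Proof. by elim/big_rec2: _ => // i a b _ <-; rewrite dual_addE. Qed.

(* The squared norm of a column [g] is the supremum of [2 Re (g x) - q x], so a
   matrix that contracts [q] acts contractively on the transposed side. *)
Lemma dual_map_contraction n (sg : 'I_n -> 'I_n -> E -> E) (g : 'cV[H]_n) :
  (forall i j, bounded_linear_map (sg i j)) ->
  (forall x : 'I_n -> E, \sum_i q (\sum_j sg i j (x j)) <= \sum_j q (x j)) ->
  l2sq (mxapp (\matrix_(j, i) dual_map (sg i j)) g) <= l2sq g.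
Proof.
move=> sb sc; pose f j : H := \sum_i dual_map (sg i j) (g i 0).
have -> : l2sq (mxapp (\matrix_(j, i) dual_map (sg i j)) g) = \sum_j si_dual_N (f j).
  apply: eq_bigr => j _; rewrite -dual_rnorm mxappE; congr (rnorm _ ^+ 2).
  by apply: eq_bigr => i _; rewrite mxE.
have -> : l2sq g = \sum_i si_dual_N (g i 0) by apply: eq_bigr => i _; rewrite dual_rnorm.
apply: ler_of_addgt0 => d d0.
have n1 : 0 < (n.+1)%:R :> R by rewrite ltr0n.
(* Dividing by [n.+1] covers n = 0, and the n errors still sum to at most [d]. *)
have d1 : 0 < d / n.+1%:R by rewrite divr_gt0.
have /choice[x hx] j := si_dual_N_approx (f j) d1.
apply: (@le_trans _ _ (\sum_j (2 * complex.Re ((f j : si_dual E) (x j)) - q (x j)) + d)).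
  apply: (@le_trans _ _ (\sum_j (2 * complex.Re ((f j : si_dual E) (x j)) - q (x j) + d / n.+1%:R))).
    by apply: ler_sum => j _; rewrite -lerBlDr ltW.
  rewrite big_split /= lerD2l sumr_const card_ord -[leLHS]mulr_natr -mulrA ler_piMr ?(ltW d0) //.
  by rewrite mulrC ler_pdivrMr // mul1r ler_nat.
rewrite lerD2r.
have -> : \sum_j (2 * complex.Re ((f j : si_dual E) (x j)) - q (x j)) =
    \sum_i 2 * complex.Re ((g i 0 : si_dual E) (\sum_j sg i j (x j))) - \sum_j q (x j).
  rewrite big_split /= sumrN; congr (_ - _).
  rewrite -!mulr_sumr -!Re_sum; congr (2 * complex.Re _).
  under eq_bigr => j _ do rewrite dual_sumE.
  rewrite exchange_big /=; apply: eq_bigr => i _.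
  rewrite (big_morph (g i 0 : si_dual E) (si_dualD (g i 0)) (si_dual0 (g i 0))).
  by apply: eq_bigr => j _; rewrite dual_mapE.
apply: (@le_trans _ _ (\sum_i 2 * complex.Re ((g i 0 : si_dual E) (\sum_j sg i j (x j))) -
    \sum_i q (\sum_j sg i j (x j)))).
  by rewrite lerD2l lerN2.
by rewrite -sumrB; apply: ler_sum => i _; exact: si_dual_gap_le.
Qed.

Lemma bop_dual_map sg : bounded_linear_map sg -> bounded_operators (dual_map sg).
Proof.
move=> sb; split=> [a g h|].
  by apply: dual_ext => x; rewrite dual_addE dual_scaleE !dual_mapE // dual_addE dual_scaleE.
have [C C0 hC] : exists2 C : R, 0 < C & forall x, q (sg x) <= C * q x.
  have [_ [c sc]] := sb; exists (`|c| + 1); first by rewrite ltr_wpDl.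
  by move=> x; rewrite (le_trans (sc x)) // ler_wpM2r ?si_re_ge0 //; have := ler_norm c; lra.
exists (Num.sqrt C) => g; rewrite -ler_sqr ?nnegrE ?mulr_ge0 ?rnorm_ge0 ?sqrtr_ge0 //.
rewrite exprMn !dual_rnorm sqr_sqrtr ?(ltW C0) //; apply: si_dual_N_le => x.
(* At the test point [sg x] / C the bound on [sg] makes the gap at least 1 / C times the gap of the
   transposed functional at [x]. *)
rewrite dual_mapE //; have := si_dual_gap_le g ((C^-1)%:C%C *: sg x).
rewrite si_dualZ conj_realc ReMr si_reZ rnorm_real ger0_norm ?invr_ge0 ?(ltW C0) //.
move=> h; rewrite -ler_pdivrMl //; apply: le_trans h.
rewrite mulrBr mulrCA lerD2l lerN2 expr2 -mulrA ler_pM2l ?invr_gt0 //.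
by rewrite ler_pdivrMl.
Qed.

Lemma dual_map_comp sg tau : bounded_linear_map sg -> bounded_linear_map tau ->
  bounded_linear_map (sg \o tau) -> dual_map tau \o dual_map sg = dual_map (sg \o tau).
Proof.
move=> sb tb stb; apply/funext => g; apply: dual_ext => x.
by rewrite /= !dual_mapE.
Qed.

Lemma bounded_linear_map_comp sg tau : bounded_linear_map sg -> bounded_linear_map tau ->
  bounded_linear_map (sg \o tau).
Proof.
move=> [sl [c sc]] [tl [d td]]; split=> [a x y /=|]; first by rewrite tl sl.
exists (`|c| * d) => x /=; rewrite (le_trans (sc _)) // -mulrA.
apply: (@le_trans _ _ (`|c| * q (tau x))); first by rewrite ler_wpM2r ?si_re_ge0 ?ler_norm.
by rewrite ler_wpM2l.
Qed.

(** Adjoints of dual maps are covariant again: the evaluations carry a copy of the original action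
    on [E]. *)
Lemma adjoint_dual_map_eval sg x : bounded_linear_map sg ->
  adjoint (dual_map sg) (si_eval x) = si_eval (sg x).
Proof.
move=> sb; apply: hdot_eqr => g; rewrite -hdot_adjoint; last exact: bop_dual_map.
by rewrite !dual_reproducing dual_mapE.
Qed.

Lemma dual_map_projection sg : bounded_linear_map sg -> (forall x, sg (sg x) = sg x) ->
  (forall x, q (sg x) <= q x) -> orthogonal_projection (dual_map sg).
Proof.
move=> sb ss sc; have bs := bop_dual_map sb.
have idem : dual_map sg \o dual_map sg = dual_map sg.
  by apply/funext => g; apply: dual_ext => x; rewrite /= !dual_mapE // ss.
split=> //; apply: contractive_idempotent_selfadjoint => // g.
rewrite -ler_sqr ?nnegrE ?rnorm_ge0 // !dual_rnorm; apply: si_dual_N_le => x.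
rewrite dual_mapE //; apply: le_trans (si_dual_gap_le g (sg x)).
by rewrite lerD2l lerN2.
Qed.

Lemma si_eval_sum (I : finType) (F : I -> E) : si_eval (\sum_i F i) = \sum_i si_eval (F i).
Proof.
apply: dual_ext => x; rewrite dual_sumE /=.
exact: (big_morph (fun u => @si_form R E u x) (fun u v => si_formDl u v x) (si_form0l x)).
Qed.

End DualMaps.

Section Doubling.
Variables (R : realType) (H : hilbert R).
Local Notation HH := (prod_hilbert H H).
Implicit Types (A B : H -> H).

Definition dbl A B (v : HH) : HH := hpair (A (hfst v)) (B (hsnd v)).
Definition swap (v : HH) : HH := hpair (hsnd v) (hfst v).

Lemma bop_dbl A B : bounded_operators A -> bounded_operators B -> bounded_operators (dbl A B).
Proof.
move=> Ab Bb; split=> [a x y|].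
  by rewrite /dbl hfst_lin hsnd_lin !bopD // !bopZ // hpair_lin.
have [K K0 hK] := bop_pos Ab; have [L L0 hL] := bop_pos Bb.
exists (K + L) => x.
rewrite -ler_sqr ?nnegrE ?mulr_ge0 ?addr_ge0 ?rnorm_ge0 ?(ltW K0) ?(ltW L0) //.
rewrite exprMn !prod_rnorm mulrDr lerD //= -exprMn ler_sqr ?nnegrE ?mulr_ge0 ?addr_ge0 ?rnorm_ge0 ?(ltW K0) ?(ltW L0) //.
  by rewrite (le_trans (hK _)) // ler_wpM2r ?rnorm_ge0 // lerDl ltW.
by rewrite (le_trans (hL _)) // ler_wpM2r ?rnorm_ge0 // lerDr ltW.
Qed.

Lemma adjoint_dbl A B : bounded_operators A -> bounded_operators B ->
  adjoint (dbl A B) = dbl (adjoint A) (adjoint B).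
Proof.
move=> Ab Bb; apply: adjoint_unique; first exact: bop_dbl.
by move=> x y; rewrite !prod_hdot /= !hdot_adjoint.
Qed.

Lemma bop_swap : bounded_operators swap.
Proof.
split=> [a x y|]; first by [].
exists 1 => x; rewrite mul1r -ler_sqr ?nnegrE ?rnorm_ge0 // !prod_rnorm /=.
by rewrite addrC.
Qed.

Lemma swap_swap : swap \o swap = id. Proof. by apply/funext => -[]. Qed.

Lemma adjoint_swap : adjoint swap = swap.
Proof.
apply: adjoint_unique; first exact: bop_swap.
by move=> x y; rewrite !prod_hdot /= addrC.
Qed.

Lemma unitary_swap : unitary swap.
Proof. by split; rewrite ?adjoint_swap ?swap_swap //; exact: bop_swap. Qed.

Lemma dagger_dbl A B : bounded_operators A -> bounded_operators B ->
  dagger swap (dbl A B) = dbl (adjoint B) (adjoint A).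
Proof. by move=> Ab Bb; rewrite /dagger adjoint_dbl. Qed.

Lemma l2sq_prod n (v : 'cV[HH]_n) :
  l2sq v = l2sq (map_mx (@hfst R H H) v) + l2sq (map_mx (@hsnd R H H) v).
Proof.
rewrite /l2sq -big_split /=; apply: eq_bigr => i _.
by rewrite prod_rnorm !mxE.
Qed.

Lemma hfst_sum (I : finType) (F : I -> HH) : hfst (\sum_i F i) = \sum_i hfst (F i).
Proof. exact: (big_morph (@hfst R H H)). Qed.

Lemma hsnd_sum (I : finType) (F : I -> HH) : hsnd (\sum_i F i) = \sum_i hsnd (F i).
Proof. exact: (big_morph (@hsnd R H H)). Qed.

Lemma mxapp_dbl m n (A B : 'M[H -> H]_(m, n)) (v : 'cV[HH]_n) :
  l2sq (mxapp (\matrix_(i, j) dbl (A i j) (B i j)) v) =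
  l2sq (mxapp A (map_mx (@hfst R H H) v)) + l2sq (mxapp B (map_mx (@hsnd R H H) v)).
Proof.
have e1 : map_mx (@hfst R H H) (mxapp (\matrix_(i, j) dbl (A i j) (B i j)) v) = mxapp A (map_mx (@hfst R H H) v).
  apply/matrixP => i j; rewrite [LHS]mxE !mxappE hfst_sum.
  by apply: eq_bigr => k _; rewrite !mxE.
have e2 : map_mx (@hsnd R H H) (mxapp (\matrix_(i, j) dbl (A i j) (B i j)) v) = mxapp B (map_mx (@hsnd R H H) v).
  apply/matrixP => i j; rewrite [LHS]mxE !mxappE hsnd_sum.
  by apply: eq_bigr => k _; rewrite !mxE.
by rewrite l2sq_prod e1 e2.
Qed.

End Doubling.

Section DoubledMaps.
Variables (R : realType) (E : semiinner R).
Local Notation H := (dual_hilbert E).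
Local Notation HH := (prod_hilbert H H).
Local Notation q x := (complex.Re (@si_form R E x x)).
Local Notation blm := (@bounded_linear_map R E).
Implicit Types (sg tau : E -> E).

(* [doubled sg tau] represents an element acting by [sg] whose formal adjoint
   acts by [tau]; swapping the two copies exchanges the roles. *)
Definition doubled sg tau : HH -> HH := dbl (dual_map tau) (adjoint (dual_map sg)).

Lemma bop_doubled sg tau : blm sg -> blm tau -> bounded_operators (doubled sg tau).
Proof.
by move=> sb tb; apply: bop_dbl; [|apply: bop_adjoint]; exact: bop_dual_map.
Qed.

Lemma dagger_doubled sg tau : blm sg -> blm tau ->
  dagger (@swap R H) (doubled sg tau) = doubled tau sg.
Proof.
move=> sb tb; rewrite /doubled dagger_dbl ?adjointK //; try exact: bop_dual_map.
by apply: bop_adjoint; exact: bop_dual_map.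
Qed.

Lemma doubled_comp sg tau sg' tau' : blm sg -> blm tau -> blm sg' -> blm tau' ->
  doubled sg tau \o doubled sg' tau' = doubled (sg \o sg') (tau' \o tau).
Proof.
move=> sb tb sb' tb'; rewrite /doubled.
rewrite -(dual_map_comp sb sb' (bounded_linear_map_comp sb sb')).
rewrite -(dual_map_comp tb' tb (bounded_linear_map_comp tb' tb)).
by rewrite adjoint_comp //; exact: bop_dual_map.
Qed.

Lemma dual_map_lincomb a sg sg' : blm sg -> blm sg' -> blm (fun x => a *: sg x + sg' x) ->
  dual_map (fun x => a *: sg x + sg' x) = Num.conj a *: dual_map sg + dual_map sg'.
Proof.
move=> sb sb' ssb; apply/funext => g; apply: dual_ext => x.
rewrite -[(_ + _) g]/(Num.conj a *: dual_map sg g + dual_map sg' g) dual_addE dual_scaleE !dual_mapE //.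
by rewrite si_dualD si_dualZ.
Qed.

Lemma doubled_lincomb a sg tau sg' tau' : blm sg -> blm tau -> blm sg' -> blm tau' ->
  blm (fun x => a *: sg x + sg' x) -> blm (fun x => Num.conj a *: tau x + tau' x) ->
  doubled (fun x => a *: sg x + sg' x) (fun x => Num.conj a *: tau x + tau' x) =
  a *: doubled sg tau + doubled sg' tau'.
Proof.
move=> sb tb sb' tb' ssb ttb; rewrite /doubled !dual_map_lincomb // conjCK.
rewrite adjoint_lincomb ?conjCK; try exact: bop_dual_map.
by [].
Qed.

(** A matrix of dual maps is bounded through the transposed matrix of maps, hence [tau j i] for the
    first component; the adjoint in the second component transposes once more, hence [sg i j]. *)
Lemma doubled_contraction n (sg tau : 'I_n -> 'I_n -> E -> E) :
  (forall i j, blm (sg i j)) -> (forall i j, blm (tau i j)) ->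
  (forall x : 'I_n -> E, \sum_i q (\sum_j sg i j (x j)) <= \sum_j q (x j)) ->
  (forall x : 'I_n -> E, \sum_i q (\sum_j tau j i (x j)) <= \sum_j q (x j)) ->
  operator_mxnorm (\matrix_(i, j) doubled (sg i j) (tau i j)) <= 1.
Proof.
move=> sb tb sc tc; apply: opnorm_le_sq => // [i j|v].
  by rewrite mxE; exact: bop_doubled.
pose A : 'M[H -> H]_n := \matrix_(i, j) dual_map (tau i j).
pose M : 'M[H -> H]_n := \matrix_(j, i) dual_map (sg i j).
have Mb : mx_in (@bounded_operators R H) M by move=> i j; rewrite mxE; exact: bop_dual_map.
have -> : \matrix_(i, j) doubled (sg i j) (tau i j) =
   \matrix_(i, j) dbl (A i j) (map_mx (@adjoint R H) M^T i j).
  by apply/matrixP => i j; rewrite !mxE.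
rewrite mxapp_dbl expr1n mul1r l2sq_prod; apply: lerD.
  have -> : A = \matrix_(j, i) dual_map (tau j i) by apply/matrixP => i j; rewrite !mxE.
  exact: (dual_map_contraction (sg := fun i j => tau j i)).
have M1 x : l2norm (mxapp M x) <= 1 * l2norm x.
  apply: l2norm_of_l2sq; exact: dual_map_contraction.
apply: l2sq_of_l2norm; exact: (adjoint_mx_bound Mb ler01 M1 (map_mx (@hsnd R H H) v)).
Qed.

(** The matrix is tested on the column with entries (0, [si_eval (z j)]). There the second
    components are the evaluations at the sums of [sg i j (z j)], whose squared norms are values of
    the form. *)
Lemma doubled_lower n (sg tau : 'I_n -> 'I_n -> E -> E) (z : 'I_n -> E) :
  (forall i j, blm (sg i j)) -> (forall i j, blm (tau i j)) -> \sum_j q (z j) <= 1 ->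
  \sum_i q (\sum_j sg i j (z j)) <= operator_mxnorm (\matrix_(i, j) doubled (sg i j) (tau i j)) ^+ 2.
Proof.
move=> sb tb z1; set T := \matrix_(i, j) doubled _ _.
have Tb : mx_in (@bounded_operators R HH) T by move=> i j; rewrite mxE; exact: bop_doubled.
pose v : 'cV[HH]_n := \col_j hpair 0 (si_eval (z j)).
have nev y : rnorm (si_eval y) ^+ 2 = q y by rewrite dual_rnorm si_eval_N.
have := opnorm_ball_sq Tb v.
have -> : l2sq v = \sum_j q (z j).
  by apply: eq_bigr => j _; rewrite mxE prod_rnorm /= rnorm0 expr0n add0r nev.
move=> h; apply: le_trans (le_trans h _); last first.
  by rewrite ler_piMr // sqr_ge0.
apply: ler_sum => i _; rewrite mxappE prod_rnorm hsnd_sum.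
have -> : \sum_k hsnd (T i k (v k 0)) = si_eval (\sum_j sg i j (z j)).
  by rewrite si_eval_sum; apply: eq_bigr => k _; rewrite !mxE /= adjoint_dual_map_eval.
by rewrite nev lerDr sqr_ge0.
Qed.

End DoubledMaps.

(** * Matrix norms on vector spaces and embeddings into corners *)

Section ScalarNormFacts.
Variable R : realType.
Local Notation sn := (@scalar_mxnorm R _).

Lemma scalar_mxnormD n (x y : 'M[R[i]]_n) : sn (x + y) <= sn x + sn y.
Proof.
apply: scalar_mxnorm_le => [|v]; first by rewrite addr_ge0 ?scalar_mxnorm_ge0.
by rewrite mulmxDl (le_trans (l2normD _ _)) // mulrDl lerD ?scalar_mxnorm_ball.
Qed.

Lemma scalar_mxnormM n (x y : 'M[R[i]]_n) : sn (x *m y) <= sn x * sn y.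
Proof.
apply: scalar_mxnorm_le => [|v]; first by rewrite mulr_ge0 ?scalar_mxnorm_ge0.
by rewrite -mulmxA (le_trans (scalar_mxnorm_ball _ _)) // -mulrA ler_wpM2l ?scalar_mxnorm_ge0 ?scalar_mxnorm_ball.
Qed.

Lemma scalar_mxnorm_le1 n (u : 'M[R[i]]_n) : (forall c : 'cV_n, l2sq (u *m c) <= l2sq c) -> sn u <= 1.
Proof. by move=> h; apply: scalar_mxnorm_le => // v; exact: l2norm_of_l2sq. Qed.

Lemma scalar_mxnorm1 n : sn (1%:M : 'M[R[i]]_n) <= 1.
Proof. by apply: scalar_mxnorm_le1 => c; rewrite mul1mx. Qed.

Lemma scalar_mxnorm_scalar n (t : R) : 0 <= t -> sn (t%:C%C%:M : 'M[R[i]]_n) <= t.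
Proof. by move=> t0; apply: scalar_mxnorm_le => // v; rewrite mul_scalar_mx l2normZc. Qed.

Lemma scalar_mxnorm0 n : sn (0 : 'M[R[i]]_n) = 0.
Proof.
apply/eqP; rewrite eq_le scalar_mxnorm_ge0 andbT; apply: scalar_mxnorm_le => // v.
by rewrite mul0mx l2norm0 mul0r.
Qed.

Lemma l2sq0 (V : normedZmodType R[i]) n : l2sq (0 : 'cV[V]_n) = 0.
Proof. by rewrite /l2sq big1 // => i _; rewrite mxE rnorm0 expr0n. Qed.

Lemma corner_mx_contraction r n (c : 'cV[R[i]]_(r + n)) :
  l2sq (block_mx (0 : 'M_r) 0 0 (1%:M : 'M_n) *m c) <= l2sq c.
Proof.
rewrite -[c]vsubmxK mul_block_col !mul0mx mul1mx !add0r !l2sq_col_mx l2sq0 add0r.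
by rewrite lerDr l2sq_ge0.
Qed.

Lemma scalar_mxnorm_pad r n (x : 'M[R[i]]_(r, n)) (y : 'M[R[i]]_n) : sn y <= sn (block_mx 0 x 0 y).
Proof.
apply: scalar_mxnorm_le => [|v]; first exact: scalar_mxnorm_ge0.
have := scalar_mxnorm_ball (block_mx (0 : 'M_r) x 0 y) (col_mx 0 v).
rewrite mul_block_col !mul0mx !add0r => h.
have -> : l2norm v = l2norm (col_mx (0 : 'cV[R[i]]_r) v).
  by apply/eqP; rewrite -(@eqrXn2 _ 2) ?l2norm_ge0 // !l2norm_sqr l2sq_col_mx l2sq0 add0r.
apply: le_trans h.
by rewrite -ler_sqr ?nnegrE ?l2norm_ge0 // !l2norm_sqr l2sq_col_mx lerDr l2sq_ge0.
Qed.

End ScalarNormFacts.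

Section MatrixNorms.
Variables (R : realType) (V : lmodType R[i]) (nv : forall n, 'M[V]_n -> R).
Local Notation nrm := (@nv _).

Definition scalar_act n (l : 'M[R[i]]_n) (x : 'M[V]_n) (m : 'M[R[i]]_n) : 'M[V]_n :=
  mulmx_by (fun v (a : R[i]) => a *: v) (mulmx_by *:%R l x) m.

(** The norm axioms of an operator space, on a whole vector space in place of a carrier. *)
Record matrix_norm : Prop := {
  mn_ge0 : forall n (x : 'M[V]_n), 0 <= nrm x;
  mn_D : forall n (x y : 'M[V]_n), nrm (x + y) <= nrm x + nrm y;
  mn_scale : forall n l (x : 'M[V]_n) m, nrm (scalar_act l x m) <= scalar_mxnorm l * nrm x * scalar_mxnorm m;
  mn_dsum : forall n m (x : 'M[V]_n) (y : 'M[V]_m), nrm (block_mx x 0 0 y) = Num.max (nrm x) (nrm y) }.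

Hypothesis N : matrix_norm.

Lemma scalar_act1r n l (x : 'M[V]_n) : scalar_act l x 1%:M = mulmx_by *:%R l x.
Proof.
apply/matrixP => i j; rewrite !mxE (bigD1 j) //= big1 ?addr0 => [|k kj].
  by rewrite !mxE eqxx scale1r.
by rewrite !mxE (negbTE kj) scale0r.
Qed.

Lemma scalar_act1l n (x : 'M[V]_n) m : scalar_act 1%:M x m = mulmx_by (fun v (a : R[i]) => a *: v) x m.
Proof.
apply/matrixP => i j; rewrite !mxE; apply: eq_bigr => k _; congr (_ *: _).
rewrite mxE (bigD1 i) //= big1 ?addr0 => [|r ri]; first by rewrite mxE eqxx scale1r.
by rewrite mxE eq_sym (negbTE ri) scale0r.
Qed.

Lemma mn_left n l (x : 'M[V]_n) : nrm (mulmx_by *:%R l x) <= scalar_mxnorm l * nrm x.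
Proof.
rewrite -scalar_act1r (le_trans (mn_scale N _ _ _)) // ler_piMr ?scalar_mxnorm1 //.
by rewrite mulr_ge0 ?scalar_mxnorm_ge0 ?(mn_ge0 N).
Qed.

Lemma mn_right n (x : 'M[V]_n) m : nrm (mulmx_by (fun v (a : R[i]) => a *: v) x m) <= nrm x * scalar_mxnorm m.
Proof.
rewrite -scalar_act1l (le_trans (mn_scale N _ _ _)) // ler_wpM2r ?scalar_mxnorm_ge0 //.
by rewrite ler_piMl ?scalar_mxnorm1 // (mn_ge0 N).
Qed.

Lemma mn_real n t (x : 'M[V]_n) : 0 <= t -> nrm (map_mx ( *:%R t%:C%C) x) <= t * nrm x.
Proof.
move=> t0; have -> : map_mx ( *:%R t%:C%C) x = mulmx_by *:%R (t%:C%C%:M) x.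
  apply/matrixP => i j; rewrite !mxE (bigD1 i) //= big1 ?addr0 => [|k ki]; first by rewrite mxE eqxx.
  by rewrite mxE eq_sym (negbTE ki) mulr0n scale0r.
by rewrite (le_trans (mn_left _ _)) // ler_wpM2r ?(mn_ge0 N) // scalar_mxnorm_scalar.
Qed.

Lemma mn_0 n : nrm (0 : 'M[V]_n) = 0.
Proof.
apply/eqP; rewrite eq_le (mn_ge0 N) andbT.
have := mn_real (0 : 'M[V]_n) (lexx 0); rewrite mul0r.
by rewrite (_ : map_mx _ _ = 0) //; apply/matrixP => i j; rewrite !mxE scaler0.
Qed.

Lemma mn_pad r n (x : 'M[V]_(r, n)) (y : 'M[V]_n) : nrm y <= nrm (block_mx 0 x 0 y).
Proof.
pose F : 'M[R[i]]_(r + n) := block_mx 0 0 0 1%:M.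
pose Z : 'M[V]_(r + n) := block_mx (0 : 'M_r) x 0 y.
have F1 : scalar_mxnorm F <= 1 by apply: scalar_mxnorm_le1; exact: corner_mx_contraction.
have FE : mulmx_by *:%R F Z = block_mx (0 : 'M[V]_r) (0 : 'M_(r, n)) (0 : 'M_(n, r)) y.
  rewrite /Z /F.
  apply/matrixP => i j; rewrite mxE big_split_ord /=.
  case: (split_ordP i) => i' ->.
    rewrite !big1 ?addr0 => [|k _|k _]; try by rewrite ?block_mxEul ?block_mxEur mxE scale0r.
    by case: (split_ordP j) => j' ->; rewrite ?block_mxEul ?block_mxEur mxE.
  rewrite big1 ?add0r => [|k _]; last by rewrite block_mxEdl mxE scale0r.
  rewrite (bigD1 i') //= big1 ?addr0 => [|k ki]; last by rewrite block_mxEdr mxE eq_sym (negbTE ki) scale0r.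
  rewrite block_mxEdr mxE eqxx scale1r.
  by case: (split_ordP j) => j' ->; rewrite ?block_mxEdl ?block_mxEdr // mxE.
have := mn_left F Z; rewrite FE (mn_dsum N) => h.
apply: (@le_trans _ _ (Num.max (nrm (0 : 'M_r)) (nrm y))); first by rewrite le_max lexx orbT.
by apply: (le_trans h); rewrite ler_piMl ?(mn_ge0 N).
Qed.

Lemma mn_contraction n (u : 'M[R[i]]_n) (x : 'M[V]_n) :
  (forall c : 'cV_n, l2sq (u *m c) <= l2sq c) -> nrm (mulmx_by *:%R u x) <= nrm x.
Proof.
move=> h; rewrite (le_trans (mn_left _ _)) // ler_piMl ?(mn_ge0 N) //; exact: scalar_mxnorm_le1.
Qed.

Lemma mn_shrink n (x : 'M[V]_n) c : 0 < c -> exists2 t, 0 < t & nrm (map_mx ( *:%R t%:C%C) x) <= c.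
Proof.
move=> c0; have x1 : 0 < nrm x + 1 by have := mn_ge0 N x; lra.
exists (c / (nrm x + 1)); first by rewrite divr_gt0.
rewrite (le_trans (mn_real _ _)) ?divr_ge0 ?(ltW c0) ?(ltW x1) //.
by rewrite mulrAC ler_pdivrMr // ler_wpM2l ?(ltW c0) //; lra.
Qed.

End MatrixNorms.

(** The two constants have separate origins: matrices of norm at most 1/4 are represented by
    contractions, and the positive forms recover squared norms up to the factor 16. *)
Record corner_embedding (R : realType) (H : hilbert R) (P Q : H -> H) (V : lmodType R[i])
    (nV : forall n, 'M[V]_n -> R) (f : V -> H -> H) : Prop := {
  ce_linear : linear f;
  ce_bop : forall v, bounded_operators (f v);
  ce_corner : forall v, P \o f v \o Q = f v;
  ce_upper : forall n (x : 'M[V]_n), operator_mxnorm (map_mx f x) <= 4 * nV n x;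
  ce_lower : forall n (x : 'M[V]_n), nV n x <= 4 * operator_mxnorm (map_mx f x) }.

Lemma doubled_corner (R : realType) (E : semiinner R) (sg tau P Q : E -> E) :
  bounded_linear_map P -> bounded_linear_map sg -> bounded_linear_map tau -> bounded_linear_map Q ->
  doubled P P \o doubled sg tau \o doubled Q Q = doubled (P \o (sg \o Q)) (Q \o (tau \o P)).
Proof.
move=> Pb sb tb Qb; rewrite (doubled_comp Pb Pb sb tb).
by rewrite (doubled_comp (bounded_linear_map_comp Pb sb) (bounded_linear_map_comp tb Pb) Qb Qb).
Qed.

(** * From lifted actions to operators on the doubled space *)

Section Representation.
Variable R : realType.
Variables (X : lmodType R[i]) (p : bool -> X -> X) (e : X).
Variables (S : zmodType) (act : S -> X -> X).
Variables (adm : forall r, 'M[S]_r -> Prop) (nu : forall n, 'M[X]_n -> R).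
Hypothesis p_linear : forall b, linear (p b).
Hypothesis p_proj : forall b b' x, p b (p b' x) = if b == b' then p b x else 0.
Hypothesis p_sum : forall x, p true x + p false x = x.
Hypothesis act_linear : forall s, linear (act s).
Variables (E : semiinner R) (lift : (X -> X) -> E -> E).
Local Notation q x := (complex.Re (@si_form R E x x)).
Local Notation blm := (@bounded_linear_map R E).
Hypothesis lift_linear : forall phi, linear phi -> linear (lift phi).
Hypothesis lift_comp : forall phi psi m, linear phi -> linear psi -> lift phi (lift psi m) = lift (phi \o psi) m.
Hypothesis lift_lincomb : forall a phi psi m, linear phi -> linear psi ->
  lift (fun x => a *: phi x + psi x) m = a *: lift phi m + lift psi m.
Hypothesis lift_id : forall m, lift id m = m.
Hypothesis lift_act : forall r (s : 'M[S]_r) (x : 'I_r -> E), adm s ->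
  \sum_i q (\sum_k lift (act (s i k)) (x k)) <= \sum_i q (x i).
Hypothesis lift_p : forall b x, q (lift (p b) x) <= q x.
Hypothesis lift_lower : forall n (s : 'M[S]_n), exists z : 'I_n -> E,
  \sum_j q (z j) <= 1 /\
  forall c, 0 <= c -> c <= nu (\matrix_(i, j) act (s i j) e) ->
    c ^+ 2 <= 16 * \sum_i q (\sum_j lift (act (s i j)) (z j)).

Local Notation H := (dual_hilbert E).
Local Notation HH := (prod_hilbert H H).

Definition rep_projection b : HH -> HH := doubled (lift (p b)) (lift (p b)).

Lemma blm_p b : blm (lift (p b)).
Proof. by split; [exact: lift_linear | exists 1 => x; rewrite mul1r]. Qed.

Lemma orthogonal_rep_projection b : orthogonal_projection (rep_projection b).
Proof.
have pb := blm_p b.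
have pp : lift (p b) \o lift (p b) = lift (p b).
  apply/funext => x /=; rewrite lift_comp //; congr (lift _ x).
  by apply/funext => y /=; rewrite p_proj eqxx.
have [Pb PP Ps] : orthogonal_projection (dual_map (lift (p b))).
  by apply: dual_map_projection => // x; rewrite -[LHS]/((lift (p b) \o lift (p b)) x) pp.
have Db : bounded_operators (rep_projection b) by exact: bop_doubled.
split; [exact: Db | by rewrite /rep_projection (doubled_comp pb pb pb pb) pp |].
by rewrite /selfadjoint /rep_projection /doubled Ps (adjoint_dbl Pb Pb) Ps.
Qed.

Lemma complement_rep_projection : complement (rep_projection true) = rep_projection false.
Proof.
(* The coefficient 1 brings the sum of the two projections into the shape of [lift_lincomb] and
   [doubled_lincomb]. *)
have idE : lift (fun x => 1 *: p true x + p false x) = id.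
  apply/funext => m; rewrite -[RHS]lift_id; congr (lift _ m).
  by apply/funext => x; rewrite scale1r p_sum.
have lE : (fun m => 1 *: lift (p true) m + lift (p false) m) = id.
  by apply/funext => m; rewrite -lift_lincomb // idE.
have lE' : (fun m => Num.conj (1 : R[i]) *: lift (p true) m + lift (p false) m) = id.
  by rewrite -[RHS]lE rmorph1.
have bid : blm id by split=> //; exists 1 => x; rewrite mul1r.
have [bt bf] := (blm_p true, blm_p false).
have := @doubled_lincomb R E 1 (lift (p true)) (lift (p true)) (lift (p false)) (lift (p false)) bt bt bf bf.
rewrite lE lE' scale1r => /(_ bid bid) h.
have idid : doubled id id = (@id HH).
  rewrite /doubled; have -> : @dual_map R E id = (@id H) by apply/funext => g; apply: dual_ext => x; rewrite dual_mapE.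
  by apply/funext => -[u v]; rewrite adjoint_id.
apply/funext => x; rewrite /complement /rep_projection.
have -> : x = doubled id id x by rewrite idid.
by rewrite {1}h idid /= addrC addKr.
Qed.

Lemma rep_projection_swap b : rep_projection b \o @swap R H = @swap R H \o rep_projection b.
Proof.
have [Pb PP Ps] := orthogonal_rep_projection b.
have D := dagger_doubled (blm_p b) (blm_p b).
move: D; rewrite -/(rep_projection b) /dagger Ps => D.
by apply/funext => x; rewrite -{1}D /= (compE (@swap_swap R H)).
Qed.

Section Family.
Variables (V : lmodType R[i]) (nV : forall n, 'M[V]_n -> R) (NV : matrix_norm nV).
Variables (s s' : V -> S) (b b' : bool).
Hypothesis s_linear : forall a v w x, act (s (a *: v + w)) x = a *: act (s v) x + act (s w) x.
Hypothesis s'_linear : forall a v w x, act (s' (a *: v + w)) x = Num.conj a *: act (s' v) x + act (s' w) x.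
Hypothesis s_adm : forall n (x : 'M[V]_n), nV x <= 1 / 4 -> adm (map_mx s x).
Hypothesis s'_adm : forall n (x : 'M[V]_n), nV x <= 1 / 4 -> adm (map_mx s' x^T).
Hypothesis s_nu : forall n (x : 'M[V]_n), nV x <= nu (\matrix_(i, j) act (s (x i j)) e).
Hypothesis s_corner : forall v x, p b (act (s v) (p b' x)) = act (s v) x.
Hypothesis s'_corner : forall v x, p b' (act (s' v) (p b x)) = act (s' v) x.

(** [s v] acts as [v] and [s' v] as its formal adjoint. [S] carries no scalars, so linearity and
    conjugate-linearity in [v] are stated for the actions. *)
Definition rep_map (v : V) : HH -> HH := doubled (lift (act (s v))) (lift (act (s' v))).

Lemma small_multiple v : exists2 t : R, 0 < t & nV (const_mx (t%:C%C *: v) : 'M_1) <= 1 / 4.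
Proof.
have [|t t0 h] := @mn_shrink R V nV NV 1 (const_mx v) (1 / 4); first by rewrite divr_gt0.
exists t => //; rewrite (_ : const_mx _ = map_mx ( *:%R t%:C%C) (const_mx v)) //.
by apply/matrixP => i j; rewrite !mxE.
Qed.

(** Only a small multiple of [phi] is contractive for the form; undoing the factor [t] bounds [phi]
    with constant t^-2. *)
Lemma blm_of_small (phi psi : X -> X) (t : R) : 0 < t -> linear phi -> linear psi ->
  (forall x, psi x = t%:C%C *: phi x) -> (forall x, q (lift psi x) <= q x) -> blm (lift phi).
Proof.
move=> t0 pl ql E1 hq; split; first exact: lift_linear.
have zl : linear (fun _ : X => 0 : X) by move=> a x y; rewrite scaler0 addr0.
have phi0 x : lift (fun=> 0) x = 0.
  apply: (@addrI _ (1 *: lift (fun=> 0) x)); rewrite addr0 -lift_lincomb // scale1r.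
  by congr (lift _ x); apply/funext => y; rewrite scaler0 addr0.
exists (t ^- 2) => x; rewrite ler_pdivlMl ?exprn_gt0 //.
apply: le_trans (hq x).
have -> : psi = (fun y => t%:C%C *: phi y + 0) by apply/funext => y; rewrite addr0.
by rewrite (@lift_lincomb _ phi (fun=> 0)) // phi0 addr0 si_reZ rnorm_real gtr0_norm.
Qed.

Lemma act_single (w : S) x : adm (const_mx w : 'M_1) -> q (lift (act w) x) <= q x.
Proof.
by move=> h; have := lift_act (fun=> x) h; rewrite !big_ord1 mxE.
Qed.

Lemma s_scale a v x : act (s (a *: v)) x = a *: act (s v) x.
Proof.
have s0 : act (s 0) x = 0.
  by have := s_linear 1 0 0 x; rewrite !scale1r addr0 => h; apply: (@addrI _ (act (s 0) x)); rewrite -h addr0.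
by have := s_linear a v 0 x; rewrite addr0 s0 addr0.
Qed.

Lemma s'_scale a v x : act (s' (a *: v)) x = Num.conj a *: act (s' v) x.
Proof.
have s0 : act (s' 0) x = 0.
  by have := s'_linear 1 0 0 x; rewrite rmorph1 !scale1r addr0 => h; apply: (@addrI _ (act (s' 0) x)); rewrite -h addr0.
by have := s'_linear a v 0 x; rewrite addr0 s0 addr0.
Qed.

Lemma blm_s v : blm (lift (act (s v))).
Proof.
have [t t0 h] := small_multiple v.
apply: (@blm_of_small _ (act (s (t%:C%C *: v))) t) => // [x|x]; first exact: s_scale.
apply: act_single; have := s_adm h.
by rewrite (_ : map_mx s _ = const_mx (s (t%:C%C *: v))) //; apply/matrixP => i j; rewrite !mxE.
Qed.

Lemma blm_s' v : blm (lift (act (s' v))).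
Proof.
have [t t0 h] := small_multiple v.
apply: (@blm_of_small _ (act (s' (t%:C%C *: v))) t) => // [x|x]; first by rewrite s'_scale conj_realc.
apply: act_single; have := s'_adm h.
by rewrite (_ : map_mx s' _ = const_mx (s' (t%:C%C *: v))) //; apply/matrixP => i j; rewrite !mxE.
Qed.

Lemma bop_rep_map v : bounded_operators (rep_map v).
Proof. by apply: bop_doubled; [exact: blm_s | exact: blm_s']. Qed.

Lemma rep_map_linear : linear rep_map.
Proof.
move=> a v w.
have sE : lift (act (s (a *: v + w))) = (fun m => a *: lift (act (s v)) m + lift (act (s w)) m).
  by apply/funext => m; rewrite -lift_lincomb //; congr (lift _ m); apply/funext => x; exact: s_linear.
have sE' : lift (act (s' (a *: v + w))) = (fun m => Num.conj a *: lift (act (s' v)) m + lift (act (s' w)) m).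
  by apply/funext => m; rewrite -lift_lincomb //; congr (lift _ m); apply/funext => x; exact: s'_linear.
have [hs hs'] := (blm_s (a *: v + w), blm_s' (a *: v + w)).
rewrite sE in hs; rewrite sE' in hs'.
by rewrite /rep_map sE sE' doubled_lincomb //; [exact: blm_s | exact: blm_s' | exact: blm_s | exact: blm_s'].
Qed.

Lemma rep_map_small n (x : 'M[V]_n) : nV x <= 1 / 4 -> operator_mxnorm (map_mx rep_map x) <= 1.
Proof.
move=> hx.
have -> : map_mx rep_map x = \matrix_(i, j) doubled (lift (act (s (x i j)))) (lift (act (s' (x i j)))).
  by apply/matrixP => i j; rewrite !mxE.
apply: (@doubled_contraction R E n (fun i j => lift (act (s (x i j)))) (fun i j => lift (act (s' (x i j))))) => [i j|i j|y|y].
- exact: blm_s.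
- exact: blm_s'.
- have := lift_act y (s_adm hx); apply: le_trans; apply: ler_sum => i _.
  by rewrite [X in _ <= q X](eq_bigr (fun j => lift (act (s (x i j))) (y j))) // => j _; rewrite mxE.
- have := lift_act y (s'_adm hx); apply: le_trans; apply: ler_sum => i _.
  by rewrite [X in _ <= q X](eq_bigr (fun j => lift (act (s' (x j i))) (y j))) // => j _; rewrite !mxE.
Qed.

Lemma rep_map_upper n (x : 'M[V]_n) : operator_mxnorm (map_mx rep_map x) <= 4 * nV x.
Proof.
(* The summand [d] keeps the scaling factor [c] positive when the norm of [x] is 0. *)
apply: ler_of_addgt0 => d d0; pose c := 4 * nV x + d.
have c0 : 0 < c by rewrite ltr_wpDl // mulr_ge0 // (mn_ge0 NV).
have ci : 0 <= c^-1 by rewrite invr_ge0 ltW.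
have := @rep_map_small n (map_mx ( *:%R (c^-1)%:C%C) x) _; rewrite -/c.
have -> : map_mx rep_map (map_mx ( *:%R (c^-1)%:C%C) x) = map_mx ( *:%R (c^-1)%:C%C) (map_mx rep_map x).
  apply/matrixP => i j; rewrite !mxE.
  by rewrite -[_ *: x i j]addr0 rep_map_linear -[rep_map 0]addr0 -{1}[rep_map 0]scale1r -[RHS]addr0; congr (_ + _);
     have := rep_map_linear 1 0 0; rewrite !scale1r addr0 => h; apply: (@addrI _ (rep_map 0)); rewrite -h !addr0.
rewrite opnormZ; last by move=> i j; rewrite mxE; exact: bop_rep_map.
rewrite rnorm_real ger0_norm // ler_pdivrMl // mulr1 => h; apply: h.
rewrite (le_trans (mn_real NV _ ci)) // ler_pdivrMl // /c; move: (nV x) => t; lra.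
Qed.

Lemma rep_map_lower n (x : 'M[V]_n) : nV x <= 4 * operator_mxnorm (map_mx rep_map x).
Proof.
have [z [z1 hz]] := lift_lower (map_mx s x).
have o0 : 0 <= operator_mxnorm (map_mx rep_map x).
  by apply: opnorm_ge0 => i j; rewrite mxE; exact: bop_rep_map.
rewrite -ler_sqr ?nnegrE ?mulr_ge0 ?(mn_ge0 NV) //.
apply: (le_trans (hz _ (mn_ge0 NV x) _)).
  have := s_nu x; rewrite (_ : \matrix_(i, j) _ = \matrix_(i, j) act (map_mx s x i j) e) //.
  by apply/matrixP => i j; rewrite !mxE.
rewrite exprMn (_ : 4 ^+ 2 = 16 :> R); last by ring.
rewrite ler_pM2l //.
have := @doubled_lower R E n (fun i j => lift (act (s (x i j)))) (fun i j => lift (act (s' (x i j)))) z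
  (fun i j => blm_s _) (fun i j => blm_s' _) z1.
have -> : \matrix_(i, j) doubled (lift (act (s (x i j)))) (lift (act (s' (x i j)))) = map_mx rep_map x.
  by apply/matrixP => i j; rewrite !mxE.
apply: le_trans; apply: ler_sum => i _.
by rewrite (eq_bigr (fun j => lift (act (s (x i j))) (z j))) // => j _; rewrite mxE.
Qed.

Lemma lift_corner (phi : X -> X) c c' : linear phi -> (forall x, p c (phi (p c' x)) = phi x) ->
  lift (p c) \o (lift phi \o lift (p c')) = lift phi.
Proof.
move=> pl h; apply/funext => m /=; rewrite lift_comp // lift_comp //; last by move=> a x y /=; rewrite pl p_linear.
by congr (lift _ m); apply/funext => x /=; rewrite h.
Qed.

Lemma rep_map_corner v : rep_projection b \o rep_map v \o rep_projection b' = rep_map v.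
Proof.
have [bs bs'] := (blm_s v, blm_s' v).
have [bp bp'] := (blm_p b, blm_p b').
have := doubled_corner bp bs bs' bp'.
rewrite (lift_corner (act_linear (s v)) (s_corner v)) (lift_corner (act_linear (s' v)) (s'_corner v)).
exact.
Qed.

Lemma rep_map_embedding : corner_embedding (rep_projection b) (rep_projection b') nV rep_map.
Proof.
split.
- exact: rep_map_linear.
- exact: bop_rep_map.
- exact: rep_map_corner.
- exact: rep_map_upper.
- exact: rep_map_lower.
Qed.

End Family.
End Representation.

(** * Representation of correspondences *)

Section LinearMaps.
Variables (A : pzRingType) (V W : lmodType A) (f : V -> W).
Hypothesis fl : linear f.

Lemma lin_add x y : f (x + y) = f x + f y.
Proof. by have := fl 1 x y; rewrite !scale1r. Qed.

Lemma lin_zero : f 0 = 0.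
Proof. by have := lin_add 0 0; rewrite addr0 => h; apply: (@addrI _ (f 0)); rewrite -h addr0. Qed.

Lemma lin_scale a x : f (a *: x) = a *: f x.
Proof. by have := fl a x 0; rewrite !addr0 lin_zero addr0. Qed.

End LinearMaps.

Record corner_representation (R : realType) (C D Y : lmodType R[i])
    (nC : forall n, 'M[C]_n -> R) (nD : forall n, 'M[D]_n -> R) (nY : forall n, 'M[Y]_n -> R)
    (cm : C -> C -> C) (dm : D -> D -> D) (la : C -> Y -> Y) (ra : Y -> D -> Y) (pr : Y -> Y -> D)
    (sc : C -> C) (sd : D -> D) (H : hilbert R) (U P : H -> H)
    (alpha : C -> H -> H) (beta : D -> H -> H) (phi : Y -> H -> H) : Prop := {
  cr_selfadjoint : selfadjoint U;
  cr_unitary : unitary U;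
  cr_projection : orthogonal_projection P;
  cr_commute : P \o U = U \o P;
  cr_alpha : corner_embedding P P nC alpha;
  cr_beta : corner_embedding (complement P) (complement P) nD beta;
  cr_phi : corner_embedding P (complement P) nY phi;
  cr_alphaM : forall c c', alpha (cm c c') = alpha c \o alpha c';
  cr_betaM : forall d d', beta (dm d d') = beta d \o beta d';
  cr_la : forall c y, phi (la c y) = alpha c \o phi y;
  cr_ra : forall y d, phi (ra y d) = phi y \o beta d;
  cr_pr : forall x y, beta (pr x y) = dagger U (phi x) \o phi y;
  cr_sc : forall c, dagger U (alpha c) = alpha (sc c);
  cr_sd : forall d, dagger U (beta d) = beta (sd d) }.

Section FiveTermSums.
Variable R : realType.
Implicit Types a b c d f : R.

(** The five summands of these inequalities are the components of [corr_norm]; they are stated for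
    bare reals so that [lra] meets no matrix norms. *)
Lemma add5_le a b c d f a1 b1 c1 d1 f1 a2 b2 c2 d2 f2 :
  a <= a1 + a2 -> b <= b1 + b2 -> c <= c1 + c2 -> d <= d1 + d2 -> f <= f1 + f2 ->
  a + b + c + (d + f) <= a1 + b1 + c1 + (d1 + f1) + (a2 + b2 + c2 + (d2 + f2)).
Proof. lra. Qed.

Lemma le5 a b c d f a1 b1 c1 d1 f1 : a <= a1 -> b <= b1 -> c <= c1 -> d <= d1 -> f <= f1 ->
  a + b + c + (d + f) <= a1 + b1 + c1 + (d1 + f1).
Proof. lra. Qed.

Lemma scale5_le t a b c d f a1 b1 c1 d1 f1 :
  a <= t * a1 -> b <= t * b1 -> c <= t * c1 -> d <= t * d1 -> f <= t * f1 ->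
  a + b + c + (d + f) <= t * (a1 + b1 + c1 + (d1 + f1)).
Proof. by rewrite !mulrDr; exact: le5. Qed.

Lemma half5_le a b c d f a1 b1 d1 : 0 <= b -> 0 <= c -> 0 <= f ->
  a1 <= a / 4 + d / 4 + f / 4 -> b1 <= b / 4 + c / 4 -> d1 <= a / 4 + d / 4 + f / 4 ->
  a1 + b1 + 0 + (d1 + 0) <= (a + b + c + (d + f)) / 2.
Proof. lra. Qed.

Lemma two_units_le a b c d f : a = 0 -> b = 0 -> c <= 1 -> d = 0 -> f <= 1 -> a + b + c + (d + f) <= 2.
Proof. by move=> -> -> ? -> ?; lra. Qed.

Lemma summands_le a b c d f : 0 <= a -> 0 <= b -> 0 <= c -> 0 <= d -> 0 <= f ->
  [/\ a <= a + b + c + (d + f), b <= a + b + c + (d + f) & d <= a + b + c + (d + f)].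
Proof. by move=> *; split; lra. Qed.

Lemma quarter_le a b c : 0 <= b -> a <= 1 / 4 -> c <= a * b -> c <= b / 4.
Proof. by move=> b0 a4 ab; apply: (le_trans ab); rewrite mulrC ler_wpM2l //; lra. Qed.

Lemma scaled_quarter_le a c t : 0 < t -> a <= t -> c <= (4 * t)^-1 * a -> c <= 1 / 4.
Proof.
move=> t0 h hc; apply: (le_trans hc); rewrite ler_pdivrMl ?mulr_gt0 //; lra.
Qed.

Lemma sum3_ge a b c : 0 <= a -> 0 <= b -> 0 <= c ->
  [/\ 0 < a + b + c + 1, a <= a + b + c + 1, b <= a + b + c + 1 & c <= a + b + c + 1].
Proof. by move=> *; split; lra. Qed.

End FiveTermSums.

Section TotalCorrespondence.
Variables (R : realType) (C D Y : lmodType R[i]).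
Variables (nC : forall n, 'M[C]_n -> R) (nD : forall n, 'M[D]_n -> R) (nY : forall n, 'M[Y]_n -> R).
Arguments nC {n}. Arguments nD {n}. Arguments nY {n}.
Hypotheses (NC : matrix_norm (@nC)) (ND : matrix_norm (@nD)) (NY : matrix_norm (@nY)).
Variables (cm : C -> C -> C) (dm : D -> D -> D) (la : C -> Y -> Y) (ra : Y -> D -> Y) (pr : Y -> Y -> D).
Variables (sc : C -> C) (sd : D -> D).
Hypotheses (cml : forall y, linear (cm^~ y)) (cmr : forall x, linear (cm x)).
Hypotheses (dml : forall y, linear (dm^~ y)) (dmr : forall x, linear (dm x)).
Hypotheses (lal : forall y, linear (la^~ y)) (lar : forall x, linear (la x)).
Hypotheses (ral : forall y, linear (ra^~ y)) (rar : forall x, linear (ra x)).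
Hypothesis (prr : forall x, linear (pr x)).
Hypothesis cmA : forall x y z, cm x (cm y z) = cm (cm x y) z.
Hypothesis dmA : forall x y z, dm x (dm y z) = dm (dm x y) z.
Hypothesis laA : forall a b x, la (cm a b) x = la a (la b x).
Hypothesis raA : forall x b c, ra x (dm b c) = ra (ra x b) c.
Hypothesis laraA : forall a x b, la a (ra x b) = ra (la a x) b.
Hypothesis pr_ra : forall x y b, pr x (ra y b) = dm (pr x y) b.
Hypothesis pr_conj : forall x y, pr x y = sd (pr y x).
Hypothesis pr_la : forall a x y, pr (la a x) y = pr x (la (sc a) y).
Hypothesis sc_lin : forall a x y, sc (a *: x + y) = Num.conj a *: sc x + sc y.
Hypothesis sd_lin : forall a x y, sd (a *: x + y) = Num.conj a *: sd x + sd y.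
Hypothesis scM : forall x y, sc (cm x y) = cm (sc y) (sc x).
Hypothesis sdM : forall x y, sd (dm x y) = dm (sd y) (sd x).
Hypotheses (scK : forall x, sc (sc x) = x) (sdK : forall x, sd (sd x) = x).
Hypothesis cm_norm : forall n (x y : 'M_n), nC (mulmx_by cm x y) <= nC x * nC y.
Hypothesis dm_norm : forall n (x y : 'M_n), nD (mulmx_by dm x y) <= nD x * nD y.
Hypothesis la_norm : forall n (x y : 'M_n), nY (mulmx_by la x y) <= nC x * nY y.
Hypothesis ra_norm : forall n (x y : 'M_n), nY (mulmx_by ra x y) <= nY x * nD y.
Hypothesis pr_norm : forall n (x y : 'M_n), nD (mulmx_by pr x^T y) <= nY x * nY y.
Hypothesis sc_norm : forall n (x : 'M_n), nC (map_mx sc x^T) = nC x.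
Hypothesis sd_norm : forall n (x : 'M_n), nD (map_mx sd x^T) = nD x.

Local Notation X := ((Y * C * R[i]^o) * (D * R[i]^o))%type.
Local Notation S := (C * Y * Y * D)%type.
Local Notation sn := scalar_mxnorm.
Local Notation sC s := (s.1.1.1).
Local Notation sY s := (s.1.1.2).
Local Notation sZ s := (s.1.2).
Local Notation sD s := (s.2).

Lemma pr_conjlinear a x y z : pr (a *: x + y) z = Num.conj a *: pr x z + pr y z.
Proof. by rewrite pr_conj prr sd_lin -!pr_conj. Qed.

(* The element [(c, y, z, d)] stands for the matrix [[c, y], [z^*, d]], which
   acts on the two column modules [Y + (C + complex numbers)] and [D + complex numbers]. *)
Definition corr_act (s : S) (x : X) : X :=
  ((la (sC s) x.1.1.1 + ra (sY s) x.2.1 + (x.2.2 : R[i]) *: sY s, cm (sC s) x.1.1.2 + (x.1.2 : R[i]) *: sC s, 0),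
   (pr (sZ s) x.1.1.1 + dm (sD s) x.2.1 + (x.2.2 : R[i]) *: sD s, 0)).

Definition corr_proj (b : bool) (x : X) : X := if b then (x.1, 0) else (0, x.2).
(** Applying (c, y, z, d) to this vector gives back y, c and d. The entry z is lost, but it only
    occurs as the formal adjoint of a y, whose own norm is recovered. *)
Definition corr_e : X := ((0, 0, 1), (0, 1)).

(* Each component of [x] enters at most two components of [corr_act s x], so entries of
   norm at most 1/4 make the action halve [corr_norm]. *)
Definition corr_adm r (s : 'M[S]_r) : Prop :=
  [/\ nC (map_mx (fun s => sC s) s) <= 1 / 4, nY (map_mx (fun s => sY s) s) <= 1 / 4,
      nY (map_mx (fun s => sZ s) s)^T <= 1 / 4 & nD (map_mx (fun s => sD s) s) <= 1 / 4].

Definition xY (x : X) : Y := x.1.1.1.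
Definition xC (x : X) : C := x.1.1.2.
Definition xL (x : X) : R[i] := x.1.2.
Definition xD (x : X) : D := x.2.1.
Definition xM (x : X) : R[i] := x.2.2.

(** A plain sum over the components, so that all estimates split; [corr_e] consists of its two
    scalar components, whence the bound 2 in [corr_norm_e]. *)
Definition corr_norm n (x : 'M[X]_n) : R :=
  nY (map_mx xY x) + nC (map_mx xC x) + sn (map_mx xL x) + (nD (map_mx xD x) + sn (map_mx xM x)).

Definition elC (c : C) : S := (c, 0, 0, 0).
Definition elY (y : Y) : S := (0, y, 0, 0).
Definition elZ (y : Y) : S := (0, 0, y, 0).
Definition elD (d : D) : S := (0, 0, 0, d).

Lemma corr_ext (x y : X) : xY x = xY y -> xC x = xC y -> xL x = xL y ->
  xD x = xD y -> xM x = xM y -> x = y.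
Proof. by rewrite /xY /xC /xL /xD /xM; case: x y => [[[? ?] ?] [? ?]] [[[? ?] ?] [? ?]] /= -> -> -> -> ->. Qed.

Let la0 y : la 0 y = 0. Proof. exact: (lin_zero (lal y)). Qed.
Let ra0 d : ra 0 d = 0. Proof. exact: (lin_zero (ral d)). Qed.
Let cm0 c : cm 0 c = 0. Proof. exact: (lin_zero (cml c)). Qed.
Let dm0 d : dm 0 d = 0. Proof. exact: (lin_zero (dml d)). Qed.
Let pr0 y : pr 0 y = 0.
Proof.
have := pr_conjlinear 1 0 0 y; rewrite rmorph1 !scale1r addr0 => h.
by apply: (@addrI _ (pr 0 y)); rewrite -h addr0.
Qed.
Let la0r c : la c 0 = 0. Proof. exact: (lin_zero (lar c)). Qed.
Let ra0r y : ra y 0 = 0. Proof. exact: (lin_zero (rar y)). Qed.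
Let cm0r c : cm c 0 = 0. Proof. exact: (lin_zero (cmr c)). Qed.
Let dm0r d : dm d 0 = 0. Proof. exact: (lin_zero (dmr d)). Qed.
Let pr0r y : pr y 0 = 0. Proof. exact: (lin_zero (prr y)). Qed.

Lemma act_elC c (x : X) : corr_act (elC c) x = ((la c x.1.1.1, cm c x.1.1.2 + (x.1.2 : R[i]) *: c, 0), (0, 0)).
Proof. by apply: corr_ext; rewrite /xY /xC /xL /xD /xM /= ?ra0 ?pr0 ?dm0 ?scaler0 ?addr0. Qed.

Lemma act_elY y (x : X) : corr_act (elY y) x = ((ra y x.2.1 + (x.2.2 : R[i]) *: y, 0, 0), (0, 0)).
Proof. by apply: corr_ext; rewrite /xY /xC /xL /xD /xM /= ?la0 ?cm0 ?pr0 ?dm0 ?scaler0 ?addr0 ?add0r. Qed.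

Lemma act_elZ y (x : X) : corr_act (elZ y) x = ((0, 0, 0), (pr y x.1.1.1, 0)).
Proof. by apply: corr_ext; rewrite /xY /xC /xL /xD /xM /= ?la0 ?cm0 ?ra0 ?dm0 ?scaler0 ?addr0 ?add0r. Qed.

Lemma act_elD d (x : X) : corr_act (elD d) x = ((0, 0, 0), (dm d x.2.1 + (x.2.2 : R[i]) *: d, 0)).
Proof. by apply: corr_ext; rewrite /xY /xC /xL /xD /xM /= ?la0 ?cm0 ?ra0 ?pr0 ?scaler0 ?addr0 ?add0r. Qed.

Lemma lincomb3 (V : lmodType R[i]) a (x x' y y' z z' : V) :
  (a *: x + x') + (a *: y + y') + (a *: z + z') = a *: (x + y + z) + (x' + y' + z').
Proof. by rewrite !scalerDr [X in X + (a *: z + _)]addrACA [LHS]addrACA. Qed.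

Lemma lincombZ (V : lmodType R[i]) a (m m' : R[i]) (y : V) : (a * m + m') *: y = a *: (m *: y) + m' *: y.
Proof. by rewrite scalerDl scalerA. Qed.

Lemma shifted_linear (V W : lmodType R[i]) (f g : V -> W) (m : R[i]) a v w : linear f -> linear g ->
  f (a *: v + w) + m *: g (a *: v + w) = a *: (f v + m *: g v) + (f w + m *: g w).
Proof. by move=> fl gl; rewrite fl gl !scalerDr addrACA !scalerA mulrC. Qed.

Lemma corr_act_linear s : linear (corr_act s).
Proof.
move=> a x y; apply: corr_ext.
- by rewrite -[RHS]lincomb3 -lincombZ -lar -rar.
- rewrite -[RHS]/(a *: (cm (sC s) x.1.1.2 + (x.1.2 : R[i]) *: sC s) + (cm (sC s) y.1.1.2 + (y.1.2 : R[i]) *: sC s)).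
  by rewrite scalerDr addrACA -lincombZ -cmr.
- by rewrite -[RHS]/(a * 0 + 0) mulr0 addr0.
- by rewrite -[RHS]lincomb3 -lincombZ -prr -dmr.
- by rewrite -[RHS]/(a * 0 + 0) mulr0 addr0.
Qed.

Lemma corr_act0 x : corr_act 0 x = 0.
Proof. by apply: corr_ext; rewrite /xY /xC /xL /xD /xM /= ?la0 ?cm0 ?ra0 ?pr0 ?dm0 ?scaler0 ?addr0. Qed.

Lemma corr_proj_linear b : linear (corr_proj b).
Proof.
by case: b => a x y; apply: corr_ext => //=; rewrite -[RHS]/(a *: 0 + 0) scaler0 addr0.
Qed.

Lemma corr_proj_proj b b' x : corr_proj b (corr_proj b' x) = if b == b' then corr_proj b x else 0.
Proof. by case: b; case: b'. Qed.

Lemma corr_proj_sum x : corr_proj true x + corr_proj false x = x.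
Proof. by apply: corr_ext; rewrite -1?[LHS]/(_ + 0) -1?[LHS]/(0 + _) ?addr0 ?add0r. Qed.

Section Sums.
Variables (I : finType) (F : I -> X).

Lemma xY_sum : xY (\sum_i F i) = \sum_i xY (F i). Proof. exact: (big_morph xY). Qed.
Lemma xC_sum : xC (\sum_i F i) = \sum_i xC (F i). Proof. exact: (big_morph xC). Qed.
Lemma xL_sum : xL (\sum_i F i) = \sum_i xL (F i). Proof. exact: (big_morph xL). Qed.
Lemma xD_sum : xD (\sum_i F i) = \sum_i xD (F i). Proof. exact: (big_morph xD). Qed.
Lemma xM_sum : xM (\sum_i F i) = \sum_i xM (F i). Proof. exact: (big_morph xM). Qed.

End Sums.

Lemma map_block0 (V W : nmodType) (f : V -> W) m n (x : 'M_m) (y : 'M_n) : f 0 = 0 ->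
  map_mx f (block_mx x 0 0 y) = block_mx (map_mx f x) 0 0 (map_mx f y).
Proof.
move=> f0; rewrite map_block_mx; congr block_mx; apply/matrixP => i j; rewrite !mxE //.
Qed.

Lemma corr_adm0 r : corr_adm (0 : 'M[S]_r).
Proof.
have h0 (V : nmodType) (f : S -> V) : f 0 = 0 -> map_mx f (0 : 'M_r) = 0.
  by move=> f0; apply/matrixP => i j; rewrite !mxE.
by split; rewrite h0 ?trmx0 ?(mn_0 NC) ?(mn_0 NY) ?(mn_0 ND) ?divr_ge0.
Qed.

Lemma corr_adm_block r r' (s : 'M[S]_r) (s' : 'M[S]_r') : corr_adm s -> corr_adm s' -> corr_adm (block_mx s 0 0 s').
Proof.
move=> [h1 h2 h3 h4] [h1' h2' h3' h4'].
by split; rewrite map_block0 // ?tr_block_mx ?trmx0 (mn_dsum NC, mn_dsum NY, mn_dsum ND) ge_max; apply/andP.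
Qed.

Lemma map_mx_add (V W : nmodType) (f : V -> W) n (x y : 'M[V]_n) : (forall x y, f (x + y) = f x + f y) ->
  map_mx f (x + y) = map_mx f x + map_mx f y.
Proof. by move=> fD; apply/matrixP => i j; rewrite !mxE fD. Qed.

Lemma corr_normD n (x y : 'M[X]_n) : corr_norm (x + y) <= corr_norm x + corr_norm y.
Proof.
rewrite /corr_norm (map_mx_add (f := xY)) // (map_mx_add (f := xC)) // (map_mx_add (f := xL)) //.
rewrite (map_mx_add (f := xD)) // (map_mx_add (f := xM)) //.
by apply: add5_le; [exact: (mn_D NY) | exact: (mn_D NC) | exact: scalar_mxnormD | exact: (mn_D ND) | exact: scalar_mxnormD].
Qed.

Lemma corr_norm_scale n t (x : 'M[X]_n) : 0 <= t -> corr_norm (map_mx ( *:%R t%:C%C) x) <= t * corr_norm x.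
Proof.
move=> t0; rewrite /corr_norm.
have e (V : lmodType R[i]) (f : X -> V) : (forall x, f (t%:C%C *: x) = t%:C%C *: f x) ->
    map_mx f (map_mx ( *:%R t%:C%C) x) = map_mx ( *:%R t%:C%C) (map_mx f x).
  by move=> h; apply/matrixP => i j; rewrite !mxE h.
have es (f : X -> R[i]) : (forall x, f (t%:C%C *: x) = t%:C%C * f x) ->
    sn (map_mx f (map_mx ( *:%R t%:C%C) x)) <= t * sn (map_mx f x).
  move=> h; have -> : map_mx f (map_mx ( *:%R t%:C%C) x) = t%:C%C%:M *m map_mx f x.
    by rewrite mul_scalar_mx; apply/matrixP => i j; rewrite !mxE h.
  by rewrite (le_trans (scalar_mxnormM _ _)) // ler_wpM2r ?scalar_mxnorm_ge0 // scalar_mxnorm_scalar.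
rewrite (e _ xY) // (e _ xC) // (e _ xD) //.
by apply: scale5_le; [exact: (mn_real NY) | exact: (mn_real NC) | exact: es | exact: (mn_real ND) | exact: es].
Qed.

Lemma corr_norm_pad r n (x : 'M[X]_(r, n)) (y : 'M[X]_n) : corr_norm y <= corr_norm (block_mx 0 x 0 y).
Proof.
have e (V : nmodType) (f : X -> V) : f 0 = 0 ->
    map_mx f (block_mx (0 : 'M_r) x (0 : 'M_(n, r)) y) = block_mx 0 (map_mx f x) 0 (map_mx f y).
  by move=> f0; rewrite map_block_mx; congr block_mx; apply/matrixP => i j; rewrite !mxE.
rewrite /corr_norm (e _ xY) // (e _ xC) // (e _ xL) // (e _ xD) // (e _ xM) //.
by apply: le5; [exact: (mn_pad NY) | exact: (mn_pad NC) | exact: scalar_mxnorm_pad | exact: (mn_pad ND) | exact: scalar_mxnorm_pad].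
Qed.

Lemma corr_norm_e r n : corr_norm (block_mx (0 : 'M[X]_r) 0 0 (e_mx corr_e n)) <= 2.
Proof.
have z (V : nmodType) (f : X -> V) : f 0 = 0 -> f corr_e = 0 ->
    map_mx f (block_mx (0 : 'M[X]_r) 0 0 (e_mx corr_e n)) = 0.
  move=> f0 fe; rewrite map_block0 //; apply/matrixP => i j.
  by case: (split_ordP i) => i' ->; case: (split_ordP j) => j' ->;
    rewrite ?block_mxEul ?block_mxEur ?block_mxEdl ?block_mxEdr !mxE // (fun_if f) f0 fe if_same.
have o (f : X -> R[i]) : f 0 = 0 -> f corr_e = 1 ->
    sn (map_mx f (block_mx (0 : 'M[X]_r) 0 0 (e_mx corr_e n))) <= 1.
  move=> f0 fe; rewrite map_block0 //.
  have -> : map_mx f (0 : 'M_r) = 0 by apply/matrixP => i j; rewrite !mxE.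
  have -> : map_mx f (e_mx corr_e n) = 1%:M.
    by apply/matrixP => i j; rewrite !mxE (fun_if f) f0 fe; case: eqP.
  by apply: scalar_mxnorm_le1; exact: corner_mx_contraction.
have oL := o xL erefl erefl; have oM := o xM erefl erefl.
apply: (two_units_le _ _ oL _ oM).
- by rewrite (z _ xY erefl erefl); exact: (mn_0 NY).
- by rewrite (z _ xC erefl erefl); exact: (mn_0 NC).
- by rewrite (z _ xD erefl erefl); exact: (mn_0 ND).
Qed.

Lemma corr_norm_contraction n (u : bool -> 'M[R[i]]_n) (x : 'M[X]_n) :
  (forall b (c : 'cV_n), l2sq (u b *m c) <= l2sq c) ->
  corr_norm (\matrix_(i, j) (\sum_k u true i k *: corr_proj true (x k j) + \sum_k u false i k *: corr_proj false (x k j)))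
    <= corr_norm x.
Proof.
move=> uc; set M := \matrix_(i, j) _.
have EY : map_mx xY M = mulmx_by *:%R (u true) (map_mx xY x).
  apply/matrixP => i j; rewrite !mxE -[LHS]/(xY _ + xY _) !xY_sum.
  rewrite [X in _ + X]big1 ?addr0 => [|k _]; last exact: scaler0.
  by apply: eq_bigr => k _; rewrite mxE.
have EC : map_mx xC M = mulmx_by *:%R (u true) (map_mx xC x).
  apply/matrixP => i j; rewrite !mxE -[LHS]/(xC _ + xC _) !xC_sum.
  rewrite [X in _ + X]big1 ?addr0 => [|k _]; last exact: scaler0.
  by apply: eq_bigr => k _; rewrite mxE.
have ED : map_mx xD M = mulmx_by *:%R (u false) (map_mx xD x).
  apply/matrixP => i j; rewrite !mxE -[LHS]/(xD _ + xD _) !xD_sum.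
  rewrite [X in X + _]big1 ?add0r => [|k _]; last exact: scaler0.
  by apply: eq_bigr => k _; rewrite mxE.
have EL : map_mx xL M = u true *m map_mx xL x.
  apply/matrixP => i j; rewrite !mxE -[LHS]/(xL _ + xL _) !xL_sum.
  rewrite [X in _ + X]big1 ?addr0 => [|k _]; last exact: mulr0.
  by apply: eq_bigr => k _; rewrite mxE.
have EM : map_mx xM M = u false *m map_mx xM x.
  apply/matrixP => i j; rewrite !mxE -[LHS]/(xM _ + xM _) !xM_sum.
  rewrite [X in X + _]big1 ?add0r => [|k _]; last exact: mulr0.
  by apply: eq_bigr => k _; rewrite mxE.
have sc1 b (y : 'M_n) : sn (u b *m y) <= sn y.
  by rewrite (le_trans (scalar_mxnormM _ _)) // ler_piMl ?scalar_mxnorm_ge0 // scalar_mxnorm_le1.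
by rewrite /corr_norm EY EC ED EL EM; apply: le5; [exact: (mn_contraction NY) | exact: (mn_contraction NC) | exact: sc1 | exact: (mn_contraction ND) | exact: sc1].
Qed.

Lemma corr_norm_act n (s : 'M[S]_n) (x : 'M[X]_n) : corr_adm s -> corr_norm (mulmx_by corr_act s x) <= corr_norm x / 2.
Proof.
move=> [hC hY hZ hD].
pose rs (V : lmodType R[i]) := mulmx_by (fun v (a : R[i]) => a *: (v : V)).
have EY : map_mx xY (mulmx_by corr_act s x) =
    mulmx_by la (map_mx (fun s => sC s) s) (map_mx xY x) + mulmx_by ra (map_mx (fun s => sY s) s) (map_mx xD x)
    + rs _ _ _ _ (map_mx (fun s => sY s) s) (map_mx xM x).
  apply/matrixP => i j; rewrite !mxE xY_sum -!big_split /=.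
  by apply: eq_bigr => k _; rewrite !mxE.
have EC : map_mx xC (mulmx_by corr_act s x) =
    mulmx_by cm (map_mx (fun s => sC s) s) (map_mx xC x) + rs _ _ _ _ (map_mx (fun s => sC s) s) (map_mx xL x).
  apply/matrixP => i j; rewrite !mxE xC_sum -!big_split /=.
  by apply: eq_bigr => k _; rewrite !mxE.
(* The double transpose matches [pr_norm], whose first argument is transposed; for the same reason
   [corr_adm] bounds the transpose of the z entries. *)
have ED : map_mx xD (mulmx_by corr_act s x) =
    mulmx_by pr (map_mx (fun s => sZ s) s)^T^T (map_mx xY x) + mulmx_by dm (map_mx (fun s => sD s) s) (map_mx xD x)
    + rs _ _ _ _ (map_mx (fun s => sD s) s) (map_mx xM x).
  apply/matrixP => i j; rewrite !mxE xD_sum -!big_split /=.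
  by apply: eq_bigr => k _; rewrite !mxE.
have EL : map_mx xL (mulmx_by corr_act s x) = 0 by apply/matrixP => i j; rewrite !mxE xL_sum big1.
have EM : map_mx xM (mulmx_by corr_act s x) = 0 by apply/matrixP => i j; rewrite !mxE xM_sum big1.
rewrite /corr_norm EY EC ED EL EM !scalar_mxnorm0.
have q := @quarter_le R.
have hla := q _ _ _ (mn_ge0 NY _) hC (la_norm _ (map_mx xY x)).
have hra := q _ _ _ (mn_ge0 ND _) hY (ra_norm _ (map_mx xD x)).
have hYM := q _ _ _ (scalar_mxnorm_ge0 _) hY (mn_right NY _ (map_mx xM x)).
have hcm := q _ _ _ (mn_ge0 NC _) hC (cm_norm _ (map_mx xC x)).
have hCL := q _ _ _ (scalar_mxnorm_ge0 _) hC (mn_right NC _ (map_mx xL x)).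
have hpr := q _ _ _ (mn_ge0 NY _) hZ (pr_norm _ (map_mx xY x)).
have hdm := q _ _ _ (mn_ge0 ND _) hD (dm_norm _ (map_mx xD x)).
have hDM := q _ _ _ (scalar_mxnorm_ge0 _) hD (mn_right ND _ (map_mx xM x)).
have tY := le_trans (mn_D NY _ _) (lerD (le_trans (mn_D NY _ _) (lerD hla hra)) hYM).
have tC := le_trans (mn_D NC _ _) (lerD hcm hCL).
have tD := le_trans (mn_D ND _ _) (lerD (le_trans (mn_D ND _ _) (lerD hpr hdm)) hDM).
by apply: half5_le tY tC tD; [exact: (mn_ge0 NC) | exact: scalar_mxnorm_ge0 | exact: scalar_mxnorm_ge0].
Qed.

Lemma corr_cyclic x : exists (s : S) (d : R[i]) (l : bool -> R[i]), corr_adm (const_mx s : 'M_1) /\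
  x = d *: corr_act s corr_e + (l true *: corr_proj true corr_e + l false *: corr_proj false corr_e).
Proof.
pose y1 := nY (const_mx (xY x) : 'M_1); pose c1 := nC (const_mx (xC x) : 'M_1); pose d1 := nD (const_mx (xD x) : 'M_1).
have [T0 hY hC hD] := sum3_ge (mn_ge0 NY _ : 0 <= y1) (mn_ge0 NC _ : 0 <= c1) (mn_ge0 ND _ : 0 <= d1).
pose t := (4 * (y1 + c1 + d1 + 1))^-1.
have t0 : 0 < t by rewrite invr_gt0 mulr_gt0.
(* The components in [Y], [C] and [D] are scaled by [t] to make the element admissible and scaled
   back by the coefficient t^-1; the scalar components come from the projections of [corr_e]. The
   summand 1 in the definition of [t] prevents a division by 0. *)
exists (t%:C%C *: xC x, t%:C%C *: xY x, 0, t%:C%C *: xD x), (t^-1)%:C%C, (fun b => if b then xL x else xM x).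
have cE (V : lmodType R[i]) (f : S -> V) s : map_mx f (const_mx s : 'M_1) = const_mx (f s).
  by apply/matrixP => i j; rewrite !mxE.
have sE (V : lmodType R[i]) (v : V) : const_mx (t%:C%C *: v) = map_mx ( *:%R t%:C%C) (const_mx v) :> 'M_1.
  by apply/matrixP => i j; rewrite !mxE.
split.
  split; rewrite cE /= ?sE.
  - exact: (scaled_quarter_le T0 hC (mn_real NC _ (ltW t0))).
  - exact: (scaled_quarter_le T0 hY (mn_real NY _ (ltW t0))).
  - by rewrite (_ : (const_mx 0)^T = 0) ?(mn_0 NY) ?divr_ge0 //; apply/matrixP => i j; rewrite !mxE.
  - exact: (scaled_quarter_le T0 hD (mn_real ND _ (ltW t0))).
have tt (V : lmodType R[i]) (v : V) : (t^-1)%:C%C *: (t%:C%C *: v) = v.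
  by rewrite scalerA -rmorphM /= mulVf ?scale1r // gt_eqF.
apply: corr_ext.
- rewrite -[RHS]/((t^-1)%:C%C *: (la _ 0 + ra _ 0 + 1 *: (t%:C%C *: xY x)) + (xL x *: 0 + xM x *: 0)).
  by rewrite la0r ra0r !scaler0 !addr0 add0r scale1r tt.
- rewrite -[RHS]/((t^-1)%:C%C *: (cm _ 0 + 1 *: (t%:C%C *: xC x)) + (xL x *: 0 + xM x *: 0)).
  by rewrite cm0r !scaler0 !addr0 add0r scale1r tt.
- by rewrite -[RHS]/((t^-1)%:C%C * 0 + (xL x * 1 + xM x * 0)) !mulr0 mulr1 addr0 add0r.
- rewrite -[RHS]/((t^-1)%:C%C *: (pr _ 0 + dm _ 0 + 1 *: (t%:C%C *: xD x)) + (xL x *: 0 + xM x *: 0)).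
  by rewrite pr0r dm0r !scaler0 !addr0 add0r scale1r tt.
- by rewrite -[RHS]/((t^-1)%:C%C * 0 + (xL x * 0 + xM x * 1)) !mulr0 mulr1 !add0r.
Qed.

Lemma map_mx_const0 (V W : nmodType) (f : V -> W) n (x : 'M[V]_n) : (forall v, f v = 0) -> map_mx f x = 0.
Proof. by move=> f0; apply/matrixP => i j; rewrite !mxE. Qed.

Lemma map_mx_comp (V W Z : Type) (f : V -> W) (g : W -> Z) n (x : 'M[V]_n) :
  map_mx g (map_mx f x) = map_mx (g \o f) x.
Proof. by apply/matrixP => i j; rewrite !mxE. Qed.

Lemma map_mx_self (V : Type) (f : V -> V) n (x : 'M[V]_n) : (forall v, f v = v) -> map_mx f x = x.
Proof. by move=> fE; apply/matrixP => i j; rewrite !mxE. Qed.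

Lemma zero_norm_le (V : lmodType R[i]) (nV : forall n, 'M[V]_n -> R) n : matrix_norm nV -> nV n 0 <= 1 / 4.
Proof. by move=> NV; rewrite (mn_0 NV) divr_ge0. Qed.

Lemma adm_elC n (x : 'M[C]_n) : nC x <= 1 / 4 -> corr_adm (map_mx elC x).
Proof.
move=> h; split; rewrite map_mx_comp; first by rewrite map_mx_self.
- by rewrite map_mx_const0 //; exact: zero_norm_le.
- by rewrite map_mx_const0 // trmx0; exact: zero_norm_le.
- by rewrite map_mx_const0 //; exact: zero_norm_le.
Qed.

Lemma adm_elY n (x : 'M[Y]_n) : nY x <= 1 / 4 -> corr_adm (map_mx elY x).
Proof.
move=> h; split; rewrite map_mx_comp; [|by rewrite map_mx_self| |].
- by rewrite map_mx_const0 //; exact: zero_norm_le.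
- by rewrite map_mx_const0 // trmx0; exact: zero_norm_le.
- by rewrite map_mx_const0 //; exact: zero_norm_le.
Qed.

Lemma adm_elZ n (x : 'M[Y]_n) : nY x <= 1 / 4 -> corr_adm (map_mx elZ x^T).
Proof.
move=> h; split; rewrite map_mx_comp; [| |by rewrite map_mx_self // trmxK|].
- by rewrite map_mx_const0 //; exact: zero_norm_le.
- by rewrite map_mx_const0 //; exact: zero_norm_le.
- by rewrite map_mx_const0 //; exact: zero_norm_le.
Qed.

Lemma adm_elD n (x : 'M[D]_n) : nD x <= 1 / 4 -> corr_adm (map_mx elD x).
Proof.
move=> h; split; rewrite map_mx_comp; [| | |by rewrite map_mx_self].
- by rewrite map_mx_const0 //; exact: zero_norm_le.
- by rewrite map_mx_const0 //; exact: zero_norm_le.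
- by rewrite map_mx_const0 // trmx0; exact: zero_norm_le.
Qed.

Lemma corr_norm_summands n (x : 'M[X]_n) :
  [/\ nY (map_mx xY x) <= corr_norm x, nC (map_mx xC x) <= corr_norm x & nD (map_mx xD x) <= corr_norm x].
Proof.
by apply: summands_le; [exact: (mn_ge0 NY) | exact: (mn_ge0 NC) | exact: scalar_mxnorm_ge0
  | exact: (mn_ge0 ND) | exact: scalar_mxnorm_ge0].
Qed.

Lemma corr_norm_elC n (x : 'M[C]_n) : nC x <= corr_norm (\matrix_(i, j) corr_act (elC (x i j)) corr_e).
Proof.
have [_ h _] := corr_norm_summands (\matrix_(i, j) corr_act (elC (x i j)) corr_e).
apply: le_trans h; rewrite (_ : map_mx _ _ = x) //; apply/matrixP => i j.
by rewrite !mxE act_elC /xC /= cm0r add0r scale1r.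
Qed.

Lemma corr_norm_elY n (x : 'M[Y]_n) : nY x <= corr_norm (\matrix_(i, j) corr_act (elY (x i j)) corr_e).
Proof.
have [h _ _] := corr_norm_summands (\matrix_(i, j) corr_act (elY (x i j)) corr_e).
apply: le_trans h; rewrite (_ : map_mx _ _ = x) //; apply/matrixP => i j.
by rewrite !mxE act_elY /xY /= ra0r add0r scale1r.
Qed.

Lemma corr_norm_elD n (x : 'M[D]_n) : nD x <= corr_norm (\matrix_(i, j) corr_act (elD (x i j)) corr_e).
Proof.
have [_ _ h] := corr_norm_summands (\matrix_(i, j) corr_act (elD (x i j)) corr_e).
apply: le_trans h; rewrite (_ : map_mx _ _ = x) //; apply/matrixP => i j.
by rewrite !mxE act_elD /xD /= dm0r add0r scale1r.
Qed.

Lemma act_elC_linear a v w x : corr_act (elC (a *: v + w)) x = a *: corr_act (elC v) x + corr_act (elC w) x.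
Proof.
rewrite !act_elC; apply: corr_ext.
- exact: lal.
- exact: (@shifted_linear _ _ (cm^~ _) id).
- by rewrite -[RHS]/(a * 0 + 0) mulr0 addr0.
- by rewrite -[RHS]/(a *: 0 + 0) scaler0 addr0.
- by rewrite -[RHS]/(a * 0 + 0) mulr0 addr0.
Qed.

Lemma act_elY_linear a v w x : corr_act (elY (a *: v + w)) x = a *: corr_act (elY v) x + corr_act (elY w) x.
Proof.
rewrite !act_elY; apply: corr_ext.
- exact: (@shifted_linear _ _ (ra^~ _) id).
- by rewrite -[RHS]/(a *: 0 + 0) scaler0 addr0.
- by rewrite -[RHS]/(a * 0 + 0) mulr0 addr0.
- by rewrite -[RHS]/(a *: 0 + 0) scaler0 addr0.
- by rewrite -[RHS]/(a * 0 + 0) mulr0 addr0.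
Qed.

Lemma act_elZ_conjlinear a v w x :
  corr_act (elZ (a *: v + w)) x = Num.conj a *: corr_act (elZ v) x + corr_act (elZ w) x.
Proof.
rewrite !act_elZ; apply: corr_ext.
- by rewrite -[RHS]/(Num.conj a *: 0 + 0) scaler0 addr0.
- by rewrite -[RHS]/(Num.conj a *: 0 + 0) scaler0 addr0.
- by rewrite -[RHS]/(Num.conj a * 0 + 0) mulr0 addr0.
- exact: pr_conjlinear.
- by rewrite -[RHS]/(Num.conj a * 0 + 0) mulr0 addr0.
Qed.

Lemma act_elD_linear a v w x : corr_act (elD (a *: v + w)) x = a *: corr_act (elD v) x + corr_act (elD w) x.
Proof.
rewrite !act_elD; apply: corr_ext.
- by rewrite -[RHS]/(a *: 0 + 0) scaler0 addr0.
- by rewrite -[RHS]/(a *: 0 + 0) scaler0 addr0.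
- by rewrite -[RHS]/(a * 0 + 0) mulr0 addr0.
- exact: (@shifted_linear _ _ (dm^~ _) id).
- by rewrite -[RHS]/(a * 0 + 0) mulr0 addr0.
Qed.

Lemma act_elCC c c' : corr_act (elC c) \o corr_act (elC c') = corr_act (elC (cm c c')).
Proof.
apply/funext => x; rewrite /= !act_elC /= laA scale0r addr0.
by rewrite (lin_add (cmr c)) (lin_scale (cmr c)) -cmA.
Qed.
Lemma act_elCY c y : corr_act (elC c) \o corr_act (elY y) = corr_act (elY (la c y)).
Proof.
apply/funext => x; rewrite /= act_elC !act_elY /= cm0r scale0r addr0.
by rewrite (lin_add (lar c)) (lin_scale (lar c)) laraA.
Qed.

Lemma act_elYD y d : corr_act (elY y) \o corr_act (elD d) = corr_act (elY (ra y d)).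
Proof.
apply/funext => x; rewrite /= act_elD !act_elY /= scale0r addr0.
by rewrite (lin_add (rar y)) (lin_scale (rar y)) raA.
Qed.

Lemma act_elDD d d' : corr_act (elD d) \o corr_act (elD d') = corr_act (elD (dm d d')).
Proof.
apply/funext => x; rewrite /= !act_elD /= scale0r addr0.
by rewrite (lin_add (dmr d)) (lin_scale (dmr d)) -dmA.
Qed.

Lemma act_elZY x y : corr_act (elZ x) \o corr_act (elY y) = corr_act (elD (pr x y)).
Proof.
apply/funext => v; rewrite /= act_elD act_elZ act_elY /=.
by rewrite (lin_add (prr x)) (lin_scale (prr x)) pr_ra.
Qed.

(** [elZ y] stands for y^*, so this identity and the next are the adjoints of [act_elCY] and
    [act_elYD]: y^* c = (c^dagger y)^* and d y^* = (y d^dagger)^*. *)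
Lemma act_elZC y c : corr_act (elZ y) \o corr_act (elC c) = corr_act (elZ (la (sc c) y)).
Proof. by apply/funext => v; rewrite /= !act_elZ act_elC /= pr_la scK. Qed.

Lemma act_elDZ d y : corr_act (elD d) \o corr_act (elZ y) = corr_act (elZ (ra y (sd d))).
Proof.
apply/funext => v; rewrite /= act_elD !act_elZ /= scale0r addr0.
have -> // : pr (ra y (sd d)) v.1.1.1 = dm d (pr y v.1.1.1).
by rewrite pr_conj pr_ra sdM sdK -pr_conj.
Qed.

Theorem total_corner_representation : exists (H : hilbert R) (U P : H -> H) alpha beta phi,
  corner_representation (@nC) (@nD) (@nY) cm dm la ra pr sc sd U P alpha beta phi.
Proof.
have := @exists_semiinner_module R X corr_proj corr_e S corr_act corr_adm corr_norm
  corr_proj_linear corr_proj_proj corr_act_linear corr_act0 corr_adm0 corr_adm_block corr_cyclic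
  corr_normD corr_norm_scale corr_norm_contraction corr_norm_act corr_norm_e corr_norm_pad corr_proj_sum.
move=> [E [lift [ll lc llc li [la_ lp lw]]]].
pose rep (s s' : S) := doubled (lift (corr_act s)) (lift (corr_act s')).
pose P b := rep_projection corr_proj lift b.
(* Each map uses an element together with its formal adjoint; the formal adjoint of a y entry is the
   z entry with the same value. *)
pose alpha := rep_map corr_act lift elC (elC \o sc).
pose beta := rep_map corr_act lift elD (elD \o sd).
pose phi := rep_map corr_act lift elY elZ.
have sCl a v w x : corr_act (elC (sc (a *: v + w))) x =
    Num.conj a *: corr_act (elC (sc v)) x + corr_act (elC (sc w)) x by rewrite sc_lin act_elC_linear.
have sDl a v w x : corr_act (elD (sd (a *: v + w))) x =
    Num.conj a *: corr_act (elD (sd v)) x + corr_act (elD (sd w)) x by rewrite sd_lin act_elD_linear.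
have sCa n (x : 'M[C]_n) : nC x <= 1 / 4 -> corr_adm (map_mx (elC \o sc) x^T).
  by rewrite -sc_norm => /adm_elC; rewrite map_mx_comp.
have sDa n (x : 'M[D]_n) : nD x <= 1 / 4 -> corr_adm (map_mx (elD \o sd) x^T).
  by rewrite -sd_norm => /adm_elD; rewrite map_mx_comp.
have cC v x : corr_proj true (corr_act (elC v) (corr_proj true x)) = corr_act (elC v) x by rewrite !act_elC.
have cD v x : corr_proj false (corr_act (elD v) (corr_proj false x)) = corr_act (elD v) x by rewrite !act_elD.
have cY v x : corr_proj true (corr_act (elY v) (corr_proj false x)) = corr_act (elY v) x by rewrite !act_elY.
have cZ v x : corr_proj false (corr_act (elZ v) (corr_proj true x)) = corr_act (elZ v) x by rewrite !act_elZ.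
pose mk := @rep_map_embedding R X corr_proj corr_e S corr_act corr_adm corr_norm corr_proj_linear
  corr_act_linear E lift ll lc llc la_ lp lw.
have Ea : corner_embedding (P true) (P true) (@nC) alpha.
  exact: (mk C (@nC) NC elC (elC \o sc) true true act_elC_linear sCl adm_elC sCa corr_norm_elC cC (fun v => cC (sc v))).
have Eb : corner_embedding (P false) (P false) (@nD) beta.
  exact: (mk D (@nD) ND elD (elD \o sd) false false act_elD_linear sDl adm_elD sDa corr_norm_elD cD (fun v => cD (sd v))).
have Ep : corner_embedding (P true) (P false) (@nY) phi.
  exact: (mk Y (@nY) NY elY elZ true false act_elY_linear act_elZ_conjlinear adm_elY adm_elZ corr_norm_elY cY cZ).
have bC v : bounded_linear_map (lift (corr_act (elC v))).
  exact: (blm_s corr_act_linear ll llc la_ NC act_elC_linear adm_elC v).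
have bY v : bounded_linear_map (lift (corr_act (elY v))).
  exact: (blm_s corr_act_linear ll llc la_ NY act_elY_linear adm_elY v).
have bD v : bounded_linear_map (lift (corr_act (elD v))).
  exact: (blm_s corr_act_linear ll llc la_ ND act_elD_linear adm_elD v).
have bZ v : bounded_linear_map (lift (corr_act (elZ v))).
  exact: (blm_s' corr_act_linear ll llc la_ NY act_elZ_conjlinear adm_elZ v).
have lcE psi psi' : linear psi -> linear psi' -> lift (psi \o psi') = lift psi \o lift psi'.
  by move=> pl pl'; apply/funext => m; rewrite -(lc _ _ m pl pl').
(* A product of doubled maps composes the elements in order and their formal adjoints in reverse, so
   every multiplicativity claim consists of two identities. *)
have mul (s1 s1' s2 s2' s3 s3' : S) : bounded_linear_map (lift (corr_act s1)) -> bounded_linear_map (lift (corr_act s1')) ->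
    bounded_linear_map (lift (corr_act s2)) -> bounded_linear_map (lift (corr_act s2')) ->
    corr_act s1 \o corr_act s2 = corr_act s3 -> corr_act s2' \o corr_act s1' = corr_act s3' ->
    rep s3 s3' = rep s1 s1' \o rep s2 s2'.
  move=> b1 b1' b2 b2' e e'; rewrite /rep (doubled_comp b1 b1' b2 b2') -e -e'.
  by rewrite !(lcE _ _ (corr_act_linear _) (corr_act_linear _)).
exists (prod_hilbert (dual_hilbert E) (dual_hilbert E)), (@swap R _), (P true), alpha, beta, phi.
have PC : complement (P true) = P false := complement_rep_projection corr_proj_linear corr_proj_sum ll llc li lp.
split; rewrite ?PC.
- exact: adjoint_swap.
- exact: unitary_swap.
- exact: (orthogonal_rep_projection corr_proj_linear corr_proj_proj ll lc lp).
- exact: (rep_projection_swap corr_proj_linear corr_proj_proj ll lc lp).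
- exact: Ea.
- exact: Eb.
- exact: Ep.
- move=> c c'; apply: (mul (elC c) (elC (sc c)) (elC c') (elC (sc c')) (elC _) (elC (sc _))) => //; first exact: act_elCC.
  by rewrite scM act_elCC.
- move=> d d'; apply: (mul (elD d) (elD (sd d)) (elD d') (elD (sd d')) (elD _) (elD (sd _))) => //; first exact: act_elDD.
  by rewrite sdM act_elDD.
- move=> c y; apply: (mul (elC c) (elC (sc c)) (elY y) (elZ y) (elY _) (elZ _)) => //; first exact: act_elCY.
  by rewrite act_elZC scK.
- move=> y d; apply: (mul (elY y) (elZ y) (elD d) (elD (sd d)) (elY _) (elZ _)) => //; first exact: act_elYD.
  by rewrite act_elDZ sdK.
- move=> x y; rewrite (dagger_doubled (bY x) (bZ x)).
  apply: (mul (elZ x) (elY x) (elY y) (elZ y) (elD _) (elD (sd _))) => //; first exact: act_elZY.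
  by rewrite -pr_conj act_elZY.
(* [dagger] exchanges the two elements of a pair; writing [c] as its double involution brings the
   new pair into the form that defines [alpha]. *)
- move=> c; have := dagger_doubled (bC c) (bC (sc c)); rewrite -{4}[c]scK; exact.
- move=> d; have := dagger_doubled (bD d) (bD (sd d)); rewrite -{4}[d]sdK; exact.
Qed.

End TotalCorrespondence.

(** * The linking algebra *)

Section LinkingAlgebra.
Variables (R : realType) (H : hilbert R).
Local Notation bop := (@bounded_operators R H).
Variables (U P : H -> H) (A B X : set (H -> H)).
Hypotheses (Us : selfadjoint U) (Uu : unitary U) (Pp : orthogonal_projection P) (PU : P \o U = U \o P).
Local Notation Q := (complement P).
Local Notation dag := (dagger U).
Hypotheses (Aa : closed_subalgebra A) (Ad : forall T, A T -> A (dag T)).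
Hypotheses (Ba : closed_subalgebra B) (Bd : forall T, B T -> B (dag T)).
Hypothesis (Xs : closed_subspace X).
Hypothesis (Ac : forall T, A T -> P \o T \o P = T).
Hypothesis (Bc : forall T, B T -> Q \o T \o Q = T).
Hypothesis (Xc : forall T, X T -> P \o T \o Q = T).
Hypothesis AX : forall S T, A S -> X T -> X (S \o T).
Hypothesis XB : forall S T, X S -> B T -> X (S \o T).
Hypothesis XX : forall S T, X S -> X T -> B (dag S \o T).

(* The upper half of the matrix conditions; the lower half is obtained by
   imposing them on the adjoint [dag T] as well. *)
Definition upper_linking (T : H -> H) : Prop :=
  [/\ forall x, X x -> X (P \o T \o x), X (P \o T \o Q) & B (Q \o T \o Q)].

Definition linking_algebra : set (H -> H) :=
  [set T | bop T /\ (upper_linking T /\ upper_linking (dag T))].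

Let Ub : bop U. Proof. by have [] := Uu. Qed.
Let UU : U \o U = id. Proof. exact: self_adjoint_unitary_involutive. Qed.
Let Pb : bop P. Proof. by have [] := Pp. Qed.
Let PP : P \o P = P. Proof. by have [] := Pp. Qed.
Let Ps : selfadjoint P. Proof. by have [] := Pp. Qed.
Let Qb : bop Q. Proof. exact: bop_complement. Qed.
Let QQ : Q \o Q = Q. Proof. exact: complement_idem. Qed.
Let dP : dag P = P. Proof. exact: dagger_commuting. Qed.
Let dQ : dag Q = Q.
Proof. by apply: dagger_commuting => //; [exact: selfadjoint_complement | exact: complement_commuting]. Qed.
Let Ab T : A T -> bop T. Proof. by have [[h _ _] _] := Aa; exact: h. Qed.
Let Bb T : B T -> bop T. Proof. by have [[h _ _] _] := Ba; exact: h. Qed.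
Let Xb T : X T -> bop T. Proof. by have [h _ _] := Xs; exact: h. Qed.
Let B0 : B 0. Proof. by have [[_ [h _] _] _] := Ba. Qed.
Let X0 : X 0. Proof. by have [_ [h _] _] := Xs. Qed.
Let BD S T : B S -> B T -> B (S + T).
Proof. by have [[_ [_ h] _] _] := Ba; move=> BS BT; have := h 1 S T BS BT; rewrite scale1r. Qed.
Let XD S T : X S -> X T -> X (S + T).
Proof. by have [_ [_ h] _] := Xs; move=> XS XT; have := h 1 S T XS XT; rewrite scale1r. Qed.

Lemma compl_P x : Q (P x) = 0. Proof. by rewrite /complement (compE PP) subrr. Qed.
Lemma P_compl x : P (Q x) = 0. Proof. by rewrite /complement bopB // (compE PP) subrr. Qed.
Lemma split_PQ x : x = P x + Q x. Proof. by rewrite /complement addrC subrK. Qed.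

Lemma bop_fun0 T : bop T -> T 0 = 0. Proof. by move=> [Tl _]; exact: lin_zero. Qed.

Lemma left_P T : P \o T \o Q = T -> forall x, P (T x) = T x /\ Q (T x) = 0.
Proof. by move=> h x; rewrite -h /= (compE PP) compl_P. Qed.

Lemma right_Q T : bop T -> P \o T \o Q = T -> forall x, T (Q x) = T x /\ T (P x) = 0.
Proof. by move=> Tb h x; rewrite -h /= (compE QQ) compl_P // bop_fun0 // bop_fun0. Qed.

(** Block multiplication, with P + Q = 1 inserted between [S] and [T]. The block Q S P is controlled
    as [dag] of P (dag S) Q, an element of [X], so its products with elements of [X] land in [B] by
    [XX]. *)
Lemma upper_linking_comp S T : bop S -> bop T -> upper_linking S -> upper_linking (dag S) ->
  upper_linking T -> upper_linking (dag T) -> upper_linking (S \o T).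
Proof.
move=> Sb Tb [S1 S2 S3] [_ S2' _] [T1 T2 T3] [_ T2' _].
have PSb : bop (P \o S) by exact: bop_comp.
have dag_PQ V : bop V -> dag (P \o dag V \o Q) = Q \o V \o P.
  move=> Vb; have Vd := bop_dagger Ub Vb.
  by rewrite (dagger_comp UU (bop_comp Pb Vd) Qb) (dagger_comp UU Pb Vd) dQ dP daggerK.
have QTX x : X x -> B (Q \o T \o x).
  move=> Xx; have := XX T2' Xx; rewrite dag_PQ //.
  by congr B; apply/funext => v /=; have [-> _] := left_P (Xc Xx) v.
split.
- move=> x Xx; have -> : P \o (S \o T) \o x = (P \o S \o (P \o T \o x)) + (P \o S \o Q \o (Q \o T \o x)).
    apply/funext => v; rewrite -[RHS]/(P (S (P (T (x v)))) + P (S (Q (Q (T (x v)))))) /= (compE QQ).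
    by rewrite -bopD // -bopD // -split_PQ.
  by apply: XD; [apply: S1; exact: T1 | apply: XB => //; exact: QTX].
- have -> : P \o (S \o T) \o Q = (P \o S \o (P \o T \o Q)) + (P \o S \o Q \o (Q \o T \o Q)).
    apply/funext => v; rewrite -[RHS]/(P (S (P (T (Q v)))) + P (S (Q (Q (T (Q v)))))) /= (compE QQ).
    by rewrite -bopD // -bopD // -split_PQ.
  by apply: XD; [exact: S1 | exact: XB].
- have -> : Q \o (S \o T) \o Q = (dag (P \o dag S \o Q) \o (P \o T \o Q)) + (Q \o S \o Q \o (Q \o T \o Q)).
    rewrite dag_PQ //; apply/funext => v.
    rewrite -[RHS]/(Q (S (P (P (T (Q v))))) + Q (S (Q (Q (T (Q v)))))) /= (compE QQ) (compE PP).
    by rewrite -bopD // -bopD // -split_PQ.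
  by apply: BD; [exact: XX | have [_ h] := Ba; exact: h].
Qed.

Lemma upper_linking_lincomb a S T : bop S -> bop T -> upper_linking S -> upper_linking T ->
  upper_linking (a *: S + T).
Proof.
move=> Sb Tb [S1 S2 S3] [T1 T2 T3].
have [_ [_ Xl] _] := Xs; have [[_ [_ Bl] _] _] := Ba.
have E (V W : H -> H) : bop V -> V \o (a *: S + T) \o W = a *: (V \o S \o W) + (V \o T \o W).
  by move=> Vb; apply/funext => v /=; rewrite -[(_ + _) (W v)]/(a *: S (W v) + T (W v)) bopD // bopZ.
split; rewrite ?E //.
- by move=> x Xx; rewrite E //; apply: Xl; [exact: S1 | exact: T1].
- exact: Xl.
- exact: Bl.
Qed.

Lemma upper_linking_closed : norm_closed [set T | bop T /\ upper_linking T].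
Proof.
have [_ _ Xcl] := Xs; have [[_ _ Bcl] _] := Ba.
move=> u T uE Tb uT; split=> //; split=> [x Xx||].
- apply: (norm_closed_sandwich Xcl Pb (Xb Xx) _ Tb uT).2 => n.
  by have [ub [h _ _]] := uE n; split; [|exact: h].
- by apply: (norm_closed_sandwich Xcl Pb Qb _ Tb uT).2 => n; have [ub [_ h _]] := uE n.
- by apply: (norm_closed_sandwich Bcl Qb Qb _ Tb uT).2 => n; have [ub [_ _ h]] := uE n.
Qed.

Lemma linking_closed_subalgebra : closed_subalgebra linking_algebra.
Proof.
split.
  split=> [T []//||].
  - have u0 : upper_linking 0.
      have z V : P \o 0 \o V = 0 by apply/funext => v; rewrite /= bop_fun0.
      have z' : Q \o 0 \o Q = 0 by apply/funext => v; rewrite /= bop_fun0.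
      by split; rewrite ?z ?z' // => x _; rewrite z.
    split; first by split; [exact: bop_zero | rewrite dagger0].
    move=> a S T [Sb [S1 S2]] [Tb [T1 T2]]; split; first by apply: bop_add => //; exact: bop_scale.
    split; first exact: upper_linking_lincomb.
    by rewrite dagger_lincomb //; apply: upper_linking_lincomb => //; exact: bop_dagger.
  - move=> u T uE Tb uT; split=> //; split.
      by apply: (upper_linking_closed _ Tb uT).2 => n; have [ub [h _]] := uE n.
    apply: ((norm_closed_dagger Ub Us UU upper_linking_closed) u T _ Tb uT).2.2 => n.
    by have [ub [_ h]] := uE n; split=> //; split=> //; exact: bop_dagger.
move=> S T [Sb [S1 S2]] [Tb [T1 T2]]; split; first exact: bop_comp.
split; first exact: upper_linking_comp.
by rewrite dagger_comp //; apply: upper_linking_comp => //; rewrite ?daggerK //; exact: bop_dagger.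
Qed.

Lemma linking_dagger T : linking_algebra T -> linking_algebra (dag T).
Proof. by move=> [Tb [T1 T2]]; split; [exact: bop_dagger | rewrite daggerK]. Qed.

Lemma linking_left T : linking_algebra T -> linking_algebra (P \o T).
Proof.
move=> [Tb [[T1 T2 T3] [T1' T2' T3']]]; have Td := bop_dagger Ub Tb; split; first exact: bop_comp.
rewrite (dagger_comp UU Pb Tb) dP; split; split.
- move=> x Xx; rewrite (_ : _ \o _ = P \o T \o x); first exact: T1.
  by apply/funext => v; rewrite /= (compE PP).
- by rewrite (_ : _ \o _ = P \o T \o Q) //; apply/funext => v; rewrite /= (compE PP).
- by rewrite (_ : _ \o _ = 0) //; apply/funext => v; rewrite /= compl_P.
- move=> x Xx; rewrite (_ : _ \o _ = P \o dag T \o x); first exact: T1'.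
  apply/funext => v /=.
  by have [-> _] := left_P (Xc Xx) v.
- by rewrite (_ : _ \o _ = 0) //; apply/funext => v; rewrite /= P_compl bop_fun0 // bop_fun0.
- by rewrite (_ : _ \o _ = 0) //; apply/funext => v; rewrite /= P_compl bop_fun0 // bop_fun0.
Qed.

Lemma linking_right T : linking_algebra T -> linking_algebra (T \o P).
Proof.
move=> ET; have [Tb _] := ET; have := linking_dagger (linking_left (linking_dagger ET)).
by rewrite (dagger_comp UU Pb (bop_dagger Ub Tb)) dP daggerK.
Qed.

(** In general this is only an inclusion: the corner also contains the products of [S] with [dag T]
    for [S] and [T] in [X]. *)
Lemma linking_corner11 : A `<=` corner P linking_algebra P.
Proof.
have up a : A a -> upper_linking a.
  move=> Aa'; have aE := Ac Aa'; split.
  - move=> x Xx; rewrite (_ : _ \o _ = a \o x); first exact: AX.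
    by apply/funext => v; rewrite -aE /= (compE PP).
  - rewrite (_ : _ \o _ = 0) //; apply/funext => v.
    by rewrite -aE /= P_compl !bop_fun0 //; exact: Ab.
  - by rewrite (_ : _ \o _ = 0) //; apply/funext => v; rewrite -aE /= compl_P.
move=> a Aa'; exists a; last exact: Ac.
by split; [exact: Ab | split; apply: up => //; exact: Ad].
Qed.

Lemma linking_corner12 : corner P linking_algebra Q = X.
Proof.
apply/seteqP; split=> [T [V [_ [[_ h _] _]] <-] //|x Xx].
have xb := Xb Xx; have xE := Xc Xx; exists x => //; split=> //; split.
  split.
  - move=> y Xy; rewrite (_ : _ \o _ = 0) //; apply/funext => v /=.
    have [<- _] := left_P (Xc Xy) v; have [_ ->] := right_Q xb xE (y v); exact: bop_fun0.
  - by rewrite xE.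
  - by rewrite (_ : _ \o _ = 0) //; apply/funext => v /=; have [_ ->] := left_P xE (Q v).
have db := bop_dagger Ub xb.
have dE : dag x = Q \o dag x \o P.
  by rewrite -{1}xE (dagger_comp UU (bop_comp Pb xb) Qb) (dagger_comp UU Pb xb) dQ dP.
have Pd v : P (dag x v) = 0 by rewrite dE /= P_compl.
split.
- by move=> y Xy; rewrite (_ : _ \o _ = 0) //; apply/funext => v; rewrite /= Pd.
- by rewrite (_ : _ \o _ = 0) //; apply/funext => v; rewrite /= Pd.
- by rewrite (_ : _ \o _ = 0) //; apply/funext => v; rewrite dE /= P_compl !bop_fun0.
Qed.

Lemma linking_corner22 : corner Q linking_algebra Q = B.
Proof.
apply/seteqP; split=> [T [V [_ [[_ _ h] _]] <-] //|b Bb'].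
have up c : B c -> upper_linking c.
  move=> Bc'; have cE := Bc Bc'; have Pc v : P (c v) = 0 by rewrite -cE /= P_compl.
  split; last by rewrite cE.
  - by move=> x Xx; rewrite (_ : _ \o _ = 0) //; apply/funext => v; rewrite /= Pc.
  - by rewrite (_ : _ \o _ = 0) //; apply/funext => v; rewrite /= Pc.
exists b; last exact: Bc.
by split; [exact: Bb | split; apply: up => //; exact: Bd].
Qed.

Lemma linking_standard_form :
  [/\ is_operator_star_algebra (bh_staralgebra U linking_algebra),
      @is_standard_form R (bh_staralgebra U linking_algebra) H id U
    & @compatible_projection R (bh_staralgebra U linking_algebra) H id U P].
Proof.
have Ea := linking_closed_subalgebra.
split.
- apply: bh_operator_star_algebra => // T; exact: linking_dagger.
- split=> //=; rewrite ?image_id //.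
    have h : @completely_bounded R (bh_space linking_algebra) (bh_space linking_algebra) id.
      split=> //; exists 1 => n x _; rewrite mul1r (_ : map_mx id x = x) //.
      by apply/matrixP => i j; rewrite mxE.
    by split=> //; exists id.
  move=> T [Tb _]; rewrite /dagger; apply/funext => v /=.
  by rewrite !(compE UU).
- split=> //= T ET; [exists (P \o T) => //; exact: linking_left | exists (T \o P) => //; exact: linking_right].
Qed.

End LinkingAlgebra.

(** * Subspaces as types *)

Section SubspaceType.
Variables (K : pzRingType) (V : lmodType K) (E : set V) (Es : subspace_set E).

(** The proof that [E] is a subspace is an argument, so that the closure instance below can be found
    from the predicate alone. *)
Definition subspace_pred of subspace_set E : {pred V} := fun v => `[< E v >].

Lemma subspace_pred_closed : submod_closed (subspace_pred Es).
Proof.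
have [E0 El] := Es; split=> [|a x y /asboolP Ex /asboolP Ey]; apply/asboolP => //; exact: El.
Qed.

HB.instance Definition _ := GRing.isSubmodClosed.Build K V (subspace_pred Es) subspace_pred_closed.

Record subspace_type := SubspaceElt { subspace_val :> V; _ : subspace_val \in subspace_pred Es }.
HB.instance Definition _ := [isSub for subspace_val].
HB.instance Definition _ := [Choice of subspace_type by <:].
HB.instance Definition _ := [SubChoice_isSubLmodule of subspace_type by <:].

Definition subspace_elt v (Ev : E v) : subspace_type := SubspaceElt (asboolT Ev).

Lemma subspace_valP (x : subspace_type) : E (subspace_val x).
Proof. by case: x => v /= /asboolP. Qed.

Lemma subspace_ext (x y : subspace_type) : subspace_val x = subspace_val y -> x = y.
Proof. exact: val_inj. Qed.

Lemma subspace_val_sum (I : finType) (F : I -> subspace_type) :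
  subspace_val (\sum_i F i) = \sum_i subspace_val (F i).
Proof. exact: (big_morph subspace_val). Qed.

Definition subspace_proj (v : V) : subspace_type := insubd 0 v.

Lemma subspace_projK v : E v -> subspace_val (subspace_proj v) = v.
Proof. by move=> Ev; rewrite /subspace_proj /insubd insubT //; apply/asboolP. Qed.

Lemma subspace_valK (x : subspace_type) : subspace_proj (subspace_val x) = x.
Proof. by apply: subspace_ext; rewrite subspace_projK //; exact: subspace_valP. Qed.

Lemma subspace_proj_linear a v w : E v -> E w -> subspace_proj (a *: v + w) = a *: subspace_proj v + subspace_proj w.
Proof.
have [_ El] := Es; move=> Ev Ew; apply: subspace_ext; rewrite subspace_projK; last exact: El.
by rewrite -[RHS]/(a *: subspace_val _ + subspace_val _) !subspace_projK.
Qed.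

End SubspaceType.

Section OperatorSpaceType.
Variables (R : realType) (V : mnspace R) (Vs : is_operator_space V).
Local Notation T := (subspace_type (os_subspace Vs)).
Local Notation vl := (@subspace_val _ _ _ (os_subspace Vs)).

Definition sub_norm n (x : 'M[T]_n) : R := mxnorm (map_mx vl x).

Lemma mx_in_val m n (x : 'M[T]_(m, n)) : mx_in (carrier V) (map_mx vl x).
Proof. by move=> i j; rewrite mxE; exact: subspace_valP. Qed.

Lemma sub_matrix_norm : matrix_norm sub_norm.
Proof.
have D n (x y : 'M[T]_n) : sub_norm (x + y) <= sub_norm x + sub_norm y.
  rewrite /sub_norm (_ : map_mx _ _ = map_mx vl x + map_mx vl y).
    by apply: (os_normD Vs); exact: mx_in_val.
  by apply/matrixP => i j; rewrite !mxE.
split=> // [n x|n l x m|n m x y].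
(* Nonnegativity is derived from the triangle inequality: 0 = |x - x| <= |x| + |-x| = 2 |x|. *)
- have Z (a : R[i]) : sub_norm (map_mx ( *:%R a) x) = rnorm a * sub_norm x.
    rewrite /sub_norm -(os_normZ Vs); last exact: mx_in_val.
    by congr mxnorm; apply/matrixP => i j; rewrite !mxE.
  have z0 : sub_norm (x + map_mx ( *:%R (-1)) x) = 0.
    have -> : x + map_mx ( *:%R (-1)) x = map_mx ( *:%R 0) x.
      by apply/matrixP => i j; rewrite !mxE scaleN1r subrr scale0r.
    by rewrite Z rnorm0 mul0r.
  have := D n x (map_mx ( *:%R (-1)) x); rewrite z0 Z rnormN rnorm1 mul1r; lra.
- rewrite /sub_norm (_ : map_mx _ _ = mulmx_by (fun v (a : R[i]) => a *: v) (mulmx_by *:%R l (map_mx vl x)) m).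
    by apply: (os_scale Vs); exact: mx_in_val.
  apply/matrixP => i j; rewrite !mxE subspace_val_sum; apply: eq_bigr => k _.
  rewrite -[LHS]/(_ *: vl _) !mxE subspace_val_sum; congr (_ *: _).
  by apply: eq_bigr => k' _; rewrite !mxE.
- rewrite /sub_norm (_ : map_mx _ _ = block_mx (map_mx vl x) 0 0 (map_mx vl y)).
    by apply: (os_dsum Vs); exact: mx_in_val.
  exact: map_block0.
Qed.

Lemma sub_norm_proj n (x : 'M[V]_n) : mx_in (carrier V) x ->
  sub_norm (map_mx (@subspace_proj _ _ _ (os_subspace Vs)) x) = mxnorm x.
Proof.
move=> xE; congr mxnorm; apply/matrixP => i j; rewrite !mxE subspace_projK //; exact: xE.
Qed.

Section Embedding.
Variables (H : hilbert R) (P Q : H -> H) (f : T -> H -> H).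
Hypothesis fe : corner_embedding P Q sub_norm f.
Local Notation F := (range f).
Local Notation fl := (ce_linear fe).

(* Off the carrier the values are those at [0], by the default of [insubd]. *)
Definition extend_embedding (v : V) : H -> H := f (subspace_proj (os_subspace Vs) v).
Definition embedding_inverse (S : H -> H) : V := vl (xget 0 [set x | f x = S]).

Lemma embedding_sub x y : f (x - y) = f x - f y.
Proof. by rewrite addrC -[- y]scaleN1r fl scaleN1r addrC. Qed.

Lemma sub_norm_eq0 n (x : 'M[T]_n) : sub_norm x = 0 -> x = 0.
Proof.
move=> x0; have := os_norm_eq0 Vs (mx_in_val x) x0 => /matrixP h.
by apply/matrixP => i j; apply: subspace_ext; have := h i j; rewrite !mxE.
Qed.

Lemma embedding_injective : injective f.
Proof.
move=> x y fxy; have xy0 : f (x - y) = 0 by rewrite embedding_sub fxy subrr.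
have : sub_norm (const_mx (x - y) : 'M_1) = 0.
  apply/eqP; rewrite eq_le (mn_ge0 sub_matrix_norm) andbT.
  rewrite (le_trans (ce_lower fe _)) // (_ : map_mx f _ = 0); last by apply/matrixP => i j; rewrite !mxE.
  have b0 : mx_in (@bounded_operators R H) (0 : 'M_1) by move=> i j; rewrite mxE; exact: bop_zero.
  have := opnormZ 0 b0; rewrite rnorm0 mul0r (_ : map_mx _ 0 = 0) => [->|]; first by rewrite mulr0.
  by apply/matrixP => i j; rewrite !mxE scaler0.
move=> /sub_norm_eq0 /matrixP/(_ 0 0); rewrite !mxE => /eqP; by rewrite subr_eq0 => /eqP.
Qed.

Lemma embedding_inverseK x : embedding_inverse (f x) = vl x.
Proof.
rewrite /embedding_inverse; congr vl; apply: embedding_injective.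
by have := @xgetPex _ 0 [set y | f y = f x] (ex_intro _ x erefl).
Qed.

Lemma extend_embeddingK v : carrier V v -> embedding_inverse (extend_embedding v) = v.
Proof. by move=> Vv; rewrite /extend_embedding embedding_inverseK subspace_projK. Qed.

Lemma embedding_inverse_extend S : F S -> extend_embedding (embedding_inverse S) = S.
Proof. by move=> [x _ <-]; rewrite embedding_inverseK /extend_embedding subspace_valK. Qed.

Lemma embedding_cb_isomorphism : @cb_isomorphism R V (bh_space F) extend_embedding.
Proof.
split.
  split=> [v Vv|a x y Vx Vy|]; first by exists (subspace_proj (os_subspace Vs) v).
    by rewrite /extend_embedding subspace_proj_linear // fl.
  exists 4 => n x xE; rewrite -sub_norm_proj //.
  rewrite -(_ : map_mx f (map_mx (subspace_proj (os_subspace Vs)) x) = map_mx extend_embedding x); first exact: (ce_upper fe).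
  by apply/matrixP => i j; rewrite !mxE.
exists embedding_inverse; split=> [|v|S]; [|exact: extend_embeddingK|exact: embedding_inverse_extend].
split=> [S [x _ <-]|a S S' [x _ <-] [y _ <-]|].
- by rewrite embedding_inverseK; exact: subspace_valP.
- by rewrite -fl !embedding_inverseK.
- exists 4 => n S SF.
  have Sy i j : {y | f y = S i j}.
    by apply: cid; have [y _ <-] := SF i j; exists y.
  pose y : 'M[T]_n := \matrix_(i, j) projT1 (Sy i j).
  have yE : map_mx f y = S by apply/matrixP => i j; rewrite !mxE (projT2 (Sy i j)).
  rewrite -yE (_ : map_mx _ _ = map_mx vl y); first exact: (ce_lower fe).
  by apply/matrixP => i j; rewrite !mxE embedding_inverseK.
Qed.

(** By [ce_lower] the preimages of a norm convergent sequence are Cauchy and have a limit by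
    completeness of [V]; by [ce_upper] its image is the limit of the given sequence. *)
Lemma embedding_closed : closed_subspace F.
Proof.
split=> [S [x _ <-]||]; first exact: (ce_bop fe).
  split; first by exists 0 => //; rewrite (lin_zero fl).
  by move=> a S S' [x _ <-] [y _ <-]; exists (a *: x + y) => //; exact: fl.
move=> u S uF Sb uS.
have uy n : {y | f y = u n} by apply: cid; have [y _ <-] := uF n; exists y.
pose y n := projT1 (uy n).
have yE n : f (y n) = u n := projT2 (uy n).
have ub n : bounded_operators (u n) by rewrite -yE; exact: (ce_bop fe).
have usb n : bounded_operators (u n - S) by exact: bop_sub.
have uS0 n : 0 <= operator_norm (u n - S) by exact: operator_norm_ge0.
have lower x : vnorm (vl x) <= 4 * operator_norm (f x).
  have := ce_lower fe (const_mx x : 'M_1).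
  by rewrite /sub_norm !map_const_mx.
have upper x : operator_norm (f x) <= 4 * vnorm (vl x).
  have := ce_upper fe (const_mx x : 'M_1).
  by rewrite /sub_norm !map_const_mx.
have onD (A B : H -> H) : bounded_operators A -> bounded_operators B -> operator_norm (A - B) <= operator_norm A + operator_norm B.
  move=> Ab Bb; apply: operator_norm_le => [||x]; first exact: bop_sub.
    by rewrite addr_ge0 ?operator_norm_ge0.
  rewrite fctBE (le_trans (rnormD _ _)) // rnormN mulrDl.
  by apply: lerD; exact: operator_norm_ball.
have [|e e0|l [Vl ul]] := os_complete Vs (u := fun n => vl (y n)); first by move=> n; exact: subspace_valP.
  (* Two errors below e / 8, multiplied by the constant 4 of [ce_lower], stay below e. *)
  have e8 : 0 < e / 8 by rewrite divr_gt0.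
  have [N hN] := ((cvg0P uS0).1 uS) _ e8.
  exists N => p q Np Nq; have := lower (y p - y q); rewrite embedding_sub !yE.
  rewrite (_ : vl (y p - y q) = vl (y p) - vl (y q)) // => h; apply: le_lt_trans h _.
  have -> : u p - u q = (u p - S) - (u q - S) by rewrite opprB addrA subrK.
  have := onD _ _ (usb p) (usb q); have := hN p Np; have := hN q Nq.
  move: (operator_norm (u p - S)) (operator_norm (u q - S)) (operator_norm _) => a b c; lra.
pose x := subspace_elt (os_subspace Vs) Vl; exists x => //.
have vn0 n : 0 <= vnorm (vl (y n) - l) by have := mn_ge0 sub_matrix_norm (const_mx (y n - x) : 'M_1); rewrite /sub_norm map_const_mx.
have fxb := ce_bop fe x.
have db : bounded_operators (S - f x) by exact: bop_sub.
suff d0 : operator_norm (S - f x) = 0.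
  apply/funext => v; apply/esym/eqP; rewrite -subr_eq0; apply/eqP; apply: rnorm0_eq0; apply/eqP.
  rewrite eq_le rnorm_ge0 andbT; have := operator_norm_ball v db; rewrite d0 mul0r; exact.
apply/eqP; rewrite eq_le operator_norm_ge0 // andbT; apply: ler_of_addgt0 => e e0; rewrite add0r.
have e8 : 0 < e / 8 by rewrite divr_gt0.
have [N hN] := ((cvg0P uS0).1 uS) _ e8.
have [M hM] := ((cvg0P vn0).1 ul) _ e8.
have := hN _ (leq_maxl N M); have := hM _ (leq_maxr N M); set n := maxn N M => h1 h2.
have h3 := upper (y n - x); rewrite embedding_sub yE (_ : vl (y n - x) = vl (y n) - l) // in h3.
have -> : S - f x = (u n - f x) - (u n - S) by rewrite opprB [RHS]addrC addrA subrK.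
have := onD _ _ (bop_sub (ub n) fxb) (usb n).
move: (vnorm _) (operator_norm (u n - S)) (operator_norm (u n - f x)) (operator_norm _) h1 h2 h3 => a b c d; lra.
Qed.

End Embedding.
End OperatorSpaceType.

Section SubspaceOperations.
Variables (K : pzRingType) (V1 V2 V3 : lmodType K) (E1 : set V1) (E2 : set V2) (E3 : set V3).
Variables (s1 : subspace_set E1) (s2 : subspace_set E2) (s3 : subspace_set E3) (op : V1 -> V2 -> V3).
Hypothesis op_bilinear : bilinear_on E1 E2 E3 op.

Lemma bilinear_closed x y : E1 x -> E2 y -> E3 (op x y).
Proof. by have [h _ _] := op_bilinear; exact: h. Qed.

Definition sub_op (x : subspace_type s1) (y : subspace_type s2) : subspace_type s3 :=
  subspace_elt s3 (bilinear_closed (subspace_valP x) (subspace_valP y)).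

Lemma sub_op_linearl y : linear (sub_op^~ y).
Proof.
have [_ h _] := op_bilinear; move=> a x x'; apply: subspace_ext => /=.
by rewrite h //; exact: subspace_valP.
Qed.

Lemma sub_op_linearr x : linear (sub_op x).
Proof.
have [_ _ h] := op_bilinear; move=> a y y'; apply: subspace_ext => /=.
by rewrite h //; exact: subspace_valP.
Qed.

Lemma val_mulmx_by m n p (x : 'M_(m, n)) (y : 'M_(n, p)) :
  map_mx (@subspace_val _ _ _ s3) (mulmx_by sub_op x y) =
  mulmx_by op (map_mx (@subspace_val _ _ _ s1) x) (map_mx (@subspace_val _ _ _ s2) y).
Proof.
apply/matrixP => i j; rewrite !mxE subspace_val_sum.
by apply: eq_bigr => k _; rewrite !mxE.
Qed.

Lemma proj_op x y : E1 x -> E2 y -> subspace_proj s3 (op x y) = sub_op (subspace_proj s1 x) (subspace_proj s2 y).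
Proof.
move=> Ex Ey; apply: subspace_ext; rewrite subspace_projK /= ?subspace_projK //.
exact: bilinear_closed.
Qed.

End SubspaceOperations.

(** * Realization of an abstract correspondence *)

Section Realization.
Variables (R : realType) (C D : mnstaralgebra R) (Y : mncorrespondence C D).
Hypothesis Yc : is_operator_star_correspondence Y.

Let Ca := osc_algebra Yc.
Let Ym := osc_star_module Yc.
Let Da := osm_algebra Ym.
Let Yr := osm_module Ym.
Let Yl := osc_left_module Yc.
Let Cs := oa_space (osa_algebra Ca).
Let Ds := oa_space (osa_algebra Da).
Let Ys := rom_space Yr.

Local Notation TC := (subspace_type (os_subspace Cs)).
Local Notation TD := (subspace_type (os_subspace Ds)).
Local Notation TY := (subspace_type (os_subspace Ys)).

Definition sub_invol (A : mnstaralgebra R) (Aa : is_operator_star_algebra A)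
    (x : subspace_type (os_subspace (oa_space (osa_algebra Aa)))) :
    subspace_type (os_subspace (oa_space (osa_algebra Aa))) :=
  subspace_elt _ (osa_closed Aa (subspace_valP x)).

Definition sub_pairing (x y : TY) : TD :=
  subspace_elt _ (osm_closed Ym (subspace_valP x) (subspace_valP y)).

Lemma sub_representation : exists (H : hilbert R) (U P : H -> H) alpha beta phi,
  corner_representation (@sub_norm _ _ Cs) (@sub_norm _ _ Ds) (@sub_norm _ _ Ys)
    (sub_op (os_subspace Cs) (oa_bilinear (osa_algebra Ca)))
    (sub_op (os_subspace Ds) (oa_bilinear (osa_algebra Da)))
    (sub_op (os_subspace Ys) (lom_bilinear Yl))
    (sub_op (os_subspace Ys) (rom_bilinear Yr))
    sub_pairing (sub_invol (Aa := Ca)) (sub_invol (Aa := Da)) U P alpha beta phi.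
Proof.
have valT (V : mnspace R) (Vs : is_operator_space V) n (x : 'M[subspace_type (os_subspace Vs)]_n) :
    map_mx (@subspace_val _ _ _ (os_subspace Vs)) x^T = (map_mx (@subspace_val _ _ _ (os_subspace Vs)) x)^T.
  by apply/matrixP => i j; rewrite !mxE.
have inv_norm (A : mnstaralgebra R) (Aa : is_operator_star_algebra A) n (x : 'M_n) :
    sub_norm (Vs := oa_space (osa_algebra Aa)) (map_mx (sub_invol (Aa := Aa)) x^T) = sub_norm (Vs := oa_space (osa_algebra Aa)) x.
  rewrite /sub_norm -[RHS](osa_norm Aa); last exact: mx_in_val.
  by congr mxnorm; apply/matrixP => i j; rewrite !mxE.
apply: total_corner_representation.
- exact: sub_matrix_norm.
- exact: sub_matrix_norm.
- exact: sub_matrix_norm.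
- exact: sub_op_linearl.
- exact: sub_op_linearr.
- exact: sub_op_linearl.
- exact: sub_op_linearr.
- exact: sub_op_linearl.
- exact: sub_op_linearr.
- exact: sub_op_linearl.
- exact: sub_op_linearr.
- move=> x a y z; apply: subspace_ext => /=.
  by rewrite (osm_linear Ym) //; exact: subspace_valP.
- by move=> x y z; apply: subspace_ext; apply: (oa_assoc (osa_algebra Ca)); exact: subspace_valP.
- by move=> x y z; apply: subspace_ext; apply: (oa_assoc (osa_algebra Da)); exact: subspace_valP.
- by move=> x y z; apply: subspace_ext; apply: (lom_assoc Yl); exact: subspace_valP.
- by move=> x y z; apply: subspace_ext; apply: (rom_assoc Yr); exact: subspace_valP.
- by move=> x y z; apply: subspace_ext; apply: (osc_bimodule Yc); exact: subspace_valP.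
- by move=> x y z; apply: subspace_ext; apply: (osm_pairM Ym); exact: subspace_valP.
- by move=> x y; apply: subspace_ext; apply: (osm_pairC Ym); exact: subspace_valP.
- by move=> x y z; apply: subspace_ext; apply: (osc_adjoint Yc); exact: subspace_valP.
- by move=> a x y; apply: subspace_ext; apply: (osa_conjlinear Ca); exact: subspace_valP.
- by move=> a x y; apply: subspace_ext; apply: (osa_conjlinear Da); exact: subspace_valP.
- by move=> x y; apply: subspace_ext; apply: (osa_mul Ca); exact: subspace_valP.
- by move=> x y; apply: subspace_ext; apply: (osa_mul Da); exact: subspace_valP.
- by move=> x; apply: subspace_ext; apply: (osa_invol Ca); exact: subspace_valP.
- by move=> x; apply: subspace_ext; apply: (osa_invol Da); exact: subspace_valP.
- by move=> n x y; rewrite /sub_norm val_mulmx_by; apply: (oa_norm (osa_algebra Ca)); exact: mx_in_val.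
- by move=> n x y; rewrite /sub_norm val_mulmx_by; apply: (oa_norm (osa_algebra Da)); exact: mx_in_val.
- by move=> n x y; rewrite /sub_norm val_mulmx_by; apply: (lom_norm Yl); exact: mx_in_val.
- by move=> n x y; rewrite /sub_norm val_mulmx_by; apply: (rom_norm Yr); exact: mx_in_val.
- move=> n x y; have := osm_norm Ym (mx_in_val x) (mx_in_val y).
  rewrite /sub_norm -valT; congr (mxnorm _ <= _); apply/matrixP => i j; rewrite !mxE subspace_val_sum.
  by apply: eq_bigr => k _; rewrite !mxE.
- exact: inv_norm.
- exact: inv_norm.
Qed.

Lemma correspondence_realization :
  exists (L : mnstaralgebra R) (H : hilbert R) (pi : L -> H -> H) (U P : H -> H) (A : set (H -> H)),
    let piL := pi @` carrier L in
    let PLP := corner P piL P in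
    let B := corner (complement P) piL (complement P) in
    let X := corner P piL (complement P) in
    [/\ is_operator_star_algebra L, is_standard_form pi U, compatible_projection pi U P
      & [/\ closed_subalgebra A, A `<=` PLP, dagger U @` A = A
          & cb_isomorphic_correspondences Y (bh_correspondence U A B X)]].
Proof.
have [H [U [P [al [be [ph r]]]]]] := sub_representation.
have [[[Us Uu] Pp] PU] := (cr_selfadjoint r, cr_unitary r, cr_projection r, cr_commute r).
have [[Ea Eb] Ep] := (cr_alpha r, cr_beta r, cr_phi r).
pose A := range al; pose B := range be; pose X := range ph.
have Aa : closed_subalgebra A.
  split; first exact: (embedding_closed Ea).
  by move=> S T [x _ <-] [y _ <-]; rewrite -(cr_alphaM r); eexists.
have Ba : closed_subalgebra B.
  split; first exact: (embedding_closed Eb).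
  by move=> S T [x _ <-] [y _ <-]; rewrite -(cr_betaM r); eexists.
have Xs : closed_subspace X := embedding_closed Ep.
have Ad T : A T -> A (dagger U T) by move=> [x _ <-]; rewrite (cr_sc r); eexists.
have Bd T : B T -> B (dagger U T) by move=> [x _ <-]; rewrite (cr_sd r); eexists.
have Ac T : A T -> P \o T \o P = T by move=> [x _ <-]; exact: (ce_corner Ea).
have Bc T : B T -> complement P \o T \o complement P = T by move=> [x _ <-]; exact: (ce_corner Eb).
have Xc T : X T -> P \o T \o complement P = T by move=> [x _ <-]; exact: (ce_corner Ep).
have AX S T : A S -> X T -> X (S \o T) by move=> [x _ <-] [y _ <-]; rewrite -(cr_la r); eexists.
have XB S T : X S -> B T -> X (S \o T) by move=> [x _ <-] [y _ <-]; rewrite -(cr_ra r); eexists.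
have XX S T : X S -> X T -> B (dagger U S \o T) by move=> [x _ <-] [y _ <-]; rewrite -(cr_pr r); eexists.
pose E := linking_algebra U P B X.
have [La sf cp] : [/\ is_operator_star_algebra (bh_staralgebra U E),
    @is_standard_form R (bh_staralgebra U E) H id U
  & @compatible_projection R (bh_staralgebra U E) H id U P] by exact: linking_standard_form.
exists (bh_staralgebra U E), H, id, U, P, A => piL PLP B' X'.
have piLE : piL = E by exact: image_id.
have -> : X' = X by rewrite /X' piLE; exact: linking_corner12.
have -> : B' = B by rewrite /B' piLE; exact: linking_corner22.
split=> //; split=> //.
- by rewrite /PLP piLE; exact: linking_corner11.
- have [Ub _ _] := Uu; have UU := self_adjoint_unitary_involutive Us Uu; have [[Ab _ _] _] := Aa.
  apply/seteqP; split=> [T [S AS <-]|T AT]; first exact: Ad.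
  by exists (dagger U T); [exact: Ad | rewrite daggerK //; exact: Ab].
have starE (V : mnstaralgebra R) (Va : is_operator_star_algebra V) (P' : H -> H)
    (f : subspace_type (os_subspace (oa_space (osa_algebra Va))) -> H -> H) :
    corner_embedding P' P' (@sub_norm _ _ (oa_space (osa_algebra Va))) f ->
    (forall c c', f (sub_op (os_subspace (oa_space (osa_algebra Va))) (oa_bilinear (osa_algebra Va)) c c') = f c \o f c') ->
    (forall c, dagger U (f c) = f (sub_invol (Aa := Va) c)) ->
    @star_cb_isomorphism R V (bh_staralgebra U (range f)) (extend_embedding f).
  move=> fe fM fd; split; first exact: (embedding_cb_isomorphism fe).
    by move=> x y Vx Vy; have := fM (subspace_proj _ x) (subspace_proj _ y); rewrite -proj_op.
  move=> x Vx; rewrite /= /extend_embedding fd; congr f; apply: subspace_ext.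
  by rewrite /= !subspace_projK //; exact: (osa_closed Va).
exists (extend_embedding ph), (extend_embedding al), (extend_embedding be); split.
- exact: (embedding_cb_isomorphism Ep).
- by apply: starE; [exact: Ea | exact: (cr_alphaM r) | exact: (cr_sc r)].
- by apply: starE; [exact: Eb | exact: (cr_betaM r) | exact: (cr_sd r)].
split=> /=.
- by move=> a x Ca' Yx; have := cr_la r (subspace_proj _ a) (subspace_proj _ x); rewrite -proj_op.
- by move=> x b Yx Db; have := cr_ra r (subspace_proj _ x) (subspace_proj _ b); rewrite -proj_op.
- move=> x y Yx Yy; rewrite /extend_embedding -(cr_pr r); congr be; apply: subspace_ext.
  by rewrite /= !subspace_projK //; exact: (osm_closed Ym).
Qed.

End Realization.

Theorem theorem4p3 (R : realType) :
  (forall (L : mnstaralgebra R) (H : hilbert R) (pi : L -> H -> H)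
      (U P : H -> H),
    is_operator_star_algebra L ->
    is_standard_form pi U ->
    compatible_projection pi U P ->
    let piL := pi @` carrier L in
    let PLP := corner P piL P in
    let B := corner (complement P) piL (complement P) in
    let X := corner P piL (complement P) in
    [/\ closed_subalgebra PLP /\ is_operator_star_algebra (bh_staralgebra U PLP),
        closed_subalgebra B /\ is_operator_star_algebra (bh_staralgebra U B)
      & forall A : set (H -> H),
          closed_subalgebra A -> A `<=` PLP -> dagger U @` A = A ->
          closed_subspace X /\
          is_operator_star_correspondence (bh_correspondence U A B X)]) /\
  (forall (C D : mnstaralgebra R) (Y : mncorrespondence C D),
    is_operator_star_correspondence Y ->
    exists (L : mnstaralgebra R) (H : hilbert R) (pi : L -> H -> H)
        (U P : H -> H) (A : set (H -> H)),
      let piL := pi @` carrier L in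
      let PLP := corner P piL P in
      let B := corner (complement P) piL (complement P) in
      let X := corner P piL (complement P) in
      [/\ is_operator_star_algebra L,
          is_standard_form pi U,
          compatible_projection pi U P
        & [/\ closed_subalgebra A, A `<=` PLP, dagger U @` A = A
            & cb_isomorphic_correspondences Y (bh_correspondence U A B X)]]).
Proof.
by split; [exact: standard_form_corners | exact: correspondence_realization].
Qed.
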